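(* Let $Q:\mathbb{C}\to\mathbb{R}\cup\{+\infty\}$ be a lower semi-continuous potential, finite on a set of positive area, with $\liminf_{z\to\infty}\frac{Q(z)}{\log|z|}>2$, and let $S$ be its droplet. Assume that $Q$ is radially symmetric, $Q(z)=q(|z|)$ with $q$ a smooth function on $\mathbb{R}^+=(0,\infty)$, that $Q$ is subharmonic in $\mathbb{C}$, and that $Q$ is strictly subharmonic in a neighborhood of the outer boundary of $S$. Let $R_0$ be the radius of the outer boundary of $S$ and $\delta=\partial\bar\partial Q(R_0)$. For each $n$ let $\{z_j\}_1^n$ be the eigenvalues of the hard edge ensemble associated with $Q^S$, let $|z|_n=\max_{1\le j\le n}|z_j|$, and define $$\omega_n=R_0\,n\,\delta\,(|z|_n-R_0)\log 4 .$$ Then $$\lim_{n\to\infty}\mathbf{P}[\omega_n\le\xi]=e^{\xi},\qquad \xi\le 0,$$ uniformly for $\xi$ in every compact subset of $\mathbb{R}^-$.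
   Context: $\mathbb{R}^-=(-\infty,0]$. $dA(z)=dx\,dy/\pi$ is the normalized area measure on $\mathbb{C}$; $\partial=\frac12(\partial_x-i\partial_y)$, $\bar\partial=\frac12(\partial_x+i\partial_y)$, so $\Delta=4\partial\bar\partial=\partial_x^2+\partial_y^2$; strictly subharmonic means $\Delta Q>0$. The droplet $S=S_Q$ is the support of the equilibrium measure $\sigma_Q$, the unique minimizer of $$I_Q(\mu)=\iint_{\mathbb{C}^2}\log\frac{1}{|z-\zeta|}\,d\mu(\zeta)\,d\mu(z)+\int_{\mathbb{C}}Q\,d\mu$$ among compactly supported Borel probability measures $\mu$ on $\mathbb{C}$. For radially symmetric $Q$, the boundary of $S$ consists of circles centered at the origin; the outer boundary is the outermost one, so $R_0=\max_{z\in S}|z|$. The localized potential is $Q^S(z)=Q(z)$ for $z\in S$ and $Q^S(z)=+\infty$ for $z\notin S$. The hard edge ensemble associated with $Q^S$ (the eigenvalues of the random normal matrix model with potential $Q^S$) is the system of $n$ random points $z_1,\dots,z_n$ in $\mathbb{C}$ with joint probability density, with respect to $\prod_{j=1}^n dA(z_j)$, $$P_n(z_1,\dots,z_n)=\frac{1}{Z_n}\prod_{j\neq k}|z_j-z_k|\;e^{-n\sum_{j=1}^n Q^S(z_j)},$$ where the product is over all ordered pairs $(j,k)$ with $j\ne k$, $1\le j,k\le n$ (so that it equals $\prod_{j<k}|z_j-z_k|^2$), $e^{-\infty}=0$, and $Z_n$ is the normalizing constant. *)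

(* Defs.v *)
From HB Require Import structures.
From mathcomp Require Import all_boot all_order all_algebra.
From mathcomp Require Import all_classical all_reals all_analysis.

Set Implicit Arguments.
Unset Strict Implicit.
Unset Printing Implicit Defensive.

Import Order.TTheory GRing.Theory Num.Theory.
Import numFieldNormedType.Exports.

Local Open Scope classical_set_scope.
Local Open Scope ring_scope.

(* The complex plane is represented by [R * R], whose library topology and
   sigma-algebra are the usual Borel ones.  The library norm on [R * R] is the
   sup norm, hence the separate definition of the modulus. *)
Definition cmod (R : realType) (z : R * R) : R :=
  Num.sqrt (z.1 ^+ 2 + z.2 ^+ 2).

(* dA = dx dy / pi *)
Definition area (R : realType) : set (R * R) -> \bar R :=
  fun A => ((pi^-1)%:E * (lebesgue_measure \x lebesgue_measure) A)%E.

(* n-fold product of a (sigma-finite) measure. *)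
Fixpoint power_measure d (T : measurableType d) (R : realType)
    (mu : set T -> \bar R) (n : nat) : set (n.-tuple T) -> \bar R :=
  match n with
  | 0%N => fun A => dirac [tuple] A
  | m.+1 => pushforward (mu \x @power_measure d T R mu m)%E
              (fun p : T * m.-tuple T => [tuple of p.1 :: p.2])
  end.
Arguments power_measure {d T R} mu n.

Definition at_infinity (R : realType) : set_system (R * R) :=
  [set A | exists M : R, forall z, M < cmod z -> A z].

Definition laplacian (R : realType) (f : R * R -> R) (z : R * R) : R :=
  let e1 : R * R := (1, 0) in
  let e2 : R * R := (0, 1) in
  'D_e1 (fun w => 'D_e1 f w) z + 'D_e2 (fun w => 'D_e2 f w) z.

(* For real-valued f, the Wirtinger operators give
   d (dbar f) = (d_x - i d_y)(d_x + i d_y) f / 4 = laplacian f / 4. *)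
Definition ddbar (R : realType) (f : R * R -> R) (z : R * R) : R :=
  laplacian f z / 4.

Definition subharmonic (R : realType) (Q : R * R -> \bar R) : Prop :=
  [/\ forall z, (Q z < +oo)%E,
      lower_semicontinuous (fun z => - Q z)%E &
      forall (a : R * R) (r : R), 0 < r ->
        (Q a <= ((2 * pi)^-1)%:E *
          \int[lebesgue_measure]_(t in `[0%R, (2 * pi)%R])
            Q (a.1 + r * cos t, a.2 + r * sin t)%R)%E].

Definition support (R : realType) (mu : set (R * R) -> \bar R) : set (R * R) :=
  [set z | forall U : set (R * R), open U -> U z -> (0 < mu U)%E].

Definition energy (R : realType) (Q : R * R -> \bar R)
    (mu : set (R * R) -> \bar R) : \bar R :=
  (\int[mu \x mu]_p lne ((cmod (p.1 - p.2))%:E^-1) + \int[mu]_z Q z)%E.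

(* Equality of measures is only meaningful on measurable sets. *)
Definition is_equilibrium_measure (R : realType) (Q : R * R -> \bar R)
    (sigma : probability (R * R)%type R) : Prop :=
  compact (support sigma) /\
  forall mu : probability (R * R)%type R, compact (support mu) ->
    (energy Q sigma <= energy Q mu)%E /\
    (energy Q mu = energy Q sigma ->
     forall A, measurable A -> mu A = sigma A).

Definition is_droplet (R : realType) (Q : R * R -> \bar R) (S : set (R * R))
    : Prop :=
  exists2 sigma : probability (R * R)%type R,
    is_equilibrium_measure Q sigma & S = support sigma.

(* S being compact and nonempty, this supremum is a maximum. *)
Definition outer_radius (R : realType) (S : set (R * R)) : R :=
  sup (@cmod R @` S).

Definition localized (R : realType) (Q : R * R -> \bar R) (S : set (R * R))
    (z : R * R) : \bar R :=
  if z \in S then Q z else +oo%E.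

Definition gibbs_weight (R : realType) (V : R * R -> \bar R) (n : nat)
    (t : n.-tuple (R * R)%type) : \bar R :=
  ((\prod_(j < n) \prod_(k < n | j != k) cmod (tnth t j - tnth t k))%:E *
   expeR (- (n%:R%:E * \sum_(j < n) V (tnth t j))))%E.

Definition partition_function (R : realType) (V : R * R -> \bar R) (n : nat)
    : \bar R :=
  (\int[power_measure (@area R) n]_t gibbs_weight V t)%E.

Definition gibbs_density (R : realType) (V : R * R -> \bar R) (n : nat)
    (t : n.-tuple (R * R)%type) : \bar R :=
  (gibbs_weight V t / partition_function V n)%E.

Definition is_normal_matrix_ensemble (R : realType) (V : R * R -> \bar R)
    (n : nat) d (Omega : measurableType d) (P : probability Omega R)
    (z : Omega -> n.-tuple (R * R)%type) : Prop :=
  measurable_fun setT z /\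
  forall A : set (n.-tuple (R * R)%type), measurable A ->
    P (z @^-1` A) = (\int[power_measure (@area R) n]_(t in A)
                       gibbs_density V t)%E.

Definition max_modulus (R : realType) (n : nat) (t : n.-tuple (R * R)%type)
    : R :=
  \big[Num.max/0]_(j < n) cmod (tnth t j).

(* Main.v *)
Require Import Defs.
From HB Require Import structures.
From mathcomp Require Import all_boot all_order all_algebra.
From mathcomp Require Import all_fingroup cyclic separable cyclotomic complex.
From mathcomp Require Import all_classical all_reals all_analysis.
From mathcomp Require Import measurable_realfun.
From mathcomp Require Import ring lra.

Set Implicit Arguments.
Unset Strict Implicit.
Unset Printing Implicit Defensive.

Import Order.TTheory GRing.Theory Num.Theory.
Import numFieldNormedType.Exports.

Local Open Scope classical_set_scope.
Local Open Scope ring_scope.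

(** Write s = |z|^2 and Q z = V(|z|^2), and put h(s) = s V'(s).  Then the Laplacian of Q at z
is 4 h'(|z|^2), so subharmonicity makes h nondecreasing; finiteness of Q at the origin
gives h >= 0 and h(0+) = 0, and the growth condition makes h reach 1.

The droplet.  Uniqueness of the minimizer makes the equilibrium measure rotation
invariant, so it is determined by its radial distribution function F(t), the mass of
{|z|^2 <= t}.  Averaging log 1/|z - w| over rotations of w gives log 1/max(|z|,|w|), and
layer-cake integration shows that the energy is a constant plus half of
int (F(t)^2 - 2 h(t) F(t)) dt/t, which is minimized pointwise over 0 <= F <= 1 by
F = min(h,1) (lemma [sigma_disc]).  Hence R_0^2 = T where T is the first point with
h(T) = 1, the droplet contains a full annulus inside its outer edge because h is strictly
increasing there, and delta = h'(T).

The gap probability.  For weights depending on |z| only, averaging the squared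
Vandermonde product over independent rotations of the variables leaves the sum over
permutations of the monomials prod |z_j|^(2 s(j)).  Thus numerator and partition function
both factor, and the probability that all |z_j|^2 are at most T - x is
prod_(1 <= k <= n) (1 - p_k(x)), where p_k(x) is the fraction of the mass of the density
s^(n-k) e^(-n V(s)) on the droplet lying in ]T - x, T] (lemma [gap_product]).

The limit.  With Psi(s) = ln s - V(s) the density is e^(n Psi(s) - k ln s), and Psi has a
critical point at T with Psi''(T) = - delta/T.  In the variables s = T - 2T mu v and t = k mu,
where mu = (2 T delta n)^(-1/2), the density relative to its value at T tends to
e^(-v^2 + 2tv).  If n x_n -> alpha, then p_k(x_n) is therefore close to
mu alpha delta / G(t), where
G(t) = int_0^oo e^(-v^2 + 2tv) dv = e^(t^2) Phi(t) and Phi(t) = int_(-oo)^t e^(-w^2) dw.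
The sum of the p_k is a Riemann sum of mesh mu for alpha delta int_0^oo dt / G(t).  As 1/G is
the derivative of ln Phi and Phi doubles between 0 and +oo, this integral is ln 2
(lemma [integral_inv_half_gauss]), which is where log 4 comes from.  So the product tends
to e^(- alpha delta ln 2) (lemma [prod_edge_fraction_cvg]); the event omega_n <= xi
corresponds to alpha = - 2 xi / (delta ln 4), and the limit is e^xi.  Distribution functions
are monotone and e^xi is Lipschitz on the negative half-line, so the pointwise limit
is uniform on compact sets. *)

(** * Area measure: affine maps, rotations, radial functions *)

(** Bundling the pushforward with a proof of measurability of the map lets it appear as
    the measure of an integral. *)
Definition pushm d d' (T1 : measurableType d) (T2 : measurableType d')
  (R : realType) (m : {measure set T1 -> \bar R}) (f : T1 -> T2)
  (mf : measurable_fun setT f) : {measure set T2 -> \bar R} :=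
  measure_function_pushforward__canonical__measure_function_Measure m mf.

Lemma pushmE d d' (T1 : measurableType d) (T2 : measurableType d')
  (R : realType) (m : {measure set T1 -> \bar R}) (f : T1 -> T2)
  (mf : measurable_fun setT f) A : pushm m mf A = m (f @^-1` A).
Proof. by []. Qed.

(** By uniqueness of Lebesgue measure it is enough to compare both sides on half-open
    intervals. *)
Lemma lebesgue_affine (R : realType) (a b : R) (A : set R) : 0 < a ->
  measurable A ->
  (lebesgue_measure ((fun x : R => (a * x + b)%R) @^-1` A) =
   (a^-1)%:E * lebesgue_measure A)%E.
Proof.
move=> a0 mA.
pose phi := (fun x : R => (a * x + b)%R) : measurableTypeR R -> measurableTypeR R.
have mphi : measurable_fun setT phi.
  by apply: measurable_funD => //; exact: measurable_funM.
have a0' : 0 <= a by exact: ltW.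
pose nu := mscale (NngNum a0') (pushm lebesgue_measure mphi) : {measure set (measurableTypeR R) -> \bar R}.
suff -> : lebesgue_measure A = nu A.
  have -> : nu A = (a%:E * lebesgue_measure (phi @^-1` A))%E by [].
  by rewrite muleA -EFinM mulVf ?gt_eqF// mul1e.
apply: lebesgue_measure_unique => //.
move=> _ [[u v] _ <-].
rewrite [RHS](_ : _ = (a%:E * lebesgue_measure (phi @^-1` `]u, v]))%E)//.
have -> : phi @^-1` `]u, v]%classic = `](u - b) / a, (v - b) / a]%classic.
  apply/seteqP; split=> x /=; rewrite /phi !in_itv/= ltr_pdivrMr // ler_pdivlMr //
    ltrBlDr lerBrDr [x * a]mulrC; exact: id.
rewrite !lebesgue_measure_itv/= !lte_fin ltr_pM2r ?invr_gt0// ltrD2r.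
case: ifP => uv; last by rewrite mule0.
rewrite -!EFinD -EFinM; congr EFin.
by field; rewrite gt_eqF.
Qed.

Lemma ge0_integral_affine (R : realType) (a b : R) (f : R -> \bar R) : 0 < a ->
  measurable_fun [set: R] f -> (forall x, 0 <= f x)%E ->
  (\int[lebesgue_measure]_x f (a * x + b)%R =
   (a^-1)%:E * \int[lebesgue_measure]_x f x)%E.
Proof.
move=> a0 mf f0.
pose phi := (fun x : R => (a * x + b)%R) : measurableTypeR R -> measurableTypeR R.
have mphi : measurable_fun setT phi.
  by apply: measurable_funD => //; exact: measurable_funM.
have ai0 : 0 <= a^-1 by rewrite invr_ge0 ltW.
pose m2 : {measure set (measurableTypeR R) -> \bar R} :=
  mscale (NngNum ai0) lebesgue_measure.
transitivity (\int[pushm lebesgue_measure mphi]_y f y)%E.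
  by rewrite ge0_integral_pushforward.
transitivity (\int[m2]_y f y)%E.
  apply: eq_measure_integral => A mA _.
  exact: lebesgue_affine.
by rewrite ge0_integral_mscale.
Qed.

Lemma ge0_integral_opp (R : realType) (f : R -> \bar R) :
  measurable_fun [set: R] f -> (forall x, 0 <= f x)%E ->
  (\int[lebesgue_measure]_x f (- x)%R = \int[lebesgue_measure]_x f x)%E.
Proof.
move=> mf f0.
have mphi : measurable_fun setT (-%R : measurableTypeR R -> measurableTypeR R).
  exact: measurable_funN.
transitivity (\int[pushm lebesgue_measure mphi]_y f y)%E.
  by rewrite ge0_integral_pushforward.
apply: eq_measure_integral => A mA _.
by rewrite pushmE; exact: lebesgue_measureN.
Qed.

Lemma sigma_finite_prod d1 d2 (T1 : measurableType d1) (T2 : measurableType d2)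
    (R : realType) (m1 : {sigma_finite_measure set T1 -> \bar R})
    (m2 : {sigma_finite_measure set T2 -> \bar R}) :
  sigma_finite setT (m1 \x m2)%E.
Proof.
have /sigma_finiteP[F [TF ndF Foo]] := sigma_finiteT m1.
have /sigma_finiteP[G [TG ndG Goo]] := sigma_finiteT m2.
exists (fun n => F n `*` G n).
  rewrite -setXTT TF TG predeqE => -[x y]; split.
    move=> [/= [n _ Fnx] [k _ Gky]]; exists (maxn n k) => //; split.
    - by move: x Fnx; exact/subsetPset/ndF/leq_maxl.
    - by move: y Gky; exact/subsetPset/ndG/leq_maxr.
  by move=> [n _ []/= ? ?]; split; exists n.
move=> k; have [? ?] := Foo k; have [? ?] := Goo k.
split; first exact: measurableX.
by rewrite product_measure1E// lte_mul_pinfty// ge0_fin_numE.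
Qed.

(** The sigma-finite structure makes iterated products and Tonelli's theorem available
    for integrals against product measures. *)
Definition prod_sigma_finite d1 d2 (T1 : measurableType d1) (T2 : measurableType d2)
    (R : realType) (m1 : {sigma_finite_measure set T1 -> \bar R})
    (m2 : {sigma_finite_measure set T2 -> \bar R}) :
    {sigma_finite_measure set (T1 * T2)%type -> \bar R} :=
  HB.pack (m1 \x m2)%E
    (Measure_isSigmaFinite.Build _ _ _ (m1 \x m2)%E (sigma_finite_prod m1 m2)).

Section measurability.
Context d (T : measurableType d) (R : realType).

Lemma measurable_fun_expR D (f : T -> R) : measurable_fun D f ->
  measurable_fun D (fun x => expR (f x)).
Proof. by move=> mf; exact: measurableT_comp. Qed.

Lemma measurable_fun_opp D (f : T -> R) : measurable_fun D f ->
  measurable_fun D (fun x => - f x).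
Proof. by move=> mf; exact: measurable_funN. Qed.

End measurability.

Ltac mfun := repeat first
  [exact: measurable_fst | exact: measurable_snd | exact: measurable_id
  |exact: measurable_cst | apply: measurable_fun_pair | apply: measurable_funD
  |apply: measurable_funB | apply: measurable_funM | apply: measurable_funX
  |apply: measurable_fun_opp | apply: measurable_fun_expR].

Section area_measure.
Variable R : realType.
Local Notation leb := (@lebesgue_measure R).

Local Notation mR := (measurableTypeR R).

Definition leb2 : {sigma_finite_measure set (mR * mR)%type -> \bar R} :=
  prod_sigma_finite leb leb.

Lemma pi_inv_ge0 : 0 <= (pi^-1 : R).
Proof. by rewrite invr_ge0 pi_ge0. Qed.

Let area_m : {measure set (mR * mR)%type -> \bar R} :=
  mscale (NngNum pi_inv_ge0) leb2.

Lemma area0 : @area R set0 = 0%E.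
Proof. exact: (measure0 area_m). Qed.

Lemma area_ge0 A : (0 <= @area R A)%E.
Proof. exact: (measure_ge0 area_m). Qed.

Lemma area_semi_sigma_additive : semi_sigma_additive (@area R).
Proof. exact: (@measure_semi_sigma_additive _ _ _ area_m). Qed.

HB.instance Definition _ := isMeasure.Build _ _ _ (@area R)
  area0 area_ge0 area_semi_sigma_additive.

Lemma area_sigma_finite : sigma_finite setT (@area R).
Proof.
have [F TF Foo] := sigma_finiteT leb2.
exists F => // n; have [mF Fn] := Foo n; split => //.
rewrite -[area _]/((pi^-1)%:E * leb2 (F n))%E lte_mul_pinfty//.
by rewrite lee_fin pi_inv_ge0.
Qed.

HB.instance Definition _ := Measure_isSigmaFinite.Build _ _ _ (@area R)
  area_sigma_finite.

(** Lebesgue measure is carried by a copy of the real line; the identity transports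
    integrals from pairs in that copy to plain pairs of reals. *)
Lemma measurable_idm :
  measurable_fun [set: mR * mR] (fun z : mR * mR => (z : R * R)).
Proof. by move=> _ A mA; rewrite setTI. Qed.

Lemma ge0_integral_area_m (f : R * R -> \bar R) : measurable_fun [set: R * R] f ->
  (forall z, 0 <= f z)%E ->
  (\int[@area R]_z f z =
   (pi^-1)%:E * \int[leb \x leb]_z (f : mR * mR -> \bar R) z)%E.
Proof.
move=> mf f0.
transitivity (\int[pushm area_m measurable_idm]_z f z)%E.
  exact: eq_measure_integral.
rewrite ge0_integral_pushforward//.
have mf' := measurableT_comp mf measurable_idm.
exact: (@ge0_integral_mscale _ _ _ leb2 setT _ (NngNum pi_inv_ge0)).
Qed.

Lemma ge0_integral_area (f : R * R -> \bar R) : measurable_fun [set: R * R] f ->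
  (forall z, 0 <= f z)%E ->
  (\int[@area R]_z f z = (pi^-1)%:E * \int[leb]_x \int[leb]_y f (x, y))%E.
Proof.
move=> mf f0; rewrite ge0_integral_area_m//; congr (_ * _)%E.
have mf' := measurableT_comp mf measurable_idm.
exact: (fubini_tonelli1 (f : mR * mR -> \bar R) mf').
Qed.

Lemma ge0_integral_area2 (f : R * R -> \bar R) : measurable_fun [set: R * R] f ->
  (forall z, 0 <= f z)%E ->
  (\int[@area R]_z f z = (pi^-1)%:E * \int[leb]_y \int[leb]_x f (x, y))%E.
Proof.
move=> mf f0; rewrite ge0_integral_area_m//; congr (_ * _)%E.
have mf' := measurableT_comp mf measurable_idm.
exact: (fubini_tonelli2 (f : mR * mR -> \bar R) mf').
Qed.

(** Complex multiplication by u, written in real coordinates; it is a rotation when |u|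
    = 1. *)
Definition crot (u z : R * R) : R * R :=
  (u.1 * z.1 - u.2 * z.2, u.2 * z.1 + u.1 * z.2).

Definition modsq (z : R * R) : R := z.1 ^+ 2 + z.2 ^+ 2.

Lemma measurable_modsq : measurable_fun [set: R * R] modsq.
Proof. by mfun. Qed.

Lemma measurable_rot u : measurable_fun [set: R * R] (crot u).
Proof.
by mfun.
Qed.

(** Invariance is stated for nonnegative integrals, the form in which it composes and in
    which it is used. *)
Definition area_preserving (phi : R * R -> R * R) :=
  measurable_fun [set: R * R] phi /\
  forall f : R * R -> \bar R, measurable_fun [set: R * R] f ->
  (forall z, 0 <= f z)%E ->
  (\int[@area R]_z f (phi z) = \int[@area R]_z f z)%E.

Lemma area_preserving_comp phi psi : area_preserving phi -> area_preserving psi ->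
  area_preserving (phi \o psi).
Proof.
move=> [mphi phiP] [mpsi psiP]; split; first exact: measurableT_comp.
move=> f mf f0; rewrite (psiP (f \o phi)) ?phiP//.
  exact: measurableT_comp.
by move=> z; exact: f0.
Qed.

(** For a fixed second coordinate the shear is a translation of the first one. *)
Lemma area_preserving_shear1 p : area_preserving (fun z => (z.1 + p * z.2, z.2)).
Proof.
have m : measurable_fun [set: R * R] (fun z : R * R => (z.1 + p * z.2, z.2)).
  by mfun.
split => // f mf f0.
rewrite ge0_integral_area2//; last exact: measurableT_comp mf m.
rewrite [RHS](ge0_integral_area2 mf f0); congr (_ * _)%E.
apply: eq_integral => y _ /=.
rewrite -[RHS]mul1e -[X in (X%:E * _)%E]invr1 -(ge0_integral_affine (p * y)) //.
  by under [RHS]eq_integral do rewrite mul1r.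
exact: measurableT_comp mf _.
Qed.

Lemma area_preserving_shear2 p : area_preserving (fun z => (z.1, z.2 + p * z.1)).
Proof.
have m : measurable_fun [set: R * R] (fun z : R * R => (z.1, z.2 + p * z.1)).
  by mfun.
split => // f mf f0.
rewrite ge0_integral_area//; last exact: measurableT_comp mf m.
rewrite [RHS](ge0_integral_area mf f0); congr (_ * _)%E.
apply: eq_integral => x _ /=.
rewrite -[RHS]mul1e -[X in (X%:E * _)%E]invr1 -(ge0_integral_affine (p * x)) //.
  by under [RHS]eq_integral do rewrite mul1r.
exact: measurableT_comp mf _.
Qed.

(** A rotation with nonzero sine is a product of three shears, each preserving area by
    Tonelli and translation invariance; the rotations by 0 and by a half turn are powers
    of the quarter turn. *)
Lemma area_preserving_rot u : modsq u = 1 -> area_preserving (crot u).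
Proof.
move: u => [a b]; rewrite /modsq/= => ab1.
have gen (c e : R) : c ^+ 2 + e ^+ 2 = 1 -> e != 0 -> area_preserving (crot (c, e)).
  move=> ce1 e0.
  have := area_preserving_comp (area_preserving_shear1 ((c - 1) / e))
    (area_preserving_comp (area_preserving_shear2 e)
    (area_preserving_shear1 ((c - 1) / e))).
  congr area_preserving; apply/funext => -[x y]; rewrite /crot/=.
  congr pair.
    have -> : c * x - e * y = c * x - e ^+ 2 * y / e by field.
    rewrite (_ : e ^+ 2 = 1 - c ^+ 2); last by rewrite -ce1 addrC addKr.
    by field.
  by field.
have [b0|b0] := eqVneq b 0; last exact: gen.
have i : area_preserving (crot (0, 1)).
  by apply: gen; rewrite ?oner_eq0// expr0n/= expr1n add0r.
have ii := area_preserving_comp i i.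
move: ab1; rewrite b0 expr0n/= addr0 => /eqP; rewrite sqrf_eq1 => /orP[|] /eqP ->.
  have := area_preserving_comp ii ii; congr area_preserving.
  by apply/funext => -[x y]; rewrite /crot/=; congr pair; ring.
move: ii; congr area_preserving.
by apply/funext => -[x y]; rewrite /crot/=; congr pair; ring.
Qed.

(** Scale one coordinate at a time in the iterated integral. *)
Lemma ge0_integral_area_scale t (f : R * R -> \bar R) : 0 < t ->
  measurable_fun [set: R * R] f -> (forall z, 0 <= f z)%E ->
  (\int[@area R]_z f (t * z.1, t * z.2)%R =
   (t ^- 2)%:E * \int[@area R]_z f z)%E.
Proof.
move=> t0 mf f0.
have m : measurable_fun [set: R * R] (fun z : R * R => (t * z.1, t * z.2)%R).
  by mfun.
have cF (f' : R -> \bar R) : measurable_fun [set: R] f' -> (forall z, 0 <= f' z)%E ->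
   (\int[leb]_x f' (t * x)%R = (t^-1)%:E * \int[leb]_x f' x)%E.
  move=> mf' f'0; rewrite -(ge0_integral_affine 0) //.
  by under [RHS]eq_integral do rewrite addr0.
rewrite ge0_integral_area//; last exact: measurableT_comp mf m.
rewrite ge0_integral_area// muleCA; congr (_ * _)%E.
under eq_integral => x _.
  rewrite /= (cF (fun y => f (t * x, y)%R))//; last exact: measurableT_comp mf _.
  over.
have mF : measurable_fun [set: R] (fun x => \int[leb]_y f (x, y))%E.
  exact: measurable_fun_fubini_tonelli_F.
rewrite ge0_integralZl//=.
- rewrite (cF (fun x => \int[leb]_y f (x, y))%E)//; last by move=> x; exact: integral_ge0.
  by rewrite muleA -EFinM -invfM expr2.
- apply: measurableT_comp mF _.
  exact: measurable_funM.
- by move=> x _; exact: integral_ge0.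
- by rewrite lee_fin invr_ge0 ltW.
Qed.

Lemma modsq_ge0 z : 0 <= modsq z.
Proof. by rewrite addr_ge0// sqr_ge0. Qed.

Lemma measurable_disc p : measurable [set z | modsq z <= p].
Proof.
rewrite -[X in measurable X]setTI.
rewrite (_ : [set z | modsq z <= p] = modsq @^-1` `]-oo, p]%classic).
  exact: measurable_modsq.
by apply/seteqP; split=> z /=; rewrite in_itv.
Qed.

Lemma area_rect (A B : set R) : measurable A -> measurable B ->
  (@area R (A `*` B) = (pi^-1)%:E * (leb A * leb B))%E.
Proof.
by move=> mA mB; rewrite -(product_measure1E leb leb).
Qed.

(** The area of the unit disc is kept as a symbol: it cancels against the partition
    function, and only its being positive and finite matters. *)
Definition disc_area : R := fine (@area R [set z | modsq z <= 1]).

Lemma area_disc1 : @area R [set z | modsq z <= 1] = disc_area%:E.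
Proof.
rewrite fineK// ge0_fin_numE//.
apply: (@le_lt_trans _ _ (@area R (`[(-1), 1] `*` `[(-1), 1]))).
  apply: le_measure; [by apply: mem_set; exact: measurable_disc|by apply: mem_set; exact: measurableX|].
  move=> [x y]/=; rewrite /modsq/= !in_itv/= => xy1.
  by split; apply/andP; split; nra.
rewrite area_rect// !lebesgue_measure_itv/= lte_fin.
by case: ifPn => _; rewrite ?mule0 ?ltry// -!EFinM ltry.
Qed.

Lemma disc_area_gt0 : 0 < disc_area.
Proof.
rewrite -lte_fin -area_disc1.
apply: (@lt_le_trans _ _ (@area R (`[0, 2^-1] `*` `[0, 2^-1]))).
  rewrite area_rect// !lebesgue_measure_itv/= lte_fin invr_gt0 ltr0n/=.
  by rewrite -!EFinD -!EFinM lte_fin !mulr_gt0 ?invr_gt0 ?pi_gt0 ?subr0 ?invr_gt0.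
apply: le_measure; rewrite ?inE; [exact: measurableX|exact: measurable_disc|].
move=> [x y]/=; rewrite /modsq/= !in_itv/= => -[/andP[x0 x1] /andP[y0 y1]].
by nra.
Qed.

(** Discs are scaled copies of the unit disc; radius 0 follows from the positive radii
    by monotonicity. *)
Lemma area_disc p : 0 <= p -> @area R [set z | modsq z <= p] = (disc_area * p)%:E.
Proof.
have H p' : 0 < p' -> @area R [set z | modsq z <= p'] = (disc_area * p')%:E.
  move=> p0; pose t := (Num.sqrt p')^-1.
  have t0 : 0 < t by rewrite invr_gt0 sqrtr_gt0.
  have t2 : t ^+ 2 = p'^-1 by rewrite exprVn sqr_sqrtr// ltW.
  have mi q : measurable_fun [set: R * R]
      (fun z => (\1_[set z | modsq z <= q] z)%:E : \bar R).
    by apply/measurable_EFinP; apply: measurable_indic; exact: measurable_disc.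
  have := ge0_integral_area_scale t0 (mi 1).
  rewrite (eq_integral (fun z => (\1_[set z | modsq z <= p'] z)%:E)); last first.
    move=> z _; rewrite !indicE; congr (_%:R%:E); congr nat_of_bool.
    apply/idP/idP; rewrite !inE/= /modsq/= !exprMn t2 -mulrDr mulrC ler_pdivrMr//;
      by rewrite mul1r.
  rewrite !integral_indic//; try exact: measurable_disc.
  rewrite !setIT t2 invrK.
  rewrite [X in (_ * X)%E]area_disc1 => H; rewrite [LHS]H.
    by rewrite -EFinM mulrC.
  by move=> z; rewrite lee_fin.
rewrite le_eqVlt => /orP[/eqP <-|]; last exact: H.
rewrite mulr0; apply/eqP; rewrite eq_le measure_ge0 andbT.
apply/lee_addgt0Pr => e e0; rewrite add0e.
have de : 0 < e / disc_area by rewrite divr_gt0// disc_area_gt0.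
rewrite (_ : e = disc_area * (e / disc_area)); last first.
  by rewrite mulrC divfK// gt_eqF// disc_area_gt0.
rewrite -(H _ de); apply: le_measure; rewrite ?inE; try exact: measurable_disc.
by move=> z /= /le_trans; apply; exact: ltW.
Qed.

Lemma area_annulus p q : p <= q ->
  @area R [set z | p < modsq z <= q] =
  (disc_area * (Num.max q 0 - Num.max p 0))%:E.
Proof.
move=> pq.
have [q0|q0] := ltP q 0.
  rewrite (_ : [set z | _] = set0) ?measure0 ?(max_r (ltW q0)) ?max_r ?subrr ?mulr0//.
    by rewrite (le_trans pq)// ltW.
  apply/seteqP; split=> z//= /andP[_ zq].
  by have := modsq_ge0 z; rewrite leNgt (le_lt_trans zq).
have [p0|p0] := ltP p 0.
  rewrite subr0 -area_disc//; congr (area _); apply/seteqP; split=> z/=.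
    by move=> /andP[].
  by move=> ->; rewrite (lt_le_trans p0)// modsq_ge0.
rewrite (_ : [set z | _] = [set z | modsq z <= q] `\` [set z | modsq z <= p]); last first.
  apply/seteqP; split=> z/=.
    by move=> /andP[zp zq]; split=> //; apply/negP; rewrite -ltNge.
  by move=> [-> /negP]; rewrite -ltNge => ->.
rewrite measureD; [|exact: measurable_disc|exact: measurable_disc|]; last first.
  by rewrite [ltLHS](area_disc q0) ltry.
rewrite setIC (setIidl _).
  rewrite [X in (X - _)%E](area_disc q0) [X in (_ - X)%E](area_disc p0).
  by rewrite -EFinB mulrBr.
by move=> z /= /le_trans; apply.
Qed.

(** The image of area under z |-> |z|^2 is a multiple of Lebesgue measure on the
    half-line, since annuli get the measure prescribed by the lengths of half-open
    intervals. *)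
Lemma ge0_integral_area_radial (F : R -> \bar R) : measurable_fun [set: R] F ->
  (forall s, 0 <= F s)%E ->
  (\int[@area R]_z F (modsq z) =
   disc_area%:E * \int[leb]_(s in `[0%R, +oo[) F s)%E.
Proof.
move=> mF F0.
have c0 := disc_area_gt0.
have ci0 : 0 <= disc_area^-1 by rewrite invr_ge0 ltW.
have mm : measurable_fun [set: R * R] (modsq : R * R -> mR).
  exact: measurable_modsq.
pose nu1 : {measure set mR -> \bar R} :=
  mscale (NngNum ci0) (pushm (@area R) mm).
have mneg : measurable (`]-oo, 0%R[%classic : set mR) by exact: measurable_itv.
(* Lebesgue measure on the negative half-line completes the image measure to a measure
   on the whole line. *)
pose nu : {measure set mR -> \bar R} :=
  measure_add nu1 (mrestr leb mneg).
have nu1E A : nu1 A = ((disc_area^-1)%:E * @area R (modsq @^-1` A))%E by [].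
have nuE A : measurable A -> leb A = nu A.
  apply: lebesgue_measure_unique => // _ [[u v] _ <-].
  rewrite [RHS]measure_addE [X in (X + _)%E]nu1E /mrestr/=.
  have [uv|vu] := leP u v; last first.
    rewrite set_itv_ge ?bnd_simp -?leNgt ?ltW// preimage_set0 !measure0.
    by rewrite mule0 adde0.
  have -> : modsq @^-1` `]u, v]%classic = [set z | u < modsq z <= v].
    by apply/seteqP; split=> z /=; rewrite in_itv.
  rewrite area_annulus// -EFinM mulrA mulVf ?gt_eqF// mul1r.
  have -> : mrestr leb mneg `]u, v]%classic =
      leb [set x | (u < x <= v) && (x < 0)].
    rewrite /mrestr; congr (leb _).
    by apply/seteqP; split=> x /=; rewrite !in_itv/=; [move=> [-> ->]|move=> /andP].
  have [v0|v0] := ltP v 0.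
    rewrite (_ : [set x | (u < x <= v) && (x < 0)] = `]u, v]%classic); last first.
      apply/seteqP; split=> x /=; rewrite in_itv/=; first by move=> /andP[].
      by move=> /andP[-> xv]; rewrite xv (le_lt_trans xv).
    by rewrite (max_r (le_trans uv (ltW v0))) subrr add0e.
  rewrite [in LHS]lebesgue_measure_itv/= lte_fin.
  have [u0|u0] := ltP u 0.
    rewrite (_ : [set x | (u < x <= v) && (x < 0)] = `]u, 0[%classic); last first.
      apply/seteqP; split=> x /=; rewrite in_itv/=.
        by move=> /andP[/andP[-> _] ->].
      by move=> /andP[-> x0]; rewrite x0 (le_trans (ltW x0)).
    rewrite lebesgue_measure_itv/= lte_fin u0 (lt_le_trans u0 v0) -!EFinD.
    by congr EFin; rewrite subr0 sub0r.
  rewrite (_ : [set x | (u < x <= v) && (x < 0)] = set0) ?measure0 ?adde0; last first.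
    apply/seteqP; split=> x //= /andP[/andP[ux _] x0].
    by move: (lt_trans ux x0); rewrite ltNge u0.
  rewrite -EFinB; case: ltP => // vu.
  by rewrite (le_anti (introT andP (conj uv vu))) subrr.
have -> : (\int[leb]_(s in `[0%R, +oo[) F s = \int[nu1]_(s in `[0%R, +oo[) F s)%E.
  apply: eq_measure_integral => A mA A0.
  rewrite [LHS](nuE _ mA) [LHS]measure_addE.
  rewrite [X in (_ + X)%E](_ : _ = 0%E) ?adde0//.
  transitivity (leb set0); last exact: measure0.
  congr (leb _).
  apply/seteqP; split=> x //= [/A0/=]; rewrite !in_itv/= andbT => x0.
  by rewrite ltNge x0.
rewrite ge0_integral_mscale//; last exact: measurable_funTS.
rewrite muleA -EFinM mulfV ?gt_eqF// mul1e ge0_integral_pushforward//; last first.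
  exact: measurable_funTS.
rewrite (_ : modsq @^-1` _ = setT)//; apply/seteqP; split=> z //= _.
by rewrite in_itv/= andbT modsq_ge0.
Qed.

End area_measure.

(** * Roots of unity and the Vandermonde product *)

Section roots_of_unity.
Import ComplexField.
Variable R : realType.

(** The complex numbers serve only for the algebra of roots of unity; measures live on
    pairs of reals. *)
Definition toC (z : R * R) : R[i] := Complex z.1 z.2.
Definition ofC (c : R[i]) : R * R := (complex.Re c, complex.Im c).

Lemma toCK c : toC (ofC c) = c.
Proof. by case: c. Qed.

Lemma normc_toC z : Normc.normc (toC z) = cmod z.
Proof. by []. Qed.

Lemma toC_rot u z : toC (crot u z) = toC u * toC z.
Proof.
by rewrite /toC /crot/=; congr Complex; ring.
Qed.

Lemma toCB z w : toC (z - w) = toC z - toC w.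
Proof. by []. Qed.

Lemma cmodE z : cmod z = Num.sqrt (@modsq R z).
Proof. by []. Qed.

Lemma modsq_rot u z : modsq (@crot R u z) = modsq u * modsq z.
Proof. by rewrite /modsq /crot/=; ring. Qed.

Lemma cmod_rot u z : modsq u = 1 -> cmod (@crot R u z) = cmod z.
Proof. by move=> u1; rewrite !cmodE modsq_rot u1 mul1r. Qed.

Lemma normcX (x : R[i]) n : Normc.normc (x ^+ n) = Normc.normc x ^+ n.
Proof.
elim: n => [|n ih]; first by rewrite !expr0 Normc.normc1.
by rewrite !exprS Normc.normcM ih.
Qed.

(** The n roots of X^n - 1 are distinct, so the group of n-th roots of unity has order n
    and contains a generator. *)
Lemma prim_root_exists_complex n : (n > 0)%N -> exists z : R[i], n.-primitive_root z.
Proof.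
pose p : {poly R[i]} := 'X^n - 1; have [r Dp] := closed_field_poly_normal p.
move=> n_gt0; rewrite (monicP _) ?monicXnsubC // scale1r in Dp.
have rn1: all n.-unity_root r by apply/allP=> z; rewrite -root_prod_XsubC -Dp.
have sz_r: (n < (size r).+1)%N.
  by rewrite -(size_prod_XsubC r id) -Dp size_XnsubC.
have [|z] := hasP (has_prim_root n_gt0 rn1 _ sz_r); last by exists z.
by rewrite -separable_prod_XsubC -Dp separable_Xn_sub_1 // pnatr_eq0 -lt0n.
Qed.

Lemma normc_ge0 (x : R[i]) : 0 <= Normc.normc x.
Proof. by case: x => a b; rewrite sqrtr_ge0. Qed.

Lemma normc_unity n (z : R[i]) : (n > 0)%N -> z ^+ n = 1 -> Normc.normc z = 1.
Proof.
move=> n0 zn; have := normcX z n; rewrite zn Normc.normc1 => /esym/eqP.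
by rewrite pexpr_eq1// ?normc_ge0// => /eqP.
Qed.

Definition unit_root (z : R[i]) (m : nat) : R * R := ofC (z ^+ m).

Lemma modsq_unit_root N z m : N.-primitive_root z -> modsq (unit_root z m) = 1.
Proof.
move=> zN; have N0 := prim_order_gt0 zN.
have : Normc.normc (z ^+ m) = 1.
  by rewrite normcX (normc_unity N0) ?expr1n// prim_expr_order.
rewrite -(toCK (z ^+ m)) normc_toC cmodE => H.
by rewrite -(sqr_sqrtr (modsq_ge0 _)) H expr1n.
Qed.

(** The product over all rotations by N-th roots of unity is the modulus of the binomial
    z^N - w^N; this is what makes the angular average of log|z - w| computable without
    integrals. *)
Lemma prod_cmod_roots N (zeta : R[i]) (z w : R * R) : N.-primitive_root zeta ->
  \prod_(m < N) cmod (z - crot (unit_root zeta m) w) =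
  Normc.normc (toC z ^+ N - toC w ^+ N).
Proof.
move=> zN.
have key (x y : R[i]) : \prod_(m < N) (x - zeta ^+ m * y) = x ^+ N - y ^+ N.
  have [->|y0] := eqVneq y 0.
    under eq_bigr do rewrite mulr0 subr0.
    by rewrite prodr_const card_ord expr0n (gtn_eqF (prim_order_gt0 zN)) subr0.
  have := congr1 (fun p : {poly R[i]} => p.[x / y]) (factor_Xn_sub_1 zN).
  rewrite big_mkord horner_prod !hornerE/= => H.
  under eq_bigr => m _ do rewrite -{1}(divfK y0 x) -mulrBl.
  rewrite big_split/= prodr_const card_ord.
  under eq_bigr do rewrite -[_ - _]/(x / y + - zeta ^+ _).
  move: H; under eq_bigr do rewrite !hornerE/=.
  by move=> ->; rewrite mulrBl mul1r expr_div_n divfK// expf_neq0.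
rewrite -key.
rewrite (big_morph (@Normc.normc R) (@Normc.normcM R) (@Normc.normc1 R)).
by apply: eq_bigr => m _; rewrite -normc_toC toCB toC_rot toCK.
Qed.

(** Together with the reverse bound this says that the N-th root of the product tends to
    max(|z|,|w|), with an error that is explicit in N. *)
Lemma prod_cmod_roots_le N (zeta : R[i]) (z w : R * R) : N.-primitive_root zeta ->
  \prod_(m < N) cmod (z - crot (unit_root zeta m) w) <=
  2 * Num.max (cmod z) (cmod w) ^+ N.
Proof.
move=> zN; rewrite prod_cmod_roots// (le_trans (le_normcD _ _))//.
rewrite normcN !normcX !normc_toC mulr_natl mulr2n.
by apply: lerD; apply: lerXn2r; rewrite ?nnegrE ?le_max ?sqrtr_ge0 ?lexx ?orbT.
Qed.

Lemma prod_cmod_roots_ge N (zeta : R[i]) (z w : R * R) : N.-primitive_root zeta ->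
  Num.max (cmod z) (cmod w) ^+ N - Num.min (cmod z) (cmod w) ^+ N <=
  \prod_(m < N) cmod (z - crot (unit_root zeta m) w).
Proof.
move=> zN; rewrite prod_cmod_roots//.
have tri (x y : R[i]) : Normc.normc x - Normc.normc y <= Normc.normc (x - y).
  by rewrite lerBlDr -{1}(subrK y x) le_normcD.
have [zw|zw] := leP (cmod z) (cmod w).
  by rewrite -normcN opprB (le_trans _ (tri _ _))// !normcX.
by rewrite (le_trans _ (tri _ _))// !normcX.
Qed.

(** Orthogonality of the characters of the cyclic group of order N. *)
Lemma sum_prim_root N (zeta : R[i]) (a b : nat) : N.-primitive_root zeta ->
  (a < N)%N -> (b < N)%N ->
  \sum_(m < N) (zeta ^+ m) ^+ a * ((zeta ^+ m) ^- b) = (a == b)%:R * N%:R.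
Proof.
move=> zN aN bN.
have z0 : zeta != 0 by rewrite (prim_root_eq0 zN) gtn_eqF// (prim_order_gt0 zN).
set om := zeta ^+ a / zeta ^+ b.
have E (m : 'I_N) : (zeta ^+ m) ^+ a * (zeta ^+ m) ^- b = om ^+ m.
  by rewrite /om expr_div_n -!exprM mulnC [(b * m)%N]mulnC.
under eq_bigr do rewrite E.
have [ab|ab] := eqVneq a b.
  rewrite /om ab divff ?expf_neq0// mul1r.
  by under eq_bigr do rewrite expr1n; rewrite sumr_const card_ord.
rewrite mul0r.
have om1 : om != 1.
  apply: contra ab => /eqP om1.
  have : zeta ^+ a == zeta ^+ b.
    by rewrite -[X in X == _](divfK (expf_neq0 b z0)) -/om om1 mul1r.
  by rewrite (eq_prim_root_expr zN) !modn_small.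
have : (om - 1) * \sum_(m < N) om ^+ m = 0.
  rewrite -subrX1 /om expr_div_n -!exprM mulnC exprM (prim_expr_order zN) expr1n.
  by rewrite mulnC exprM (prim_expr_order zN) expr1n divr1 subrr.
by move=> /eqP; rewrite mulf_eq0 subr_eq0 (negbTE om1)/= => /eqP.
Qed.

(** The product over ordered pairs of distinct indices is the squared modulus of a
    Vandermonde determinant. *)
Lemma prod_neq_sqr n (x : 'I_n -> R[i]) :
  (\prod_(j < n) \prod_(k < n | j != k) Normc.normc (x j - x k))%:C%C =
  \det (Vandermonde n (\row_j x j)) * (\det (Vandermonde n (\row_j x j)))^*%C.
Proof.
rewrite -sqr_normc.
have -> (y : R[i]) : `|y| ^+ 2 = (Normc.normc y ^+ 2)%:C%C.
  by rewrite rmorphXn.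
congr (_%:C%C); rewrite det_Vandermonde.
rewrite (big_morph (@Normc.normc R) (@Normc.normcM R) (@Normc.normc1 R)).
under [in RHS]eq_bigr do
  rewrite (big_morph (@Normc.normc R) (@Normc.normcM R) (@Normc.normc1 R)).
rewrite expr2.
rewrite [X in _ = X * _](eq_bigr (fun i : 'I_n =>
  \prod_(j < n | (i < j)%N) Normc.normc (x i - x j))); last first.
  by move=> i _; apply: eq_bigr => j _; rewrite !mxE -normcN opprB.
rewrite [X in _ = _ * X](exchange_big_dep predT)//=.
rewrite -big_split/=; apply: eq_bigr => j _.
rewrite (bigID (fun k : 'I_n => (j < k)%N))/=; congr (_ * _).
  apply: eq_bigl => k; rewrite -val_eqE/=.
  by have [] := ltngtP j k.
apply: eq_big => [k|k _]; last by rewrite !mxE.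
by rewrite -val_eqE/=; have [] := ltngtP j k.
Qed.

Lemma det_expand n (x : 'I_n -> R[i]) :
  \det (Vandermonde n (\row_j x j)) =
  \sum_(s : 'S_n) (-1) ^+ s * \prod_j x j ^+ s j.
Proof.
rewrite -det_tr /determinant; apply: eq_bigr => s _; congr (_ * _).
by apply: eq_bigr => j _; rewrite !mxE.
Qed.

(** Expand both determinants over permutations s and s'. Averaging over independent
    rotations of all variables annihilates, by orthogonality of characters, the terms
    with s different from s'. Roots of order n suffice because all exponents are less
    than n. *)
Lemma average_Vandermonde n (zeta : R[i]) (t : 'I_n -> R * R) :
  n.-primitive_root zeta ->
  \sum_(a : {ffun 'I_n -> 'I_n}) \prod_(j < n) \prod_(k < n | j != k)
     cmod (crot (unit_root zeta (a j)) (t j) - crot (unit_root zeta (a k)) (t k)) =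
  n%:R ^+ n * \sum_(s : 'S_n) \prod_(j < n) modsq (t j) ^+ s j.
Proof.
move=> zN; apply: complexI; rewrite rmorph_sum/=.
have conjz : (zeta^*%C) = zeta^-1.
  have := sqr_normc zeta; rewrite normc_def.
  have := modsq_unit_root 1 zN; rewrite /unit_root expr1 /modsq/= => ->.
  rewrite sqrtr1 expr1n => H.
  have z0 : zeta != 0 by rewrite (prim_root_eq0 zN) gtn_eqF// (prim_order_gt0 zN).
  by apply: (mulfI z0); rewrite -H divff.
have toCn (z : R * R) : toC z * (toC z)^*%C = (modsq z)%:C%C.
  by rewrite -sqr_normc -add_Re2_Im2.
transitivity (\sum_(a : {ffun 'I_n -> 'I_n}) \sum_(s : 'S_n) \sum_(s' : 'S_n)
   ((-1) ^+ s * (-1) ^+ s' * \prod_(j < n)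
     ((zeta ^+ a j) ^+ s j * (zeta ^+ a j) ^- s' j) * \prod_(j < n)
     (toC (t j) ^+ s j * (toC (t j))^*%C ^+ s' j))).
  apply: eq_bigr => a _.
  rewrite (_ : \prod_(j < n) _ = \prod_(j < n) \prod_(k < n | j != k)
    Normc.normc ((zeta ^+ a j * toC (t j)) - (zeta ^+ a k * toC (t k)))); last first.
    apply: eq_bigr => j _; apply: eq_bigr => k _.
    by rewrite -normc_toC toCB !toC_rot !toCK.
  rewrite (prod_neq_sqr (fun j => zeta ^+ a j * toC (t j))) det_expand.
  rewrite rmorph_sum/= big_distrl/=; apply: eq_bigr => s _.
  rewrite big_distrr/=; apply: eq_bigr => s' _.
  rewrite rmorphM rmorphXn rmorphN rmorph1 rmorph_prod/=.
  rewrite mulrACA -!mulrA; congr (_ * (_ * _)).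
  rewrite -!big_split/=; apply: eq_bigr => j _.
  rewrite rmorphXn rmorphM rmorphXn/= conjz.
  by rewrite !exprMn exprVn [((zeta ^+ a j)^-1) ^+ _]exprVn; ring.
rewrite exchange_big/=.
rewrite rmorphM rmorph_sum/= mulr_sumr; apply: eq_bigr => s _.
rewrite exchange_big/= (bigD1 s)//= [X in _ + X]big1 ?addr0; last first.
  move=> s' ss'; rewrite -mulr_suml -mulr_sumr.
  rewrite -(bigA_distr_bigA (fun j m : 'I_n => (zeta ^+ m) ^+ s j * (zeta ^+ m) ^- s' j)).
  have [j sj] : exists j, s j != s' j.
    apply/existsP; apply: contraR ss' => /existsPn H.
    by apply/eqP/permP => j; have := H j; rewrite negbK => /eqP.
  rewrite (bigD1 j)//= sum_prim_root ?ltn_ord//.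
  by rewrite val_eqE (negbTE sj) !mul0r mulr0 mul0r.
rewrite -mulr_suml -mulr_sumr.
rewrite -(bigA_distr_bigA (fun j m : 'I_n => (zeta ^+ m) ^+ s j * (zeta ^+ m) ^- s j)).
under eq_bigr => j _ do rewrite sum_prim_root ?ltn_ord// eqxx mul1r.
rewrite prodr_const card_ord -expr2 sqrr_sign mul1r rmorphXn rmorph_nat; congr (_ * _).
rewrite rmorph_prod/=; apply: eq_bigr => j _.
by rewrite -exprMn toCn rmorphXn.
Qed.

End roots_of_unity.

(** * Integration over n-tuples *)

Section power_measure.
Context d (T : measurableType d) (R : realType).
Variable mu : {sigma_finite_measure set T -> \bar R}.

Lemma measurable_tcons n :
  measurable_fun [set: T * n.-tuple T] (fun p => [tuple of p.1 :: p.2]).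
Proof. exact: measurable_cons. Qed.

Lemma measurable_uncons n :
  measurable_fun [set: n.+1.-tuple T] (fun t => (thead t, [tuple of behead t])).
Proof.
apply: measurable_fun_pair; last exact: measurable_behead.
exact: (@measurable_tnth _ T n.+1 ord0).
Qed.

(** The iterated product is defined as a mere set function; that it is a sigma-finite
    measure, needed at every step for Tonelli, is proved together with its construction.
    *)
Lemma power_measure_measure n :
  {m : {sigma_finite_measure set (n.-tuple T) -> \bar R} |
    (m : set (n.-tuple T) -> \bar R) = power_measure mu n}.
Proof.
elim: n => [|n [m IH]]; first by exists (dirac [tuple]).
pose m' := pushm (prod_sigma_finite mu m) (@measurable_tcons n).
have sf : sigma_finite setT m'.
  have [F TF Foo] := sigma_finiteT (prod_sigma_finite mu m).
  pose g := fun t : n.+1.-tuple T => (thead t, [tuple of behead t]).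
  exists (fun k => g @^-1` (F k)).
    by rewrite -preimage_bigcup -TF preimage_setT.
  move=> k; have [mF Fk] := Foo k; split.
    by rewrite -[X in measurable X]setTI; exact: measurable_uncons.
  rewrite /m' pushmE -comp_preimage (_ : g \o _ = id)//.
  by apply/funext => -[x t]/=; rewrite /g/= theadE; congr pair; exact/val_inj.
pose m'' : {sigma_finite_measure set (n.+1.-tuple T) -> \bar R} :=
  HB.pack (m' : set _ -> \bar R) (Measure.on m')
    (Measure_isSigmaFinite.Build _ _ _ m' sf).
exists m''; apply/funext => A /=.
by rewrite -IH.
Qed.

Definition pmeas n : {sigma_finite_measure set (n.-tuple T) -> \bar R} :=
  sval (power_measure_measure n).

Lemma pmeasE n : (pmeas n : set (n.-tuple T) -> \bar R) = power_measure mu n.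
Proof. by rewrite /pmeas; case: power_measure_measure. Qed.

Local Open Scope ereal_scope.

Lemma integral_pmeas0 (f : 0.-tuple T -> \bar R) : measurable_fun setT f ->
  (forall t, 0 <= f t) -> \int[pmeas 0]_t f t = f [tuple].
Proof.
move=> mf f0; rewrite pmeasE/= -[LHS]/(\int[\d_ [tuple]]_t f t).
by rewrite integral_dirac// diracT mul1e.
Qed.

Lemma integral_pmeasS n (f : n.+1.-tuple T -> \bar R) : measurable_fun setT f ->
  (forall t, 0 <= f t) ->
  \int[pmeas n.+1]_t f t = \int[mu]_x \int[pmeas n]_t f [tuple of x :: t].
Proof.
move=> mf f0.
transitivity (\int[pushm (prod_sigma_finite mu (pmeas n)) (@measurable_tcons n)]_t f t).
  apply: eq_measure_integral => A mA _.
  by rewrite pushmE -[LHS]/((pmeas n.+1 : set _ -> _) A) pmeasE/= -pmeasE.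
rewrite ge0_integral_pushforward//; last exact: measurable_tcons.
have mf' := measurableT_comp mf (@measurable_tcons n).
rewrite preimage_setT.
exact: (@fubini_tonelli1 _ _ _ _ _ mu (pmeas n) _ mf' (fun=> f0 _)).
Qed.

Definition tmap n (phi : 'I_n -> T -> T) (t : n.-tuple T) : n.-tuple T :=
  [tuple phi j (tnth t j) | j < n].

Lemma measurable_tmap n (phi : 'I_n -> T -> T) :
  (forall j, measurable_fun setT (phi j)) -> measurable_fun setT (tmap phi).
Proof.
move=> mphi; apply/measurable_fun_tnthP => j.
rewrite (_ : _ \o _ = phi j \o (fun t : n.-tuple T => tnth t j)).
  by apply: measurableT_comp => //; exact: measurable_tnth.
by apply/funext => t /=; rewrite tnth_mktuple.
Qed.

(** The same notion as area_preserving, for an arbitrary measure. *)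
Definition mpreserving (phi : T -> T) :=
  measurable_fun setT phi /\ forall f : T -> \bar R, measurable_fun setT f ->
  (forall z, 0 <= f z) -> \int[mu]_z f (phi z) = \int[mu]_z f z.

(** By induction on n, the coordinates are changed one after the other. *)
Lemma integral_pmeas_map n (phi : 'I_n -> T -> T) (f : n.-tuple T -> \bar R) :
  (forall j, mpreserving (phi j)) -> measurable_fun setT f ->
  (forall t, 0 <= f t) ->
  \int[pmeas n]_t f (tmap phi t) = \int[pmeas n]_t f t.
Proof.
elim: n => [|n IH] in phi f * => phiP mf f0.
  by apply: eq_integral => t _; rewrite [t]tuple0 [tmap _ _]tuple0.
have mphi j : measurable_fun setT (phi j) by have [] := phiP j.
have mf' := measurableT_comp mf (measurable_tmap mphi).
rewrite (integral_pmeasS mf')//; last by move=> t; exact: f0.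
rewrite integral_pmeasS//.
pose phi' j := phi (lift ord0 j).
have E x (t : n.-tuple T) : tmap phi [tuple of x :: t] =
    [tuple of phi ord0 x :: tmap phi' t].
  apply: eq_from_tnth => j; rewrite tnth_mktuple.
  case: (unliftP ord0 j) => [k ->|->]; rewrite ?tnth0// !tnthS.
  by rewrite tnth_mktuple.
have mfc : measurable_fun [set: T * n.-tuple T] (fun p => f [tuple of p.1 :: p.2]).
  exact: measurableT_comp mf (@measurable_tcons n).
under eq_integral => x _.
  under eq_integral do rewrite /= E.
  rewrite (IH _ (fun t => f [tuple of phi ord0 x :: t]))//; last first.
    by apply: (measurableT_comp mf); apply: measurable_cons.
    by move=> j; exact: phiP.
  over.
have [_ /(_ (fun x => \int[pmeas n]_t f [tuple of x :: t])) /= ->//] := phiP ord0.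
- exact: (measurable_fun_fubini_tonelli_F (m2 := pmeas n) _ mfc).
- by move=> z; exact: integral_ge0.
Qed.

Lemma integral_pmeas_prod n (g : 'I_n -> T -> \bar R) :
  (forall j, measurable_fun setT (g j)) -> (forall j x, 0 <= g j x) ->
  \int[pmeas n]_t (\prod_(j < n) g j (tnth t j)) =
  \prod_(j < n) \int[mu]_x g j x.
Proof.
have mprod m (h : 'I_m -> T -> \bar R) : (forall j, measurable_fun setT (h j)) ->
  measurable_fun setT (fun t : m.-tuple T => \prod_(j < m) h j (tnth t j)).
  move=> mh.
  suff H (s : seq 'I_m) : measurable_fun setT
     (fun t : m.-tuple T => \prod_(j <- s) h j (tnth t j)) by exact: H.
  elim: s => [|j s ih].
    by under eq_fun do rewrite big_nil; exact: measurable_cst.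
  under eq_fun do rewrite big_cons; apply: emeasurable_funM => //.
  by apply: measurableT_comp => //; exact: measurable_tnth.
elim: n => [|n IH] in g * => mg g0.
  rewrite integral_pmeas0 ?big_ord0//; first exact: mprod.
  by move=> t; exact: prode_ge0.
rewrite integral_pmeasS//=; [|exact: mprod|by move=> t; exact: prode_ge0].
rewrite big_ord_recl.
under eq_integral => x _.
  under eq_integral => t _.
    rewrite big_ord_recl tnth0.
    under eq_bigr do rewrite tnthS.
    over.
  rewrite ge0_integralZl//; [|exact: (mprod _ (fun j => g (lift ord0 j)))|
    by move=> t _; exact: prode_ge0].
  rewrite (IH (fun j => g (lift ord0 j)))//.
  over.
rewrite ge0_integralZr//.
by apply: prode_ge0 => j _; exact: integral_ge0.
Qed.

End power_measure.

Section vandermonde_integral.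
Variable R : realType.
Local Notation pm n := (pmeas (@area R) n).

Lemma continuous_sqrt_measurable : measurable_fun [set: R] (@Num.sqrt R).
Proof. by apply: continuous_measurable_fun; exact: sqrt_continuous. Qed.

Lemma measurable_cmod : measurable_fun [set: R * R] (@cmod R).
Proof.
by apply: (measurableT_comp continuous_sqrt_measurable); exact: measurable_modsq.
Qed.

Definition vdm n (t : n.-tuple (R * R)%type) : R :=
  \prod_(j < n) \prod_(k < n | j != k) cmod (tnth t j - tnth t k).

Lemma vdm_ge0 n (t : n.-tuple (R * R)%type) : 0 <= vdm t.
Proof. by do 2 (apply: prodr_ge0 => ? _); exact: sqrtr_ge0. Qed.

Lemma measurable_vdm n : measurable_fun setT (@vdm n).
Proof.
apply: measurable_prod => j _.
under eq_fun do rewrite big_mkcond/=.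
apply: measurable_prod => k _.
case: (j != k); last exact: measurable_cst.
apply: (measurableT_comp measurable_cmod).
have m (i : 'I_n) : measurable_fun setT (fun t : n.-tuple (R * R)%type => tnth t i).
  exact: measurable_tnth.
apply: measurable_fun_pair; apply: measurable_funB.
- exact: (measurableT_comp measurable_fst (m j)).
- exact: (measurableT_comp measurable_fst (m k)).
- exact: (measurableT_comp measurable_snd (m j)).
- exact: (measurableT_comp measurable_snd (m k)).
Qed.

Local Open Scope ereal_scope.

Lemma eq_mule_natl (k : nat) (x y : \bar R) : (0 < k)%N ->
  (k%:R)%:E * x = (k%:R)%:E * y -> x = y.
Proof.
move=> k0 /(congr1 (fun z => (k%:R^-1)%:E * z)).
by rewrite !muleA -!EFinM mulVf ?pnatr_eq0 -?lt0n// !mul1e.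
Qed.

Lemma ge0_sum_const (I : finType) (x : \bar R) : 0 <= x ->
  \sum_(i : I) x = (#|I|%:R)%:E * x.
Proof.
move=> x0; rewrite sumr_const; elim: #|I| => [|k ih]; first by rewrite mul0e.
by rewrite mulrSr ih -natr1 EFinD ge0_muleDl ?mul1e// lee_fin.
Qed.

(** Invariance of area and of the weight lets each variable be rotated by an arbitrary
    n-th root of unity without changing the integral; average over all (roots of
    unity)^n and use average_Vandermonde. Each of the n! permutations contributes the
    same product of moments. *)
Lemma integral_vdm n (w : R * R -> \bar R) : measurable_fun setT w ->
  (forall z, 0 <= w z) ->
  (forall u z, modsq u = 1%R -> w (crot u z) = w z) ->
  \int[pm n]_t ((vdm t)%:E * \prod_(j < n) w (tnth t j)) =
  (n`!%:R)%:E * \prod_(j < n) \int[@area R]_z ((modsq z ^+ j)%:E * w z).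
Proof.
move=> mw w0 wrot.
have [n0|n0] := posnP n.
  subst n; rewrite integral_pmeas0.
  - by rewrite /vdm !big_ord0 !mul1e.
  - under eq_fun do rewrite /vdm !big_ord0 !mul1e; exact: measurable_cst.
  - by move=> t; rewrite /vdm !big_ord0 !mul1e.
have [zeta zN] := prim_root_exists_complex R n0.
pose phi (a : {ffun 'I_n -> 'I_n}) (j : 'I_n) := crot (unit_root zeta (a j)).
have phi1 (a : {ffun 'I_n -> 'I_n}) (j : 'I_n) : modsq (unit_root zeta (a j)) = 1%R.
  exact: (modsq_unit_root _ zN).
pose F (t : n.-tuple (R * R)%type) := (vdm t)%:E * \prod_(j < n) w (tnth t j).
have mW : measurable_fun setT (fun t : n.-tuple (R * R)%type => \prod_(j < n) w (tnth t j)).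
  suff H (s : seq 'I_n) : measurable_fun setT
     (fun t : n.-tuple (R * R)%type => \prod_(j <- s) w (tnth t j)) by exact: H.
  elim: s => [|j s ih].
    by under eq_fun do rewrite big_nil; exact: measurable_cst.
  under eq_fun do rewrite big_cons; apply: emeasurable_funM => //.
  by apply: measurableT_comp => //; exact: measurable_tnth.
have mF : measurable_fun setT F.
  by apply: emeasurable_funM => //; apply/measurable_EFinP; exact: measurable_vdm.
have F0 t : 0 <= F t.
  by rewrite mule_ge0 ?lee_fin ?vdm_ge0//; exact: prode_ge0.
have pres (a : {ffun 'I_n -> 'I_n}) j : mpreserving (@area R) (phi a j).
  by have [? ?] := area_preserving_rot (phi1 a j); split.
have Fa (a : {ffun 'I_n -> 'I_n}) : \int[pm n]_t F t = \int[pm n]_t F (tmap (phi a) t).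
  by rewrite integral_pmeas_map.
have nn0 : (0 < n ^ n)%N by rewrite expn_gt0 n0.
apply: (eq_mule_natl nn0).
rewrite -[\int[_]_t _]/(\int[pm n]_t F t).
transitivity (\sum_(a : {ffun 'I_n -> 'I_n}) \int[pm n]_t F (tmap (phi a) t)).
  under eq_bigr do rewrite -Fa.
  by rewrite ge0_sum_const ?integral_ge0// card_ffun !card_ord.
rewrite -ge0_integral_sum//; last first.
  move=> a; apply: measurableT_comp mF _; apply: measurable_tmap => j.
  exact: measurable_rot.
transitivity (\int[pm n]_t \sum_(s : 'S_n) ((n ^ n)%:R)%:E *
    \prod_(j < n) ((modsq (tnth t j) ^+ s j)%:E * w (tnth t j))).
  apply: eq_integral => t _.
  have Wa (a : {ffun 'I_n -> 'I_n}) : \prod_(j < n) w (tnth (tmap (phi a) t) j) = \prod_(j < n) w (tnth t j).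
    by apply: eq_bigr => j _; rewrite tnth_mktuple wrot.
  under eq_bigr => a _ do rewrite /F Wa.
  rewrite -ge0_sume_distrl; last by move=> a _; rewrite lee_fin vdm_ge0.
  rewrite sumEFin.
  have := average_Vandermonde (tnth t) zN.
  rewrite (_ : (\sum_(a : {ffun _}) _)%R = (\sum_(a : {ffun 'I_n -> 'I_n}) vdm (tmap (phi a) t))%R).
    move=> ->; rewrite natrX EFinM -muleA -sumEFin.
    rewrite ge0_sume_distrl; last first.
      move=> s _; rewrite lee_fin; apply: prodr_ge0 => j _.
      by rewrite exprn_ge0// modsq_ge0.
    rewrite ge0_sume_distrr; last first.
      move=> s _; apply: mule_ge0; last exact: prode_ge0.
      rewrite lee_fin; apply: prodr_ge0 => j _.
      by rewrite exprn_ge0// modsq_ge0.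
    apply: eq_bigr => s _; congr (_ * _).
    by rewrite -prodEFin -big_split.
  apply: eq_bigr => a _; apply: eq_bigr => j _; apply: eq_bigr => k _.
  by rewrite !tnth_mktuple.
have mg j : measurable_fun setT (fun z : R * R => (modsq z ^+ j)%:E * w z).
  apply: emeasurable_funM => //; apply/measurable_EFinP.
  by apply: measurable_funX; exact: measurable_modsq.
have g0 j z : 0 <= (modsq z ^+ j)%:E * w z.
  by rewrite mule_ge0// lee_fin exprn_ge0// modsq_ge0.
have mP (s : 'S_n) : measurable_fun setT (fun t : n.-tuple (R * R)%type =>
    \prod_(j < n) ((modsq (tnth t j) ^+ s j)%:E * w (tnth t j))).
  suff H (r : seq 'I_n) : measurable_fun setT
     (fun t : n.-tuple (R * R)%type => \prod_(j <- r) ((modsq (tnth t j) ^+ s j)%:E * w (tnth t j))) by exact: H.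
  elim: r => [|j r ih].
    by under eq_fun do rewrite big_nil; exact: measurable_cst.
  under eq_fun do rewrite big_cons; apply: emeasurable_funM => //.
  apply: (measurableT_comp (f := fun z : R * R => (modsq z ^+ s j)%:E * w z)) => //.
  exact: measurable_tnth.
rewrite ge0_integral_sum//; last 2 first.
- move=> s; apply: emeasurable_funM => //.
- by move=> s t _; rewrite mule_ge0//; exact: prode_ge0.
rewrite (eq_bigr (fun=> ((n ^ n)%:R)%:E *
   \prod_(j < n) \int[@area R]_z ((modsq z ^+ j)%:E * w z))); last first.
  move=> s _; rewrite ge0_integralZl//; last by move=> t _; exact: prode_ge0.
  rewrite (integral_pmeas_prod (@area R) (g := fun j z => (modsq z ^+ s j)%:E * w z))//.
  congr (_ * _).
  rewrite [RHS](reindex_inj (@perm_inj _ s))/=.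
  by apply: eq_bigr.
rewrite ge0_sum_const ?card_Sn; first by rewrite muleCA.
rewrite mule_ge0//; apply: prode_ge0 => j _; exact: integral_ge0.
Qed.

End vandermonde_integral.

(** * Taylor bounds, dominated convergence, exponential integrals *)

Section calculus.
Variable R : realType.

Lemma mvt_derive (f df : R -> R) (a b : R) : a < b ->
  (forall x : R, a <= x <= b -> is_derive x 1 f (df x)) ->
  exists c, [/\ a < c, c < b & f b - f a = df c * (b - a)].
Proof.
move=> ab fd.
have [| |c cab E] := @MVT R f df a b ab.
- by move=> x; rewrite in_itv/= => /andP[ax xb]; apply: fd; rewrite !ltW.
- apply: derivable_within_continuous => x; rewrite in_itv/= => xab.
  by have [] := fd _ xab.
by exists c; move: cab; rewrite in_itv/= => /andP[-> ->].
Qed.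

Lemma derive_ge0_le (f df : R -> R) (a b : R) : a <= b ->
  (forall x : R, a <= x <= b -> is_derive x 1 f (df x)) ->
  (forall x, a <= x <= b -> 0 <= df x) -> f a <= f b.
Proof.
rewrite le_eqVlt => /predU1P[->//|ab] fd f0.
have [c [ac cb E]] := mvt_derive ab fd.
by rewrite -subr_ge0 E mulr_ge0 ?subr_ge0 ?f0// !ltW.
Qed.

(** First-order Taylor formula with Peano remainder. *)
Lemma derive_expand1 (f : R -> R) (a l : R) : is_derive a 1 f l ->
  forall eta, 0 < eta -> exists2 d, 0 < d &
  forall x, `|x - a| <= d -> `|f x - f a - l * (x - a)| <= eta * `|x - a|.
Proof.
move=> [fd fl] eta eta0.
have : (fun h => h^-1 *: (f (h *: 1 + a) - f a)) @ 0^' --> l by rewrite -fl.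
move=> /cvgrPdist_le /(_ _ eta0); rewrite near_withinE => /nbhs_ballP[d /= d0 H].
exists (d / 2); first by rewrite divr_gt0.
move=> x xad; have [->|xa] := eqVneq x a; first by rewrite !subrr mulr0 subr0 normr0 mulr0.
have xa0 : x - a != 0 by rewrite subr_eq0.
have := H (x - a); rewrite /ball/= sub0r normrN => /(_ _ xa0).
have xd : `|x - a| < d by rewrite (le_lt_trans xad)// ltr_pdivrMr// ltr_pMr// ltr1n.
move=> /(_ xd); rewrite /= scaler1 subrK => {}H.
rewrite /GRing.scale/= in H.
have -> : f x - f a - l * (x - a) = - (l - (x - a)^-1 * (f x - f a)) * (x - a).
  by field.
by rewrite normrM normrN ler_wpM2r.
Qed.

(** Second-order Taylor formula with Peano remainder, obtained by applying the mean
    value theorem to the difference between the function and its Taylor polynomial. *)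
Lemma derive_expand2 (f df : R -> R) (a l : R) :
  (\forall x \near a, is_derive (x : R) 1 f (df x)) -> is_derive a 1 df l ->
  forall eta, 0 < eta -> exists2 d, 0 < d &
  forall x, `|x - a| <= d ->
    `|f x - f a - df a * (x - a) - l / 2 * (x - a) ^+ 2| <= eta * (x - a) ^+ 2.
Proof.
move=> /nbhs_ballP[d1 /= d10 fd] dfd eta eta0.
have [d2 d20 H] := derive_expand1 dfd eta0.
pose d := Num.min (d1 / 2) d2.
have d0 : 0 < d by rewrite lt_min d20 divr_gt0.
exists d => // x xad.
pose g := fun y => f y - df a * (y - a) - l / 2 * (y - a) ^+ 2.
have gd (y : R) : `|y - a| <= d -> is_derive y 1 g (df y - df a - l * (y - a)).
  rewrite le_min => /andP[yd1 yd2].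
  have fy : is_derive y 1 f (df y).
    apply: fd; rewrite /ball/= distrC (le_lt_trans yd1)//.
    by rewrite ltr_pdivrMr// ltr_pMr// ltr1n.
  rewrite /g; apply: is_derive_eq.
  by rewrite /GRing.scale/= ?mulr0 ?subr0 ?expr1; field.
have ga : g a = f a by rewrite /g !subrr expr0n/= !mulr0 !subr0.
suff : `|g x - g a| <= eta * (x - a) ^+ 2.
  by rewrite ga /g; congr (`|_| <= _); ring.
have key (c : R) : `|c - a| <= `|x - a| ->
   `|df c - df a - l * (c - a)| * `|x - a| <= eta * (x - a) ^+ 2.
  move=> ca.
  have cd : `|c - a| <= d2.
    by rewrite (le_trans ca)// (le_trans xad)// ge_min lexx orbT.
  rewrite -real_normK ?num_real// expr2 mulrA ler_wpM2r//.
  by rewrite (le_trans (H _ cd))// ler_wpM2l// ltW.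
have [xa|xa|->] := ltgtP x a; last by rewrite !subrr normr0 expr0n/= mulr0.
- have [c [xc ca E]] : exists c, [/\ x < c, c < a &
      g a - g x = (df c - df a - l * (c - a)) * (a - x)].
    apply: mvt_derive => // y /andP[xy ya]; apply: gd.
    rewrite (le_trans _ xad)// ler0_norm ?subr_le0// ltr0_norm ?subr_lt0//.
    by rewrite lerN2 lerD2r.
  rewrite distrC E normrM [`|a - x|]distrC; apply: key.
  by rewrite ltr0_norm ?subr_lt0// ltr0_norm ?subr_lt0// lerN2 lerD2r ltW.
- have [c [ac cx E]] : exists c, [/\ a < c, c < x &
      g x - g a = (df c - df a - l * (c - a)) * (x - a)].
    apply: mvt_derive => // y /andP[ay yx]; apply: gd.
    by rewrite (le_trans _ xad)// ger0_norm ?subr_ge0// gtr0_norm ?subr_gt0// lerD2r.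
  rewrite E normrM; apply: key.
  by rewrite gtr0_norm ?subr_gt0// gtr0_norm ?subr_gt0// lerD2r ltW.
Qed.

Lemma ln_le_sub1 (x : R) : 0 < x -> ln x <= x - 1.
Proof.
move=> x0; have := @le_ln1Dx R (x - 1); rewrite addrCA subrr addr0; apply.
by rewrite ltrBrDl subrr.
Qed.

(** Linear bounds for the logarithm at relative distance at most 1/2 from T; the factor
    2 on the right absorbs the curvature. *)
Lemma ln_sub_bounds (T y : R) : 0 < T -> 0 <= y -> y <= T / 2 ->
  y / T <= ln T - ln (T - y) <= 2 * y / T.
Proof.
move=> T0 y0 yT.
have Ty : 0 < T - y by lra.
rewrite -ln_div ?posrE//; apply/andP; split.
  rewrite -lerN2 -lnV ?posrE ?divr_gt0// invf_div.
  rewrite (le_trans (ln_le_sub1 _))// ?divr_gt0// mulrBl divff ?gt_eqF//.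
  lra.
rewrite (le_trans (ln_le_sub1 _)) ?divr_gt0//.
rewrite lerBlDr ler_pdivrMr// -(@ler_pM2r _ T)//.
rewrite [leRHS](_ : _ = (2 * y + T) * (T - y)); last by field; rewrite ?gt_eqF.
by nra.
Qed.

End calculus.

Section dct.
Context d (T : measurableType d) (R : realType).
Variables (mu : {measure set T -> \bar R}) (D : set T).

(** Domination is only available from some index on: shift the sequence before applying
    dominated convergence. *)
Lemma dominated_cvg_near (f_ : nat -> T -> \bar R) (f g : T -> \bar R) :
  measurable D -> (forall n, measurable_fun D (f_ n)) ->
  (forall x, D x -> f_ n x @[n --> \oo] --> f x) ->
  mu.-integrable D g ->
  (\forall n \near \oo, forall x, D x -> (`|f_ n x| <= g x)%E) ->
  mu.-integrable D f /\
  (\int[mu]_(x in D) f_ n x)%E @[n --> \oo] --> (\int[mu]_(x in D) f x)%E.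
Proof.
move=> mD mf ff ig [N _ H].
have mf0 : measurable_fun D f.
  exact: (emeasurable_fun_cvg f_).
have shift (u : nat -> \bar R) (l : \bar R) : u n @[n --> \oo] --> l <-> u (n + N)%N @[n --> \oo] --> l.
  by rewrite -(cvg_shiftn N u).
have ff' : {ae mu, forall x, D x -> (fun n => f_ (n + N)%N x) @ \oo --> f x}.
  by apply/aeW => x Dx; apply/(shift (fun n => f_ n x)); exact: ff.
have H' : {ae mu, forall x n, D x -> (`|f_ (n + N)%N x| <= g x)%E}.
  by apply/aeW => x n Dx; apply: H => //=; rewrite leq_addl.
have [i _ c] := dominated_convergence mD (fun n => mf (n + N)%N) mf0 ff' ig H'.
by split => //; apply/(shift (fun n => \int[mu]_(x in D) f_ n x)%E); exact: c.
Qed.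

End dct.

Section exp_integrable.
Variable R : realType.
Local Notation leb := (@lebesgue_measure R).

Lemma integral_expN (a : R) : 0 < a ->
  (\int[leb]_(x in `[0%R, +oo[) (expR (- (a * x)))%:E = (a^-1)%:E)%E.
Proof.
move=> a0.
have cF (x : R) : is_derive x 1 (fun x : R => - a^-1 * expR (- (a * x))) (expR (- (a * x))).
  apply: is_derive_eq; rewrite /GRing.scale/= mulr1.
  by field; rewrite gt_eqF.
rewrite (@ge0_continuous_FTC2y _ _ (fun x : R => - a^-1 * expR (- (a * x))) 0 0).
- by rewrite mulr0 oppr0 expR0 mulr1 sub0e -EFinN opprK.
- by move=> x _; exact: expR_ge0.
- apply: continuous_subspaceT => x.
  apply: continuous_comp; last exact: continuous_expR.
  by apply: cvgN; apply: cvgM; [exact: cvg_cst|exact: cvg_id].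
- rewrite -[X in _ --> X](mulr0 (- a^-1)); apply: cvgM; first exact: cvg_cst.
  apply: (cvg_comp (fun x : R => a * x) (fun x => expR (- x))); last exact: cvgr_expR.
  by apply: gt0_cvgMry => //; exact: cvg_id.
- by move=> x _; have [] := cF x.
- apply: cvg_at_right_filter; have [d0 _] := cF 0.
  exact: (differentiable_continuous ((derivable1_diffP _ _).1 d0)).
- by move=> x _; rewrite derive1E; have [_ ->] := cF x.
Qed.

Lemma integrable_expN (a : R) : 0 < a ->
  leb.-integrable `[0%R, +oo[ (fun x => (expR (- (a * x)))%:E).
Proof.
move=> a0; apply/integrableP; split.
  apply: measurable_funTS; apply/measurable_EFinP.
  by mfun.
under eq_integral do rewrite abse_EFin ger0_norm ?expR_ge0//.
by rewrite integral_expN// ltry.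
Qed.

(** Completing the square bounds the function by a multiple of e^(-v). *)
Lemma integrable_gauss_linear (c b : R) : 0 < c ->
  leb.-integrable `[0%R, +oo[ (fun v => (expR (- (c * v ^+ 2) + b * v))%:E).
Proof.
move=> c0.
pose K := (b + 1) ^+ 2 / (4 * c).
have i1 : leb.-integrable `[0%R, +oo[
    (fun v => ((expR K)%:E * (expR (- (1 * v)))%:E)%E).
  by apply: integrableZl => //; exact: integrable_expN.
apply: (le_integrable _ _ _ i1) => //.
- apply: measurable_funTS; apply/measurable_EFinP.
  by mfun.
- move=> v _; rewrite -EFinM !abse_EFin lee_fin !ger0_norm ?expR_ge0 ?mulr_ge0 ?expR_ge0//.
  rewrite -expRD ler_expR mul1r /K.
  have : 0 <= (2 * c * v - (b + 1)) ^+ 2 / (4 * c).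
    by rewrite divr_ge0 ?sqr_ge0// mulr_ge0// ltW.
  rewrite (_ : _ / _ = c * v ^+ 2 - (b + 1) * v + (b + 1) ^+ 2 / (4 * c)).
    lra.
  by field; rewrite gt_eqF.
Qed.

End exp_integrable.

(** * The radial potential and its mass function *)

Section potential.
Variable R : realType.
Local Notation leb := (@lebesgue_measure R).
Variables (Q : R * R -> \bar R) (q : R -> R).
Hypothesis Qnoo : forall z, (-oo < Q z)%E.
Hypothesis Qlsc : lower_semicontinuous Q.
Hypothesis Qrad : forall z, 0 < cmod z -> Q z = (q (cmod z))%:E.
Hypothesis qsmooth : forall (k : nat) (r : R), 0 < r -> derivable (derive1n k q) r 1.
Hypothesis Qsub : subharmonic Q.

(** The potential as a function of s = |z|^2 rather than of |z|: in this variable area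
    becomes Lebesgue measure. *)
Definition radial_pot (s : R) : R := fine (Q (Num.sqrt s, 0)).
Local Notation V := radial_pot.
(** This is s V'(s). It turns out to be the mass that the equilibrium measure gives to
    {|z|^2 <= s}, as long as it does not exceed 1. *)
Definition radial_mass (s : R) : R := Num.sqrt s * derive1 q (Num.sqrt s) / 2.
Local Notation h := radial_mass.
(** One quarter of the Laplacian of the potential on the circle |z|^2 = s. *)
Definition radial_dens (s : R) : R := derive1 radial_mass s.
Local Notation h' := radial_dens.

Lemma Q_fin z : Q z \is a fin_num.
Proof. by rewrite fin_numElt Qnoo/=; have [+ _ _] := Qsub; exact. Qed.

Lemma cmod_sqrt (s : R) : cmod (Num.sqrt s, 0) = Num.sqrt s.
Proof. by rewrite /cmod/= expr0n/= addr0 sqrtr_sqr ger0_norm. Qed.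

Lemma modsq_eq0 (z : R * R) : modsq z = 0 -> z = (0, 0).
Proof.
move=> /eqP; rewrite paddr_eq0 ?sqr_ge0// !sqrf_eq0; case: z => x y /=.
by move=> /andP[/eqP -> /eqP ->].
Qed.

(** At the origin, where the radial formula for Q says nothing, V(0) is Q(0) by
    definition. *)
Lemma QV z : Q z = (V (modsq z))%:E.
Proof.
rewrite /V fineK ?Q_fin//.
have [z0|z0] := ltP 0 (modsq z).
  by rewrite !Qrad ?cmod_sqrt ?sqrtr_gt0// cmodE.
have /modsq_eq0 -> : modsq z = 0 by apply/le_anti; rewrite z0 modsq_ge0.
by rewrite /modsq/= expr0n/= addr0 sqrtr0.
Qed.

Lemma V_q s : 0 < s -> V s = q (Num.sqrt s).
Proof. by move=> s0; rewrite /V Qrad ?cmod_sqrt ?sqrtr_gt0. Qed.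

Lemma V_le0 s : s <= 0 -> V s = V 0.
Proof. by move=> s0; rewrite /V ler0_sqrtr// sqrtr0. Qed.

Lemma is_derive_V (s : R) : 0 < s -> is_derive s 1 V (h s / s).
Proof.
move=> s0; have r0 : 0 < Num.sqrt s by rewrite sqrtr_gt0.
have dq : is_derive (Num.sqrt s) 1 q (derive1 q (Num.sqrt s)).
  by split; [exact: (@qsmooth 0%N _ r0)|rewrite derive1E].
have d1 := is_derive1_comp dq (is_derive1_sqrt s0).
have E : derive1 q (Num.sqrt s) * (2 * Num.sqrt s)^-1 = h s / s.
  rewrite -[X in _ = _ / X](sqr_sqrtr (ltW s0)) /radial_mass; field; by rewrite gt_eqF.
rewrite -E; apply: near_eq_is_derive d1.
by apply: filterS (lt_nbhsr s0) => t t0; rewrite V_q.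
Qed.

Lemma is_derive_h (s : R) : 0 < s -> is_derive s 1 h (h' s).
Proof.
move=> s0; have r0 : 0 < Num.sqrt s by rewrite sqrtr_gt0.
have dq : is_derive (Num.sqrt s) 1 (derive1 q) (derive1n 2 q (Num.sqrt s)).
  by split; [exact: (@qsmooth 1%N _ r0)|rewrite /derive1n/= [RHS]derive1E].
have d1 := is_derive1_comp dq (is_derive1_sqrt s0).
have d2 := is_deriveM (is_derive1_sqrt s0) d1.
have d3 := is_deriveM d2 (is_derive_cst (2^-1 : R) s 1).
have [d4 _] := d3.
have d5 : derivable h s 1 by exact: d4.
apply: DeriveDef; first exact: d5.
by rewrite /radial_dens derive1E.
Qed.

Lemma cvg_V (s : R) : 0 < s -> V t @[t --> s] --> V s.
Proof.
move=> s0; have [d _] := is_derive_V s0.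
exact: (differentiable_continuous ((derivable1_diffP _ _).1 d)).
Qed.

Lemma cvg_h (s : R) : 0 < s -> h t @[t --> s] --> h s.
Proof.
move=> s0; have [d _] := is_derive_h s0.
exact: (differentiable_continuous ((derivable1_diffP _ _).1 d)).
Qed.

(** Lower semicontinuity of Q and of -Q at the origin give continuity of V at 0. *)
Lemma V_near0 (e : R) : 0 < e -> exists2 d, 0 < d &
  forall s, s <= d -> `|V s - V 0| < e.
Proof.
move=> e0.
have key : \forall z \near ((0, 0) : R * R), `|V (modsq z) - V 0| < e.
  have m0 : modsq ((0, 0) : R * R) = 0 by rewrite /modsq/= expr0n/= addr0.
  have H1 : ((V 0 - e)%:E < Q (0, 0)%R)%E by rewrite QV m0 lte_fin; lra.
  have [A nA HA] := Qlsc H1.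
  have [_ usc _] := Qsub.
  have H2 : ((- V 0 - e)%:E < - Q (0, 0)%R)%E by rewrite QV m0 -EFinN lte_fin; lra.
  have [B nB HB] := usc _ _ H2.
  near=> z.
  have Az : A z by near: z.
  have Bz : B z by near: z.
  have := HA _ Az; have := HB _ Bz; rewrite QV -EFinN !lte_fin => h1 h2.
  by rewrite ltr_norml; lra.
move: key => /nbhs_ballP[d /= d0 H].
(* The norm balls of the plane are squares of half-side d; half of it keeps (sqrt s, 0)
   strictly inside. *)
exists ((d / 2) ^+ 2); first by rewrite exprn_gt0// divr_gt0.
move=> s sd; have [s0|s0] := leP s 0.
  by rewrite (V_le0 s0) subrr normr0.
have : ball ((0, 0) : R * R) d (Num.sqrt s, 0).
  split => /=; rewrite /ball/= ?subrr ?normr0// sub0r normrN ger0_norm//.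
  rewrite (@le_lt_trans _ _ (d / 2))//; last lra.
  by rewrite -(ger0_norm (ltW (divr_gt0 d0 _)))// -sqrtr_sqr ler_wsqrtr.
by move=> /H; rewrite /modsq/= expr0n/= addr0 sqr_sqrtr// ltW.
Unshelve. all: by end_near. Qed.

Lemma continuous_V : continuous V.
Proof.
move=> s; have [s0|s0|->] := ltgtP s 0; last 1 first.
- apply/cvgrPdist_lt => e e0; have [d d0 H] := V_near0 e0.
  have N : \forall t \near (0 : R), t <= d by apply: filterS (lt_nbhsl d0) => t; exact: ltW.
  by apply: filterS N => t td; rewrite distrC; exact: H.
- apply: (@cvg_trans _ ((fun=> V 0) @ s)); last first.
    by rewrite (V_le0 (ltW s0)); exact: (@cvg_cst _ _ _ (nbhs s)).
  apply: near_eq_cvg; near=> t; rewrite [RHS]V_le0//.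
  near: t; apply: filterS (lt_nbhsl s0) => t; exact: ltW.
- exact: cvg_V.
Unshelve. all: by end_near. Qed.

(** Evaluated by the fundamental theorem of calculus with an explicit primitive. *)
Lemma integral_cos2 (a0 a1 a2 : R) :
  (\int[leb]_(t in `[0%R, (2 * pi)%R]) (a0 + a1 * cos t + a2 * cos t ^+ 2)%:E =
   ((a0 + a2 / 2) * (2 * pi))%:E)%E.
Proof.
pose F (t : R) : R := a0 * t + a1 * sin t + a2 / 2 * (t + sin t * cos t).
have dF (t : R) : is_derive t 1 F (a0 + a1 * cos t + a2 * cos t ^+ 2).
  have S : sin t * sin t = 1 - cos t ^+ 2 by rewrite -expr2 sin2cos2.
  apply: is_derive_eq; rewrite /GRing.scale/= !mulr1 mulrN S.
  by field.
have cF t : F x @[x --> t] --> F t.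
  by have [d _] := dF t; exact: (differentiable_continuous ((derivable1_diffP _ _).1 d)).
rewrite (@continuous_FTC2 _ _ F).
- rewrite /F -EFinB mulr_natl sin2pi cos2pi sin0 cos0; congr EFin; ring.
- by rewrite mulr_gt0// pi_gt0.
- apply: continuous_subspaceT => t.
  apply: cvgD; first apply: cvgD; first exact: cvg_cst.
    by apply: cvgM; [exact: cvg_cst|exact: continuous_cos].
  apply: cvgM; first exact: cvg_cst.
  by apply: cvgM; exact: continuous_cos.
- split.
  + by move=> t _; have [] := dF t.
  + by apply: cvg_at_right_filter; exact: cF.
  + by apply: cvg_at_left_filter; exact: cF.
- by move=> t _; rewrite derive1E; have [_ ->] := dF t.
Qed.

(** The circle of radius r around the point (sqrt s, 0) of the circle |z|^2 = s, in the
    variable |z|^2. *)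
Lemma submean s r : 0 < s -> 0 < r ->
  ((V s)%:E <= ((2 * pi)^-1)%:E * \int[leb]_(t in `[0%R, (2 * pi)%R])
     (V (s + (r ^+ 2 + 2 * r * Num.sqrt s * cos t)))%:E)%E.
Proof.
move=> s0 r0; have [_ _ /(_ (Num.sqrt s, 0) r r0)] := Qsub.
rewrite QV/= (_ : modsq _ = s); last first.
  by rewrite /modsq/= expr0n/= addr0 sqr_sqrtr// ltW.
congr (_ <= _ * _)%E; apply: eq_integral => t _; rewrite QV; congr (V _)%:E.
rewrite /modsq/= add0r sqrrD sqr_sqrtr ?(ltW s0)// !exprMn.
rewrite sin2cos2; ring.
Qed.

(** If the Laplacian were negative at a point, a second-order Taylor expansion of V
    would contradict the sub-mean value inequality on small circles around it: the mean
    of the quadratic upper bound is smaller than the value at the centre. *)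
Lemma radial_dens_ge0 s : 0 < s -> 0 <= h' s.
Proof.
move=> s0; rewrite leNgt; apply/negP => h0.
have sn0 : s != 0 by rewrite gt_eqF.
pose l := (h' s * s - h s) / s ^+ 2.
have dd : is_derive s 1 (fun t => h t / t) l.
  have d1 := is_deriveM (is_derive_h s0) (is_deriveV sn0 (is_derive_id s 1)).
  by apply: (is_derive_eq d1); rewrite /GRing.scale/= /l; field.
have dn : \forall x \near s, is_derive (x : R) 1 V (h x / x).
  by apply: filterS (lt_nbhsr s0) => x x0; exact: is_derive_V.
(* With this eta the mean of the Taylor bound exceeds V(s) by r^2 (3/4 h'(s) + O(r^2)),
   which is negative for small r. *)
pose eta := - h' s / (8 * s).
have eta0 : 0 < eta by rewrite divr_gt0 ?mulr_gt0// oppr_gt0.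
have [d d0 H] := derive_expand2 dn dd eta0.
pose c := l / 2 + eta.
have rs0 : 0 <= Num.sqrt s by [].
pose r := Num.min 1 (Num.min (d / (1 + 2 * Num.sqrt s)) (- h' s / (4 * (`|c| + 1)))).
have D1 : 0 < 1 + 2 * Num.sqrt s by lra.
have D2 : 0 < 4 * (`|c| + 1) by have := normr_ge0 c; lra.
have r0 : 0 < r by rewrite !lt_min ltr01 !divr_gt0// oppr_gt0.
have r1 : r <= 1 by rewrite ge_min lexx.
have r2 : r * (1 + 2 * Num.sqrt s) <= d by rewrite -ler_pdivlMr// /r !ge_min lexx !orbT.
have r3 : r * (4 * (`|c| + 1)) <= - h' s by rewrite -ler_pdivlMr// /r !ge_min lexx !orbT.
have rr : r ^+ 2 <= r by rewrite expr2 ger_pMl.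
pose u t := r ^+ 2 + 2 * r * Num.sqrt s * cos t.
pose a0 := V s + h s / s * r ^+ 2 + c * r ^+ 4.
pose a1 := (h s / s + 2 * c * r ^+ 2) * (2 * r * Num.sqrt s).
pose a2 := c * (2 * r * Num.sqrt s) ^+ 2.
have cu : continuous u.
  move=> t; apply: cvgD; first exact: cvg_cst.
  by apply: cvgM; [exact: cvg_cst|exact: continuous_cos].
have cVu : continuous (fun t => V (s + u t)).
  move=> t; apply: (continuous_comp (f := fun t => s + u t) (g := V)); last exact: continuous_V.
  by apply: cvgD; [exact: cvg_cst|exact: cu].
have cP : continuous (fun t => a0 + a1 * cos t + a2 * cos t ^+ 2).
  move=> t; apply: cvgD; first apply: cvgD; first exact: cvg_cst.
    by apply: cvgM; [exact: cvg_cst|exact: continuous_cos].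
  apply: cvgM; first exact: cvg_cst.
  by apply: cvgM; exact: continuous_cos.
have le1 : (\int[leb]_(t in `[0%R, (2 * pi)%R]) (V (s + u t))%:E <=
    \int[leb]_(t in `[0%R, (2 * pi)%R]) (a0 + a1 * cos t + a2 * cos t ^+ 2)%:E)%E.
  apply: le_integral.
  - exact: measurable_itv.
  - apply: (continuous_compact_integrable (f := fun t => V (s + u t))); first exact: segment_compact.
    exact: continuous_subspaceT.
  - apply: (continuous_compact_integrable (f := fun t => a0 + a1 * cos t + a2 * cos t ^+ 2)); first exact: segment_compact.
    exact: continuous_subspaceT.
  move=> t _; rewrite lee_fin.
  have ut : `|s + u t - s| <= d.
    rewrite addrAC subrr add0r /u (le_trans (ler_normD _ _))//.
    rewrite ger0_norm ?sqr_ge0// normrM ger0_norm ?mulr_ge0 ?(ltW r0)//.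
    rewrite (le_trans _ r2)// mulrDr mulr1 lerD// .
    rewrite (_ : r * (2 * _) = 2 * r * Num.sqrt s); last by ring.
    rewrite ler_piMr// ?mulr_ge0 ?(ltW r0)//.
    by rewrite ler_norml cos_geN1 cos_le1.
  have := H _ ut; rewrite ler_norml => /andP[_].
  rewrite (addrAC s) subrr add0r => H2.
  have -> : a0 + a1 * cos t + a2 * cos t ^+ 2 = V s + h s / s * u t + (l / 2 + eta) * u t ^+ 2.
    by rewrite /a0 /a1 /a2 /u -/c; ring.
  lra.
have := le_trans (submean s0 r0) (lee_wpmul2l _ le1).
rewrite lee_fin invr_ge0 mulr_ge0 ?pi_ge0// => /(_ isT).
rewrite integral_cos2 -EFinM lee_fin mulrCA mulVf ?mulr1; last first.
  by rewrite gt_eqF// mulr_gt0// pi_gt0.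
rewrite /a0 /a2 !exprMn sqr_sqrtr ?(ltW s0)// => main.
have : 0 <= r ^+ 2 * (h s / s + c * (r ^+ 2 + 2 * s)).
  by move: main; lra.
rewrite pmulr_rge0 ?exprn_gt0//.
have -> : h s / s + c * (r ^+ 2 + 2 * s) = 3 / 4 * h' s + c * r ^+ 2.
  by rewrite /c /l /eta; field.
have : c * r ^+ 2 <= `|c| * r.
  by rewrite (le_trans (ler_norm _))// normrM [`|r ^+ 2|]ger0_norm ?sqr_ge0// ler_wpM2l.
have : 0 <= r * 4 by lra.
lra.
Qed.

(** Its derivative is nonnegative by subharmonicity. *)
Lemma radial_mass_nd s t : 0 < s -> s <= t -> h s <= h t.
Proof.
move=> s0 st; apply: (@derive_ge0_le _ h h' s t st) => x /andP[sx _].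
  by apply: is_derive_h; exact: lt_le_trans sx.
by apply: radial_dens_ge0; exact: lt_le_trans sx.
Qed.

Lemma derive_e1 (f : R * R -> R) z : 'D_((1, 0) : R * R) f z = 'D_1 (fun x : R => f (x, z.2)) z.1.
Proof.
rewrite /derive; congr (lim (_ @ 0^')); apply/funext => e.
by rewrite /shift/= -[e *: (1, 0)]/(e *: 1, e *: (0:R)) /= scaler0 /= -[_ + z]/(e *: 1 + z.1, 0 + z.2) add0r; case: z.
Qed.

Lemma derive_e2 (f : R * R -> R) z : 'D_((0, 1) : R * R) f z = 'D_1 (fun y : R => f (z.1, y)) z.2.
Proof.
rewrite /derive; congr (lim (_ @ 0^')); apply/funext => e.
by rewrite /shift/= -[e *: (0, 1)]/(e *: (0:R), e *: 1) /= scaler0 /= -[_ + z]/(0 + z.1, e *: 1 + z.2) add0r; case: z.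
Qed.

Lemma is_derive_line (b x : R) : 0 < x ^+ 2 + b ->
  is_derive x 1 (fun x => V (x ^+ 2 + b)) (h (x ^+ 2 + b) / (x ^+ 2 + b) * (2 * x)).
Proof.
move=> m0; have d1 := is_derive_V m0.
have d2 : is_derive x 1 (fun x => x ^+ 2 + b) (2 * x).
  by apply: is_derive_eq; rewrite /GRing.scale/= ?addr0 ?mulr1 ?expr1 ?mulr_natl.
exact: (@is_derive1_comp _ V (fun x => x ^+ 2 + b) x _ _ d1 d2).
Qed.

Lemma derive2_line (b x : R) : 0 < x ^+ 2 + b ->
  'D_1 (fun x : R => 'D_1 (fun x : R => V (x ^+ 2 + b)) x) x =
  (h' (x ^+ 2 + b) * (x ^+ 2 + b) - h (x ^+ 2 + b)) / (x ^+ 2 + b) ^+ 2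
    * (4 * x ^+ 2) + 2 * (h (x ^+ 2 + b) / (x ^+ 2 + b)).
Proof.
move=> m0; set m := x ^+ 2 + b; have mn0 : m != 0 by rewrite gt_eqF.
have E : {near x, (fun x : R => 'D_1 (fun x : R => V (x ^+ 2 + b)) x) =1
   (fun x => h (x ^+ 2 + b) / (x ^+ 2 + b) * (2 * x))}.
  have c : (fun x : R => x ^+ 2 + b) t @[t --> x] --> x ^+ 2 + b.
    by apply: cvgD; [apply: cvgM; exact: cvg_id|exact: cvg_cst].
  have c' : \forall t \near x, 0 < t ^+ 2 + b by exact: c _ (lt_nbhsr m0).
  by apply: filterS c' => t /= t0; have [_ ->] := is_derive_line t0.
rewrite (near_eq_derive _ E).
have dv : is_derive (m : R) 1 (fun x : R => x^-1) (- m ^- 2 *: 1).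
  exact: (@is_deriveV R id m 1 1 mn0 (is_derive_id _ _)).
have d1 := is_deriveM (is_derive_h m0) dv.
have d2 : is_derive x 1 (fun x => x ^+ 2 + b) (2 * x).
  by apply: is_derive_eq; rewrite /GRing.scale/= ?addr0 ?mulr1 ?expr1 ?mulr_natl.
have d3 := @is_derive1_comp _ _ (fun x => x ^+ 2 + b) x _ _ d1 d2.
have d4 : is_derive x 1 (fun x : R => 2 * x) 2.
  by apply: is_derive_eq; rewrite /GRing.scale/= mulr1.
have [_ d5] := is_deriveM d3 d4.
have -> : (fun x : R => h (x ^+ 2 + b) / (x ^+ 2 + b) * (2 * x)) =
  ((h * (fun x => x^-1)) \o (fun x => x ^+ 2 + b)) * (fun x => 2 * x) by [].
rewrite d5 -[LHS]/(h m / m * 2 +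
  2 * x * ((h m * (- m ^- 2 * 1) + m^-1 * h' m) * (2 * x))).
by field.
Qed.

(** In polar coordinates the Laplacian of V(|z|^2) is 4 (s V'(s))'. *)
Lemma laplacian_radial w : 0 < modsq w -> laplacian (fine \o Q) w = 4 * h' (modsq w).
Proof.
move=> w0; have E : fine \o Q = fun z : R * R => V (modsq z) by apply/funext => z /=; rewrite QV.
rewrite /laplacian E derive_e1 derive_e2.
have -> : (fun x : R => 'D_((1, 0) : R * R) (fun z : R * R => V (modsq z)) (x, w.2)) =
    (fun x : R => 'D_1 (fun x : R => V (x ^+ 2 + w.2 ^+ 2)) x).
  by apply/funext => x; rewrite derive_e1.
have -> : (fun x : R => 'D_((0, 1) : R * R) (fun z : R * R => V (modsq z)) (w.1, x)) =
    (fun x : R => 'D_1 (fun x : R => V (x ^+ 2 + w.1 ^+ 2)) x).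
  apply/funext => x; rewrite derive_e2; congr (derive _ x 1).
  by apply/funext => y; rewrite /modsq/= addrC.
have w0' : 0 < w.2 ^+ 2 + w.1 ^+ 2 by rewrite addrC.
rewrite (derive2_line w0) (derive2_line w0') (addrC (w.2 ^+ 2)) -/(modsq w).
have wE : w.2 ^+ 2 = modsq w - w.1 ^+ 2 by rewrite /modsq addrC addKr.
rewrite wE; field; by rewrite gt_eqF.
Qed.

(** A negative value of h would persist towards 0 by monotonicity, so V' <= -c/x there
    and V would tend to +oo at the origin, where it is continuous. *)
Lemma radial_mass_ge0 s : 0 < s -> 0 <= h s.
Proof.
move=> s0; rewrite leNgt; apply/negP => hs0.
have [d d0 H] := V_near0 ltr01.
pose c := - h s; have c0 : 0 < c by rewrite oppr_gt0.
pose t0 := Num.min s d.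
have t00 : 0 < t0 by rewrite lt_min s0.
(* From t to t0 the function V drops by at least 2, whereas it stays within 1 of V(0).
   *)
pose t := t0 * expR (- (2 / c)).
have e1 : expR (- (2 / c)) < 1 by rewrite -expR0 ltr_expR oppr_lt0 divr_gt0.
have t1 : 0 < t by rewrite mulr_gt0 ?expR_gt0.
have tt0 : t < t0 by rewrite gtr_pMr.
have t0s : t0 <= s by rewrite ge_min lexx.
have t0d : t0 <= d by rewrite ge_min lexx orbT.
have : - V t - c * ln t <= - V t0 - c * ln t0.
  apply: (@derive_ge0_le _ (fun x => - V x - c * ln x) (fun x => (- h x - c) / x)); first exact: ltW.
    move=> x /andP[tx _]; have x0 := lt_le_trans t1 tx.
    have d1 := is_derive_V x0; have d2 := is_derive1_ln x0.
    by apply: is_derive_eq; rewrite /GRing.scale/= ?mulr0 ?addr0; field; rewrite gt_eqF.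
  move=> x /andP[tx xt]; have x0 := lt_le_trans t1 tx.
  rewrite divr_ge0 ?(ltW x0)// subr_ge0 lerN2; apply: radial_mass_nd => //.
  exact: le_trans t0s.
rewrite /t lnM ?posrE ?expR_gt0// expRK => H1.
have := H t; rewrite (le_trans (ltW tt0) t0d) => /(_ isT).
have := H t0 t0d.
rewrite !ltr_norml => /andP[a1 a2] /andP[b1 b2].
have E : c * (ln t0 - 2 / c) = c * ln t0 - 2 by field; rewrite gt_eqF.
move: H1; rewrite E -/t => H1.
by lra.
Qed.

(** A positive lower bound on h would make V' >= p/x near 0 and V would tend to -oo at
    the origin. *)
Lemma radial_mass_near0 p : 0 < p -> exists2 s, 0 < s & h s < p.
Proof.
move=> p0; apply: contrapT => /forall2NP H.
have hp s : 0 < s -> p <= h s.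
  by move=> s0; have [//|/negP] := H s; rewrite -leNgt.
have [d d0 Hd] := V_near0 ltr01.
(* From t to d the function V grows by at least 2, whereas it stays within 1 of V(0). *)
pose t := d * expR (- (2 / p)).
have e1 : expR (- (2 / p)) < 1 by rewrite -expR0 ltr_expR oppr_lt0 divr_gt0.
have t1 : 0 < t by rewrite mulr_gt0 ?expR_gt0.
have td : t < d by rewrite gtr_pMr.
have : V t - p * ln t <= V d - p * ln d.
  apply: (@derive_ge0_le _ (fun x => V x - p * ln x) (fun x => (h x - p) / x)); first exact: ltW.
    move=> x /andP[tx _]; have x0 := lt_le_trans t1 tx.
    have d1 := is_derive_V x0; have d2 := is_derive1_ln x0.
    by apply: is_derive_eq; rewrite /GRing.scale/= mulrBl.
  move=> x /andP[tx xt]; have x0 := lt_le_trans t1 tx.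
  by rewrite divr_ge0 ?(ltW x0)// subr_ge0; exact: hp.
rewrite /t lnM ?posrE ?expR_gt0// expRK => H1.
have := Hd t (ltW td); have := Hd d (lexx d).
rewrite !ltr_norml => /andP[a1 a2] /andP[b1 b2].
have E : p * (ln d - 2 / p) = p * ln d - 2 by field; rewrite gt_eqF.
move: H1; rewrite E -/t => H1.
by lra.
Qed.

Hypothesis Qgrowth :
  (2%:E < limf_einf (fun z => Q z / (ln (cmod z))%:E) (@at_infinity R))%E.

(** The growth condition reads Q >= 2c log|z| with c > 1, that is V(s) >= c ln s. *)
Lemma V_growth : exists c M, [/\ 1 < c, 1 < M & forall s, M < s -> c * ln s <= V s].
Proof.
move: Qgrowth; rewrite limf_einfE => /ereal_sup_gt[_ [A [M HA] <-] H].
have [c [c1 Hc]] : exists c : R, 1 < c /\ forall z, A z ->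
    ((2 * c)%:E <= Q z / (ln (cmod z))%:E)%E.
  case: (ereal_inf _) H (@ereal_inf_lbound _ ((fun z => Q z / (ln (cmod z))%:E)%E @` A)) => [r H1 H2|_ H2|//].
    exists (r / 2); split; first by rewrite ltr_pdivlMr// mul1r -lte_fin.
    by move=> z Az; rewrite mulrCA mulfV// mulr1; apply: H2; exists z.
  exists 2; split; first by rewrite ltr1n.
  move=> z Az; apply: (@le_trans _ _ +oo%E); first by rewrite leey.
  by apply: H2; exists z.
pose N := Num.max 2 (`|M| + 1).
have N1 : 1 < N by rewrite lt_max ltr1n.
exists c, (N ^+ 2); split => //.
  by rewrite exprn_egt1.
move=> s Ns; have s1 : 1 < s by apply: lt_trans Ns; rewrite exprn_egt1.
have s0 : 0 < s by exact: lt_trans ltr01 s1.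
have Nsq : N < Num.sqrt s.
  rewrite -(ger0_norm (ltW (lt_trans ltr01 N1))) -sqrtr_sqr ltr_sqrt//.
have As : A (Num.sqrt s, 0).
  apply: HA; rewrite cmod_sqrt (lt_trans _ Nsq)// /N lt_max; apply/orP; right.
  by rewrite (le_lt_trans (ler_norm M))// ltrDl.
have := Hc _ As; rewrite cmod_sqrt QV.
have ls : 0 < ln (Num.sqrt s).
  by rewrite ln_gt0// -[X in X < _]sqrtr1 ltr_sqrt.
rewrite inver gt_eqF// -EFinM lee_fin ler_pdivlMr//.
rewrite /modsq/= expr0n/= addr0 sqr_sqrtr ?(ltW s0)//; apply: le_trans.
rewrite -{1}(sqr_sqrtr (ltW s0)) lnXn ?sqrtr_gt0// -mulr_natl; lra.
Qed.

(** If h stayed below 1, then V(s) <= V(1) + ln s, contradicting growth. *)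
Lemma radial_mass_ge1 : exists2 s, 0 < s & 1 <= h s.
Proof.
have [c [M [c1 M1 H]]] := V_growth.
apply: contrapT => /forall2NP Hn.
have hp s : 0 < s -> h s < 1.
  by move=> s0; have [//|/negP] := Hn s; rewrite -ltNge.
have bd s : 1 <= s -> V s <= V 1 + ln s.
  move=> s1; suff : ln 1 - V 1 <= ln s - V s by rewrite ln1; lra.
  apply: (@derive_ge0_le _ (fun x => ln x - V x) (fun x => (1 - h x) / x)) => // x /andP[x1 _].
    have x0 := lt_le_trans ltr01 x1.
    have d1 := is_derive_V x0; have d2 := is_derive1_ln x0.
    by apply: is_derive_eq; rewrite mulrBl mul1r.
  have x0 := lt_le_trans ltr01 x1.
  by rewrite divr_ge0 ?(ltW x0)// subr_ge0 ltW// hp.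
pose L := Num.max (ln M + 1) ((V 1 + 1) / (c - 1)).
have LM : M < expR L.
  have M0 : 0 < M by exact: lt_trans M1.
  by rewrite -[X in X < _](@lnK _ M)// ltr_expR lt_max ltrDl ltr01.
have := H _ LM; have := bd (expR L); rewrite (ltW (lt_trans M1 LM)) => /(_ isT).
rewrite expRK => h1 h2.
have : (V 1 + 1) / (c - 1) <= L by rewrite le_max lexx orbT.
by rewrite ler_pdivrMr ?subr_gt0//; lra.
Qed.

(** The quantile function of the equilibrium measure in the variable |z|^2; its value at
    1 is the squared outer radius. *)
Definition mass_quantile (p : R) : R := inf [set s | 0 < s /\ p <= h s].
Local Notation Hq := mass_quantile.

Lemma quantile_inf p : p <= 1 -> has_inf [set s | 0 < s /\ p <= h s].
Proof.
move=> p1; split.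
  by have [s s0 hs] := radial_mass_ge1; exists s; split => //; exact: le_trans hs.
by exists 0 => s /= [/ltW].
Qed.

(** The Galois connection between a nondecreasing continuous function and its quantile
    function; continuity makes the set of s with p <= h(s) closed. *)
Lemma quantile_le p t : p <= 1 -> 0 < t -> (Hq p <= t) = (p <= h t).
Proof.
move=> p1 t0; apply/idP/idP => [|H]; last first.
  by apply: ge_inf; [exact: (quantile_inf p1).2|].
move=> Ht; rewrite leNgt; apply/negP => hp.
have N : \forall x \near t, h x < p by exact: (cvgr_lt _ (cvg_h t0) _ hp).
move: N => /nbhs_ballP[e /= e0 He].
have : t + e / 2 <= Hq p.
  apply: lb_le_inf; first exact: (quantile_inf p1).1.
  move=> s /= [s0 ps]; rewrite leNgt; apply/negP => ste.
  have [st|ts] := leP s t.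
    by move: hp; rewrite ltNge (le_trans ps)// radial_mass_nd.
  have /He : ball t e s.
    rewrite /ball/= ltr0_norm ?subr_lt0// opprB.
    have : e / 2 < e by rewrite ltr_pdivrMr// ltr_pMr// ltr1n.
    lra.
  by rewrite ltNge ps.
have : 0 < e / 2 by rewrite divr_gt0.
lra.
Qed.

Lemma quantile_ge0 p : p <= 1 -> 0 <= Hq p.
Proof.
by move=> p1; apply: lb_le_inf; [exact: (quantile_inf p1).1|move=> s /= [/ltW]].
Qed.

Lemma quantile_gt0 p : 0 < p -> p <= 1 -> 0 < Hq p.
Proof.
move=> p0 p1; have [s s0 hs] := radial_mass_near0 p0.
apply: (lt_trans s0); rewrite ltNge quantile_le// -ltNge//.
Qed.

(** Here h is continuous, so that it takes the value p at its p-quantile. *)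
Lemma mass_quantileK p : 0 < p -> p <= 1 -> h (Hq p) = p.
Proof.
move=> p0 p1; have H0 := quantile_gt0 p0 p1.
apply/le_anti; rewrite -quantile_le// lexx andbT leNgt; apply/negP => hp.
have N : \forall x \near Hq p, p < h x by exact: (cvgr_gt _ (cvg_h H0) _ hp).
move: N => /nbhs_ballP[e /= e0 He].
pose m := Num.min (e / 2) (Hq p / 2).
have m0 : 0 < m by rewrite lt_min !divr_gt0.
have me : m <= e / 2 by rewrite ge_min lexx.
have mH : m <= Hq p / 2 by rewrite ge_min lexx orbT.
have : ball (Hq p) e (Hq p - m).
  rewrite /ball/= opprB addrC subrK gtr0_norm//; lra.
move=> /He/= /ltW; rewrite -quantile_le//; lra.
Qed.

Lemma quantile_lt p s : p <= 1 -> 0 < s -> s < Hq p -> h s < p.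
Proof. by move=> p1 s0; rewrite !ltNge quantile_le. Qed.

(** Extended by constants to a nondecreasing function on the whole line, which makes its
    measurability immediate. *)
Definition quantile01 (p : R) : R := if p <= 0 then 0 else Hq (Num.min p 1).

Lemma quantile01_nd : {homo quantile01 : x y / x <= y}.
Proof.
move=> x y xy; rewrite /quantile01; case: ifPn => [x0|].
  by case: ifPn => // _; apply: quantile_ge0; rewrite ge_min lexx orbT.
rewrite -ltNge => x0; rewrite [y <= 0]leNgt (lt_le_trans x0 xy)/=.
have y0 := lt_le_trans x0 xy.
have y1 : Num.min y 1 <= 1 by rewrite ge_min lexx orbT.
have x1 : Num.min x 1 <= 1 by rewrite ge_min lexx orbT.
rewrite quantile_le// ?quantile_gt0 ?lt_min ?y0 ?ltr01//.
rewrite mass_quantileK ?lt_min ?y0 ?ltr01//.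
by rewrite le_min !ge_min xy lexx !orbT.
Qed.

End potential.

(** * Supports of probability measures on the plane *)

Section plane.
Variable R : realType.
Local Notation supp := (@Defs.support R).

(** A countable base of the plane, through which open sets are Borel for the product
    sigma-algebra. *)
Definition rat_rect (p : (rat * rat) * (rat * rat)) : set (R * R) :=
  `]ratr p.1.1, ratr p.1.2[ `*` `]ratr p.2.1, ratr p.2.2[.

Definition rat_rect_sel (P : (rat * rat) * (rat * rat) -> Prop) (n : nat) : set (R * R) :=
  if unpickle n is Some p then if `[< P p >] then rat_rect p else set0 else set0.

Lemma measurable_rat_rect_sel P n : measurable (rat_rect_sel P n).
Proof.
rewrite /rat_rect_sel; case: unpickle => // p; case: ifP => // _.
by apply: measurableX; exact: measurable_itv.
Qed.

Lemma rat_rect_sel_sub P (A : set (R * R)) : (forall p, P p -> rat_rect p `<=` A) ->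
  \bigcup_n rat_rect_sel P n `<=` A.
Proof.
move=> H z [n _]; rewrite /rat_rect_sel; case: unpickle => // p.
by case: ifPn => // /asboolP Pp; exact: H.
Qed.

Lemma sub_rat_rect_sel P (A : set (R * R)) :
  (forall z, A z -> exists2 p, P p & rat_rect p z) -> A `<=` \bigcup_n rat_rect_sel P n.
Proof.
move=> H z /H[p Pp pz]; exists (pickle p); first exact: I.
by rewrite /rat_rect_sel (pickleK p) asboolT.
Qed.

Lemma nbhs_rat_rect (U : set (R * R)) z : open U -> U z ->
  exists2 p, rat_rect p `<=` U & rat_rect p z.
Proof.
move=> oU Uz; have /nbhs_ballP[e /= e0 H] := open_nbhs_nbhs (conj oU Uz).
have gap (x : R) : exists p : rat * rat, [/\ ratr p.1 < x, x < ratr p.2,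
    x - e < ratr p.1 & ratr p.2 < x + e].
  have [a /itvP Ha] : exists a, ratr a \in `]x - e, x[ by apply: rat_in_itvoo; lra.
  have [b /itvP Hb] : exists b, ratr b \in `]x, x + e[ by apply: rat_in_itvoo; lra.
  by exists (a, b); rewrite !Ha !Hb.
have [p1 [a1 a2 a3 a4]] := gap z.1; have [p2 [b1 b2 b3 b4]] := gap z.2.
exists (p1, p2); last by split; rewrite /= in_itv/= ?a1 ?a2 ?b1 ?b2.
move=> y [/=]; rewrite !in_itv/= => /andP[c1 c2] /andP[d1 d2].
apply: H; split; rewrite /ball/= ltr_norml; apply/andP; split; lra.
Qed.

Lemma measurable_open (U : set (R * R)) : open U -> measurable U.
Proof.
move=> oU.
rewrite (_ : U = \bigcup_n rat_rect_sel (fun p => rat_rect p `<=` U) n).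
  by apply: bigcup_measurable => n _; exact: measurable_rat_rect_sel.
apply/seteqP; split; last exact: rat_rect_sel_sub.
by apply: sub_rat_rect_sel => z Uz; exact: nbhs_rat_rect.
Qed.

Lemma measurable_closed (U : set (R * R)) : closed U -> measurable U.
Proof.
by move=> cU; rewrite -[U]setCK; apply: measurableC; apply: measurable_open; exact: closed_openC.
Qed.

Lemma continuous_modsq : continuous (@modsq R).
Proof.
move=> z; apply: cvgD.
  by apply: (@cvg_comp _ _ _ fst (fun x : R => x ^+ 2)); [exact: cvg_fst|exact: exprn_continuous].
by apply: (@cvg_comp _ _ _ snd (fun x : R => x ^+ 2)); [exact: cvg_snd|exact: exprn_continuous].
Qed.

Lemma continuous_crot u : continuous (@crot R u).
Proof.
move=> z.
have c1 : u.1 * y.1 - u.2 * y.2 @[y --> z] --> u.1 * z.1 - u.2 * z.2.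
  by apply: cvgB; (apply: cvgM; first exact: cvg_cst); [exact: cvg_fst|exact: cvg_snd].
have c2 : u.2 * y.1 + u.1 * y.2 @[y --> z] --> u.2 * z.1 + u.1 * z.2.
  by apply: cvgD; (apply: cvgM; first exact: cvg_cst); [exact: cvg_fst|exact: cvg_snd].
exact: (cvg_pair c1 c2).
Qed.

Lemma closed_disc (L : R) : closed [set z : R * R | modsq z <= L].
Proof.
rewrite (_ : [set z | _] = @modsq R @^-1` [set x | x <= L])//.
by apply: closed_comp; [move=> z _; exact: continuous_modsq|exact: closed_le].
Qed.

Lemma compact_disc (L : R) : compact [set z : R * R | modsq z <= L].
Proof.
have [L0|L0] := ltP L 0.
  rewrite (_ : [set z | _] = set0); first exact: compact0.
  apply/seteqP; split => // z /= zL; have := modsq_ge0 z; lra.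
apply: (@subclosed_compact _ _ (`[- (L + 1), L + 1] `*` `[- (L + 1), L + 1])).
- exact: closed_disc.
- by apply: compact_setX; exact: segment_compact.
move=> [x y] /=; rewrite /modsq/= => xy; rewrite !in_itv/=.
by split; apply/andP; split; nra.
Qed.

Lemma compact_sub_disc (S : set (R * R)) : compact S ->
  exists2 L, 0 < L & forall z, S z -> modsq z <= L.
Proof.
move=> cS.
have : compact (@modsq R @` S).
  by apply: continuous_compact => //; apply: continuous_subspaceT; exact: continuous_modsq.
move=> /(@compact_bounded R R^o)[M [_ HM]].
exists (`|M| + 1); first by rewrite ltr_wpDl.
move=> z Sz; rewrite -(ger0_norm (modsq_ge0 z)).
apply: HM; last by exists z.
by rewrite (le_lt_trans (ler_norm M))// ltrDl.
Qed.

Variable m : probability (R * R)%type R.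

Lemma closed_support : closed (supp m).
Proof.
rewrite -[supp m]setCK closedC openE => z /=.
move=> /existsNP[U /not_implyP[oU /not_implyP[Uz mU]]].
apply: (filterS _ (open_nbhs_nbhs (conj oU Uz))) => y Uy /(_ U oU Uy).
exact: mU.
Qed.

(** The complement of the support is covered by null open sets, hence by countably many
    null rational rectangles. *)
Lemma support_setC : m (~` supp m) = 0%E.
Proof.
have mS : measurable (~` supp m) by apply: measurableC; exact: measurable_closed closed_support.
apply: measure_negligible => //.
apply: (@negligibleS _ _ _ _ (\bigcup_n rat_rect_sel (fun p => m (rat_rect p) = 0%E) n)).
  apply: sub_rat_rect_sel => z /existsNP[U /not_implyP[oU /not_implyP[Uz mU]]].
  have [p pU pz] := nbhs_rat_rect oU Uz.
  exists p => //; apply/eqP; rewrite eq_le measure_ge0 andbT.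
  rewrite (@le_trans _ _ (m U))//; last by rewrite leNgt; apply/negP.
  apply: le_measure; rewrite ?inE//; last exact: measurable_open.
  by apply: measurableX; exact: measurable_itv.
apply: negligible_bigcup => n; rewrite /rat_rect_sel.
case: unpickle => [p|]; last exact: negligible_set0.
case: ifPn => [/asboolP p0|_]; last exact: negligible_set0.
apply/negligibleP => //.
by apply: measurableX; exact: measurable_itv.
Qed.

Lemma support_sub (A : set (R * R)) : closed A -> m (~` A) = 0%E -> supp m `<=` A.
Proof.
move=> cA mA z /(_ (~` A) (closed_openC cA)) H; apply: contrapT => Az.
by have := H Az; rewrite mA ltxx.
Qed.

Lemma support_disc L : (forall z, supp m z -> modsq z <= L) ->
  m [set z | modsq z <= L] = 1%E.
Proof.
move=> H; have mL : measurable [set z : R * R | modsq z <= L] by exact: measurable_disc.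
apply/eqP; rewrite eq_le probability_le1//=.
rewrite -(probability_setT m).
have mS : measurable (supp m) by exact: measurable_closed closed_support.
rewrite -(setvU (supp m)) measureU//; last first.
- by rewrite setICl.
- exact: measurableC.
rewrite [X in (X + _)%E]support_setC add0e; apply: le_measure; rewrite ?inE//.
Qed.

End plane.

(** * Integrals of functions bounded below *)

Section bounded_below.
Context d (T : measurableType d) (R : realType).
Variables (mu : {measure set T -> \bar R}) (D : set T).
Hypothesis mu1 : mu setT = 1%E.
Hypothesis mD : measurable D.
Hypothesis muD : mu (~` D) = 0%E.

Lemma ae_carrier (P : T -> Prop) : (forall x, D x -> P x) -> {ae mu, forall x, P x}.
Proof.
move=> H; exists (~` D); split => //; first exact: measurableC.
by move=> x /= Px; apply: contra_not Px => /H.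
Qed.

Lemma ge0_integral_carrier (f g : T -> \bar R) : measurable_fun setT f ->
  measurable_fun setT g -> (forall x, 0 <= f x)%E -> (forall x, 0 <= g x)%E ->
  (forall x, D x -> f x = g x) -> (\int[mu]_x f x = \int[mu]_x g x)%E.
Proof.
move=> mf mg f0 g0 fg; apply: ge0_ae_eq_integral => //.
by apply: ae_carrier => x /fg.
Qed.

Lemma ge0_le_integral_carrier (f g : T -> \bar R) : measurable_fun setT f ->
  measurable_fun setT g -> (forall x, 0 <= f x)%E -> (forall x, 0 <= g x)%E ->
  (forall x, D x -> f x <= g x)%E -> (\int[mu]_x f x <= \int[mu]_x g x)%E.
Proof.
move=> mf mg f0 g0 fg.
have -> : (\int[mu]_x f x = \int[mu]_x (mine (f x) (g x)))%E.
  apply: ge0_integral_carrier => //; first exact: measurable_mine.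
    by move=> x; rewrite le_min f0 g0.
  by move=> x /fg fgx; apply/esym/min_idPl.
apply: ge0_le_integral => //; first by move=> x _; rewrite le_min f0 g0.
  exact: measurable_mine.
by move=> x _; rewrite ge_min lexx orbT.
Qed.

Lemma integral_cst1 (c : R) : (\int[mu]_x c%:E = c%:E)%E.
Proof. by rewrite integral_cst// [X in (_ * X)%E]mu1 mule1. Qed.

(** Energies are integrals of functions that are bounded below and may be infinite;
    adding a constant reduces them to nonnegative integrals. *)
Lemma integral_shift (f : T -> \bar R) (c : R) : measurable_fun setT f -> 0 <= c ->
  (forall x, D x -> - c%:E <= f x)%E ->
  (\int[mu]_x f x = \int[mu]_x maxe (f x + c%:E) 0 - c%:E)%E.
Proof.
move=> mf c0 fc.
have mg : measurable_fun setT (fun x => maxe (f x + c%:E) 0)%E.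
  by apply: measurable_maxe => //; exact: emeasurable_funD.
have mp : measurable_fun setT (f^\+)%E by exact: measurable_funepos.
have mn : measurable_fun setT (f^\-)%E by exact: measurable_funeneg.
have g0 x : (0 <= maxe (f x + c%:E) 0)%E by rewrite le_max lexx orbT.
have n_le : (\int[mu]_x f^\- x <= c%:E)%E.
  rewrite -integral_cst1; apply: ge0_le_integral_carrier => //.
  move=> x /fc; rewrite funenegE ge_max lee_fin c0 andbT.
  by rewrite leeNl.
have n_fin : (\int[mu]_x f^\- x)%E \is a fin_num.
  by rewrite ge0_fin_numE ?integral_ge0// (le_lt_trans n_le)// ltry.
have key : (\int[mu]_x maxe (f x + c%:E) 0 + \int[mu]_x f^\- x = \int[mu]_x f^\+ x + c%:E)%E.
  rewrite -[c%:E in RHS]integral_cst1 -!ge0_integralD//.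
  apply: ge0_integral_carrier => //; [exact: emeasurable_funD|exact: emeasurable_funD| | |].
  - by move=> x; rewrite adde_ge0.
  - by move=> x; rewrite adde_ge0.
  move=> x /fc; rewrite funeposE funenegE.
  case: (f x) => [r|_|]; last first.
  - by rewrite leeNy_eq.
  - have e0 : (maxe +oo 0 = +oo :> \bar R)%E by apply/max_idPl; rewrite leey.
    have e1 : (maxe (+oo + c%:E) 0 = +oo :> \bar R)%E by apply/max_idPl; rewrite leey.
    have e2 : (maxe (- +oo) 0 = 0 :> \bar R)%E by apply/max_idPr; rewrite leNye.
    transitivity (+oo + 0 : \bar R)%E; first by congr (_ + _)%E.
    transitivity (+oo + c%:E : \bar R)%E; last by congr (_ + _)%E.
    by rewrite !addye.
  rewrite -EFinN -EFinD -!EFin_max -!EFinD lee_fin => cr.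
  rewrite [Num.max (r + c) 0]max_l; last lra.
  congr EFin; have [r0|r0] := leP 0 r.
    by rewrite max_r ?oppr_le0// addr0.
  rewrite max_l ?oppr_ge0 ?(ltW r0)//; lra.
have E : (\int[mu]_x f^\+ x = \int[mu]_x maxe (f x + c%:E) 0 + \int[mu]_x f^\- x - c%:E)%E.
  by rewrite key addeK.
by rewrite integralE E addeAC addeK.
Qed.

End bounded_below.

Section product_carrier.
Context d (T : measurableType d) (R : realType).
Variables (mu : probability T R) (D : set T).
Hypothesis mD : measurable D.
Hypothesis muD : mu D = 1%E.

Lemma product_square (A : set T) : measurable A -> ((mu \x mu) (A `*` A) = mu A * mu A)%E.
Proof. by move=> mA; rewrite product_measure1E. Qed.

Lemma product_setT : ((mu \x mu) setT = 1)%E.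
Proof.
rewrite -setXTT; apply: (etrans (product_square measurableT)).
by transitivity (1%:E * 1%:E : \bar R)%E; [congr (_ * _)%E; exact: probability_setT|rewrite mule1].
Qed.

Lemma product_carrier : ((mu \x mu) (~` (D `*` D)) = 0)%E.
Proof.
have mDD : measurable (D `*` D) by exact: measurableX.
have H : ((mu \x mu) (D `*` D) = 1)%E.
  apply: (etrans (product_square mD)).
  by transitivity (1%:E * 1%:E : \bar R)%E; [congr (_ * _)%E; exact: muD|rewrite mule1].
have E : ((mu \x mu) setT = (mu \x mu) (D `*` D) + (mu \x mu) (~` (D `*` D)))%E.
  rewrite -measureU//; [by rewrite setUv|exact: measurableC|by rewrite setICr].
move: E; rewrite product_setT H => /(congr1 (fun x => x - 1%:E)%E).
by rewrite addeAC !subee// add0e.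
Qed.

End product_carrier.

(** * The logarithmic kernel and rotation invariance *)

Section logkernel.
Variable R : realType.

(** The integrand of the logarithmic energy; it equals +oo on the diagonal. *)
Definition logk (p : (R * R) * (R * R)) : \bar R := lne ((cmod (p.1 - p.2))%:E^-1).

Lemma cmod_ge0 (z : R * R) : 0 <= cmod z. Proof. exact: sqrtr_ge0. Qed.

Lemma logkE p : 0 < cmod (p.1 - p.2) -> logk p = (- ln (cmod (p.1 - p.2)))%:E.
Proof.
by move=> p0; rewrite /logk inver gt_eqF// lne_EFin ?invr_gt0// lnV.
Qed.

Lemma logk_diag p : cmod (p.1 - p.2) = 0 -> logk p = +oo%E.
Proof. by move=> p0; rewrite /logk p0 inver eqxx. Qed.

Lemma measurable_dist :
  measurable_fun [set: (R * R) * (R * R)] (fun p : (R * R) * (R * R) => cmod (p.1 - p.2)).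
Proof.
apply: (measurableT_comp (@measurable_cmod R)).
apply: measurable_fun_pair; apply: measurable_funB; exact: measurableT_comp.
Qed.

Lemma measurable_logk : measurable_fun [set: (R * R) * (R * R)] logk.
Proof.
pose F (x : R) : \bar R := if x <= 0 then +oo%E else (- ln x)%:E.
have mF : measurable_fun [set: R] F.
  apply: measurable_fun_ifT.
  - by apply: measurable_fun_ler.
  - exact: measurable_cst.
  - by apply/measurable_EFinP; apply: measurable_funN; exact: measurable_ln.
rewrite (_ : logk = F \o (fun p : (R * R) * (R * R) => cmod (p.1 - p.2))).
  exact: (measurableT_comp mF measurable_dist).
apply/funext => p /=; rewrite /F; case: ifPn => [p0|].
  by apply: logk_diag; apply/le_anti; rewrite p0 cmod_ge0.
by rewrite -ltNge => /logkE.
Qed.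

Lemma crotB u (z w : R * R) : crot u (z - w) = crot u z - crot u w.
Proof.
by rewrite /crot/=; congr (_, _); rewrite -?[(z - w).1]/(z.1 - w.1) -?[(z - w).2]/(z.2 - w.2)/=; ring.
Qed.

Lemma logk_rot u p : modsq u = 1 -> logk (crot u p.1, crot u p.2) = logk p.
Proof. by move=> u1; rewrite /logk/= -crotB cmod_rot. Qed.

Definition rotation_invariant (m : set (R * R) -> \bar R) :=
  forall u A, modsq u = 1 -> measurable A -> m (crot u @^-1` A) = m A.

End logkernel.

Section rotate.
Variable R : realType.
Local Notation supp := (@Defs.support R).
Variables (sigma : probability (R * R)%type R) (u : R * R).

HB.instance Definition _ := isMeasurableFun.Build _ _ _ _ (@crot R u) (@measurable_rot R u).

Definition rotp : probability (R * R)%type R := distribution sigma (@crot R u).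

Lemma rotpE A : rotp A = sigma (crot u @^-1` A).
Proof. by []. Qed.

Lemma ge0_integral_rotp (f : R * R -> \bar R) : measurable_fun [set: R * R] f ->
  (forall z, 0 <= f z)%E ->
  (\int[rotp]_z f z = \int[sigma]_z f (crot u z))%E.
Proof.
move=> mf f0.
rewrite [LHS](ge0_integral_pushforward (@measurable_rot R u) _ measurableT mf)//.
Qed.

Lemma ge0_integral_rotp2 (f : (R * R) * (R * R) -> \bar R) :
  measurable_fun [set: (R * R) * (R * R)] f -> (forall z, 0 <= f z)%E ->
  (\int[rotp \x rotp]_p f p = \int[sigma \x sigma]_p f (crot u p.1, crot u p.2))%E.
Proof.
move=> mf f0.
have mr := @measurable_rot R u.
have mf' : measurable_fun [set: (R * R) * (R * R)] (fun p => f (crot u p.1, crot u p.2)).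
  apply: (measurableT_comp mf); apply: measurable_fun_pair; exact: measurableT_comp.
rewrite (@fubini_tonelli1 _ _ _ _ _ rotp rotp _ mf (fun=> f0 _)).
rewrite (@fubini_tonelli1 _ _ _ _ _ sigma sigma _ mf' (fun=> f0 _)).
rewrite /fubini_F ge0_integral_rotp.
- by apply: eq_integral => z _; rewrite ge0_integral_rotp//; exact: measurableT_comp.
- by apply: (@measurable_fun_fubini_tonelli_F _ _ _ _ _ rotp f).
- by move=> z; apply: integral_ge0 => w _.
Qed.

Lemma energy_rotp (Q : R * R -> \bar R) : measurable_fun [set: R * R] Q ->
  (forall z, Q (crot u z) = Q z) -> modsq u = 1 ->
  energy Q rotp = energy Q sigma.
Proof.
move=> mQ Qr u1; rewrite /energy; congr (_ + _)%E.
  rewrite -[LHS]/(\int[rotp \x rotp]_p logk p)%E -[RHS]/(\int[sigma \x sigma]_p logk p)%E.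
  have mk := @measurable_logk R.
  rewrite integralE [RHS]integralE; congr (_ - _)%E.
    rewrite ge0_integral_rotp2//; last exact: measurable_funepos.
    by apply: eq_integral => p _; rewrite !funeposE logk_rot.
  rewrite ge0_integral_rotp2//; last exact: measurable_funeneg.
  by apply: eq_integral => p _; rewrite !funenegE logk_rot.
rewrite integralE [RHS]integralE; congr (_ - _)%E.
  rewrite ge0_integral_rotp//; last exact: measurable_funepos.
  by apply: eq_integral => p _; rewrite !funeposE Qr.
rewrite ge0_integral_rotp//; last exact: measurable_funeneg.
by apply: eq_integral => p _; rewrite !funenegE Qr.
Qed.

Lemma compact_support_rotp : modsq u = 1 -> compact (supp sigma) -> compact (supp rotp).
Proof.
move=> u1 cS; have [L L0 HL] := compact_sub_disc cS.
apply: (@subclosed_compact _ _ [set z : R * R | modsq z <= L]).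
- exact: closed_support.
- exact: compact_disc.
apply: support_sub; first exact: closed_disc.
rewrite rotpE (_ : _ @^-1` _ = ~` [set z | modsq z <= L]); last first.
  by apply/seteqP; split => z /=; rewrite modsq_rot u1 mul1r.
have mL : measurable [set z : R * R | modsq z <= L] by exact: measurable_disc.
rewrite [LHS](probability_setC sigma mL).
by rewrite [X in (_ - X)%E](support_disc HL) subee.
Qed.

End rotate.

Section equilibrium_rot.
Variable R : realType.
Variables (Q : R * R -> \bar R) (sigma : probability (R * R)%type R).

(** A rotated copy of the minimizer has the same energy, so it coincides with it by
    uniqueness. *)
Lemma equilibrium_rotation_invariant : measurable_fun [set: R * R] Q ->
  (forall u z, modsq u = 1 -> Q (crot u z) = Q z) ->
  is_equilibrium_measure Q sigma -> rotation_invariant sigma.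
Proof.
move=> mQ Qr [cS H] u A u1 mA.
have [_ H2] := H (rotp sigma u) (compact_support_rotp u1 cS).
by rewrite -(H2 _ A mA)// energy_rotp// => z; exact: Qr.
Qed.

Hypothesis rotinv : rotation_invariant sigma.

Lemma ge0_integral_rot u (f : R * R -> \bar R) : modsq u = 1 ->
  measurable_fun [set: R * R] f -> (forall z, 0 <= f z)%E ->
  (\int[sigma]_z f (crot u z) = \int[sigma]_z f z)%E.
Proof.
move=> u1 mf f0; rewrite -ge0_integral_rotp//.
by apply: eq_measure_integral => A mA _; rewrite [LHS]rotpE rotinv.
Qed.

(** Rotating one variable only is allowed by Tonelli, as the inner integral is rotation
    invariant for each value of the other variable. *)
Lemma ge0_integral_rot2 u (f : (R * R) * (R * R) -> \bar R) : modsq u = 1 ->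
  measurable_fun [set: (R * R) * (R * R)] f -> (forall z, 0 <= f z)%E ->
  (\int[sigma \x sigma]_p f (p.1, crot u p.2) = \int[sigma \x sigma]_p f p)%E.
Proof.
move=> u1 mf f0.
have mr := @measurable_rot R u.
have mf' : measurable_fun [set: (R * R) * (R * R)] (fun p => f (p.1, crot u p.2)).
  apply: (measurableT_comp mf); apply: measurable_fun_pair => //; exact: measurableT_comp.
rewrite (@fubini_tonelli1 _ _ _ _ _ sigma sigma _ mf (fun=> f0 _)).
rewrite (@fubini_tonelli1 _ _ _ _ _ sigma sigma _ mf' (fun=> f0 _)).
apply: eq_integral => z _; rewrite /fubini_F.
by rewrite (ge0_integral_rot u1 (f := fun w => f (z, w)))//; exact: measurableT_comp.
Qed.

End equilibrium_rot.

(** * Layer-cake integration *)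

Section monotone.
Context d (T : measurableType d) (R : realType) (mu : {measure set T -> \bar R}).

Lemma monotone_cvg (D : set T) (f_ : nat -> T -> \bar R) (f : T -> \bar R) :
  measurable D -> (forall n, measurable_fun D (f_ n)) ->
  (forall n x, D x -> (0 <= f_ n x)%E) ->
  (forall x, D x -> {homo f_^~ x : n m / (n <= m)%N >-> (n <= m)%E}) ->
  (forall x, D x -> f_ n x @[n --> \oo] --> f x) ->
  (\int[mu]_(x in D) f_ n x)%E @[n --> \oo] --> (\int[mu]_(x in D) f x)%E.
Proof.
move=> mD mf f0 nd fc.
have -> : (\int[mu]_(x in D) f x = \int[mu]_(x in D) limn (f_^~ x))%E.
  by apply: eq_integral => x; rewrite inE => Dx; apply/esym/cvg_lim => //; exact: fc.
apply: cvg_monotone_convergence => // x Dx n m nm; exact: nd.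
Qed.

End monotone.

Section layer.
Variable R : realType.
Local Notation leb := (@lebesgue_measure R).
Local Notation mR := (measurableTypeR R).
Variable L : R.
Hypothesis L0 : 0 < L.

Definition cutoff (w : R -> R) (t : R) : R := if 0 < t <= L then w t else 0.

(** Layers of the primitive W of w: the integral over t is W(L) - W(s) for 0 <= s <= L.
    *)
Definition layer (w : R -> R) (s t : R) : R := if s <= t then cutoff w t else 0.

Lemma cutoff_ge0 w t : (forall t, 0 < t -> 0 <= w t) -> 0 <= cutoff w t.
Proof. by move=> w0; rewrite /cutoff; case: ifPn => // /andP[/w0]. Qed.

Lemma layer_ge0 w s t : (forall t, 0 < t -> 0 <= w t) -> 0 <= layer w s t.
Proof. by move=> w0; rewrite /layer; case: ifP => // _; exact: cutoff_ge0. Qed.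

Lemma measurable_cutoff w : measurable_fun [set: R] w -> measurable_fun [set: R] (cutoff w).
Proof.
move=> mw; apply: measurable_fun_ifT => //.
apply: measurable_and.
  exact: measurable_fun_ltr.
exact: measurable_fun_ler.
Qed.

Lemma integral_deriv_segment (w W : R -> R) (a b : R) : 0 < a -> a <= b ->
  (forall t : R, 0 < t -> is_derive t 1 W (w t)) ->
  (forall t : R, 0 < t -> w x @[x --> t] --> w t) ->
  (\int[leb]_(t in `[a, b]) (w t)%:E = (W b - W a)%:E)%E.
Proof.
move=> a0; rewrite le_eqVlt => /predU1P[<-|ab] dW cw.
  by rewrite set_itv1 integral_set1 subrr.
have cW (t : R) : 0 < t -> W x @[x --> t] --> W t.
  move=> t0; have [d _] := dW t t0.
  exact: (differentiable_continuous ((derivable1_diffP _ _).1 d)).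
have b0 := lt_trans a0 ab.
rewrite (@continuous_FTC2 _ _ W)//.
- apply: continuous_in_subspaceT => t; rewrite inE/= in_itv/= => /andP[t1 _].
  by apply: cw; exact: lt_le_trans t1.
- split.
  + move=> t; rewrite in_itv/= => /andP[t1 _].
    by have [] := dW t (lt_trans a0 t1).
  + by apply: cvg_at_right_filter; exact: cW.
  + by apply: cvg_at_left_filter; exact: cW.
- move=> t; rewrite in_itv/= => /andP[t1 _].
  by rewrite derive1E; have [_ ->] := dW t (lt_trans a0 t1).
Qed.

Lemma integral_layer (w W : R -> R) (s : R) : 0 < s -> s <= L ->
  (forall t : R, 0 < t -> is_derive t 1 W (w t)) ->
  (forall t : R, 0 < t -> w x @[x --> t] --> w t) ->
  (\int[leb]_t (layer w s t)%:E = (W L - W s)%:E)%E.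
Proof.
move=> s0 sL dW cw; rewrite -(integral_deriv_segment s0 sL dW cw).
rewrite [RHS]integral_mkcond; apply: eq_integral => t _.
rewrite /patch mem_setE in_itv/= /layer /cutoff; have [st|st] := leP s t => //.
by rewrite (lt_le_trans s0 st)/=; case: ifP.
Qed.

Lemma measurable_layer w s : measurable_fun [set: R] w -> measurable_fun [set: R] (layer w s).
Proof.
move=> mw; apply: measurable_fun_ifT => //; first exact: measurable_fun_ler.
exact: measurable_cutoff.
Qed.

(** The primitive is only differentiable away from 0; let s decrease to 0. *)
Lemma integral_layer0 (w W : R -> R) : measurable_fun [set: R] w ->
  (forall t, 0 < t -> 0 <= w t) ->
  (forall t : R, 0 < t -> is_derive t 1 W (w t)) ->
  (forall t : R, 0 < t -> w x @[x --> t] --> w t) -> W x @[x --> (0 : R)] --> W 0 ->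
  (\int[leb]_t (layer w 0 t)%:E = (W L - W 0)%:E)%E.
Proof.
move=> mw w0 dW cw cW.
pose s n : R := L * n.+1%:R^-1.
have s0 n : 0 < s n by rewrite mulr_gt0// invr_gt0.
have sL n : s n <= L by rewrite ger_pMr// invf_le1// ler1n.
have s_cvg : s n @[n --> \oo] --> (0 : R).
  rewrite -(mulr0 L); apply: cvgM; [exact: cvg_cst|exact: cvg_harmonic].
have c1 : (\int[leb]_t (layer w (s n) t)%:E)%E @[n --> \oo] --> (\int[leb]_t (layer w 0 t)%:E)%E.
  apply: (@monotone_cvg _ _ _ leb setT (fun n t => (layer w (s n) t)%:E) (fun t => (layer w 0 t)%:E)) => //.
  - by move=> n; apply/measurable_EFinP; exact: measurable_layer.
  - by move=> n t _; rewrite lee_fin layer_ge0.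
  - move=> t _ n m nm; rewrite lee_fin /layer.
    have sm : s m <= s n by rewrite ler_pM2l// lef_pV2 ?posrE// ler_nat ltnS.
    case: ifPn => [st|_]; first by rewrite (le_trans sm st).
    by case: ifPn => // _; exact: cutoff_ge0.
  move=> t _; have [t0|t0] := leP t 0.
    have E x : layer w x t = 0 by rewrite /layer /cutoff [0 < t]ltNge t0/= if_same.
    by under eq_fun do rewrite E; rewrite E; exact: cvg_cst.
  apply: cvg_near_cst.
  have N : \forall n \near \oo, s n < t by exact: (cvgr_lt _ s_cvg _ t0).
  by apply: filterS N => n nt; rewrite /layer (ltW t0) (ltW nt).
apply: (cvg_unique _ c1) => //.
have -> : (fun n => \int[leb]_t (layer w (s n) t)%:E)%E = (fun n => (W L - W (s n))%:E).
  by apply/funext => n; exact: integral_layer.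
apply: cvg_EFin; first exact: nearW.
apply: cvgB; first exact: cvg_cst.
exact: (cvg_comp s W s_cvg cW).
Qed.

(** Exchanging the two integrals replaces the function S by its distribution function.
    *)
Lemma layer_tonelli d (X : measurableType d) (nu : {sigma_finite_measure set X -> \bar R})
  (S : X -> R) (w : R -> R) : measurable_fun [set: X] S -> measurable_fun [set: R] w ->
  (forall t, 0 < t -> 0 <= w t) ->
  measurable_fun [set: X] (fun x => \int[leb]_t (layer w (S x) t)%:E)%E /\
  (\int[nu]_x \int[leb]_t (layer w (S x) t)%:E =
   \int[leb]_t ((cutoff w t)%:E * nu [set x | (S x <= t)%R]))%E.
Proof.
move=> mS mw w0.
have mi : measurable_fun [set: mR] (id : mR -> R) by move=> _ A mA; rewrite setTI.
have m1 : measurable_fun [set: X * mR] (fun p : X * mR => S p.1).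
  exact: (measurableT_comp mS measurable_fst).
have m2 : measurable_fun [set: X * mR] (fun p : X * mR => p.2 : R).
  exact: (measurableT_comp mi measurable_snd).
have m3 : measurable_fun [set: X * mR] (fun p : X * mR => cutoff w p.2).
  exact: (measurableT_comp (measurable_cutoff mw) m2).
have mL : measurable_fun [set: X * mR] (fun p : X * mR => (layer w (S p.1) p.2)%:E).
  apply/measurable_EFinP; apply: measurable_fun_ifT => //.
  exact: (measurable_fun_ler m1 m2).
have L_ge0 p : (0 <= (layer w (S p.1) p.2)%:E)%E by rewrite lee_fin layer_ge0.
split.
  exact: (@measurable_fun_fubini_tonelli_F _ _ _ _ _ leb _ mL (fun=> L_ge0 _)).
rewrite -[LHS](@fubini_tonelli1 _ _ _ _ _ nu leb _ mL (fun=> L_ge0 _)).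
rewrite (@fubini_tonelli2 _ _ _ _ _ nu leb _ mL (fun=> L_ge0 _)).
apply: eq_integral => t _; rewrite /fubini_G/=.
have mA : measurable [set x | S x <= t].
  rewrite -[X in measurable X]setTI (_ : [set x | S x <= t] = S @^-1` `]-oo, t]%classic).
    exact: mS.
  by apply/seteqP; split => x /=; rewrite in_itv.
transitivity (\int[nu]_x ((cutoff w t)%:E * (\1_[set x | S x <= t] x)%:E))%E.
  apply: eq_integral => x _; rewrite -EFinM indicE /layer.
  have -> : (x \in [set x0 | S x0 <= t]) = (S x <= t) by apply/idP/idP; rewrite inE.
  by case: ifP; rewrite ?mulr1 ?mulr0.
rewrite ge0_integralZl//; first by rewrite integral_indic// setIT.
- exact/measurable_EFinP.
- by rewrite lee_fin cutoff_ge0.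
Qed.

End layer.

(** * Angular averages of the logarithmic kernel *)

Section averaging.
Variable R : realType.
Local Notation leb := (@lebesgue_measure R).
Local Notation R2 := (R * R)%type.
Variable L : R.
Hypothesis L1 : 1 <= L.

Let L0 : 0 < L. Proof. exact: lt_le_trans L1. Qed.

Definition disc : set R2 := [set z | modsq z <= L].
(** On the disc |z|^2 <= L the distance |z - w| is at most 2 sqrt L, so log 1/|z - w| is
    at least minus this constant. *)
Definition kshift : R := ln 2 + ln L / 2.
Definition shifted_logk (p : R2 * R2) := maxe (logk p + kshift%:E)%E 0%E.
Definition maxsq (p : R2 * R2) : R := Num.max (modsq p.1) (modsq p.2).
(** This is log(sqrt L / max(|z|,|w|)), the mean of log(sqrt L / |z - w|) over rotations
    of w; it is written in layers so that its double integral becomes an integral of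
    F(t)^2. *)
Definition log_max (p : R2 * R2) : \bar R :=
  ((2^-1)%:E * \int[leb]_t (layer L (fun t => t^-1) (maxsq p) t)%:E)%E.

Lemma kshift_ge0 : 0 <= kshift.
Proof. by rewrite addr_ge0 ?divr_ge0 ?ln_ge0// ler1n. Qed.

Lemma shifted_logk_ge0 p : (0 <= shifted_logk p)%E.
Proof. by rewrite le_max lexx orbT. Qed.

Lemma measurable_shifted_logk : measurable_fun [set: R2 * R2] shifted_logk.
Proof.
apply: measurable_maxe => //; apply: emeasurable_funD => //; exact: measurable_logk.
Qed.

Lemma measurable_maxsq : measurable_fun [set: R2 * R2] maxsq.
Proof.
by apply: measurable_maxr; apply: (measurableT_comp (@measurable_modsq R)).
Qed.

Lemma measurable_inv : measurable_fun [set: R] (fun t : R => t^-1).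
Proof.
pose F (t : R) := if 0 < t then expR (- ln t) else if t < 0 then - expR (- ln (- t)) else 0.
have -> : (fun t : R => t^-1) = F.
  apply/funext => t; rewrite /F; have [t0|t0|<-] := ltgtP 0 t; last by rewrite invr0.
  - by rewrite expRN lnK.
  - by rewrite expRN lnK ?posrE ?oppr_gt0// invrN opprK.
have ml := @measurable_ln R.
apply: measurable_fun_ifT; first exact: measurable_fun_ltr.
  by mfun.
apply: measurable_fun_ifT; first exact: measurable_fun_ltr.
  mfun; apply: (measurableT_comp ml); mfun.
exact: measurable_cst.
Qed.

Lemma log_max_ge0 p : (0 <= log_max p)%E.
Proof.
rewrite mule_ge0//.
by apply: integral_ge0 => t _; rewrite lee_fin layer_ge0// => x /ltW; rewrite invr_ge0.
Qed.

Lemma log_maxE p : 0 < maxsq p -> maxsq p <= L -> log_max p = ((ln L - ln (maxsq p)) / 2)%:E.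
Proof.
move=> p0 pL; rewrite /log_max (integral_layer (W := @ln R) p0 pL).
- by rewrite -EFinM mulrC.
- by move=> t t0; apply: cvgV; [rewrite gt_eqF|exact: cvg_id].
Qed.

Lemma ln_sqrt (x : R) : 0 < x -> ln (Num.sqrt x) = ln x / 2.
Proof.
move=> x0; have s0 : 0 < Num.sqrt x by rewrite sqrtr_gt0.
have := lnXn 2 s0; rewrite sqr_sqrtr ?(ltW x0)// => ->.
by rewrite mulr2n; lra.
Qed.

Lemma ln_mulX (a b : R) n : 0 < a -> 0 < b -> ln (a * b ^+ n) = ln a + n%:R * ln b.
Proof. by move=> a0 b0; rewrite lnM ?posrE ?exprn_gt0// lnXn// mulr_natl. Qed.

Lemma ln_prod n (F : 'I_n -> R) : (forall i, 0 < F i) ->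
  ln (\prod_(i < n) F i) = \sum_(i < n) ln (F i).
Proof.
elim: n F => [|n ih] F F0; first by rewrite !big_ord0 ln1.
rewrite !big_ord_recl lnM ?posrE ?prodr_gt0// ih//.
Qed.

Lemma modsqB_le (z w : R2) : modsq (z - w) <= 2 * (modsq z + modsq w).
Proof.
rewrite /modsq -[(z - w).1]/(z.1 - w.1) -[(z - w).2]/(z.2 - w.2).
have := sqr_ge0 (z.1 + w.1); have := sqr_ge0 (z.2 + w.2).
rewrite !sqrrD !sqrrN; lra.
Qed.

Lemma logk_disc p : disc p.1 -> disc p.2 -> (- kshift%:E <= logk p)%E.
Proof.
move=> z1 z2; have := cmod_ge0 (p.1 - p.2); rewrite le_eqVlt => /predU1P[/esym /logk_diag ->|d0].
  by rewrite leey.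
rewrite (logkE d0) lee_fin lerN2.
have H : modsq (p.1 - p.2) <= 4 * L.
  by rewrite (le_trans (modsqB_le _ _))//; move: z1 z2; rewrite /disc/=; lra.
have H0 : 0 < modsq (p.1 - p.2) by rewrite -sqrtr_gt0.
have : cmod (p.1 - p.2) <= 2 * Num.sqrt L.
  rewrite (_ : 2 * Num.sqrt L = Num.sqrt (4 * L)); last first.
    by rewrite sqrtrM// (_ : 4 = 2 ^+ 2) ?sqrtr_sqr ?ger0_norm//; ring.
  exact: ler_wsqrtr.
rewrite -ler_ln ?posrE ?mulr_gt0 ?sqrtr_gt0// => /le_trans; apply.
rewrite lnM ?posrE ?sqrtr_gt0// lerD2l.
by rewrite ln_sqrt.
Qed.

Lemma shifted_logkE p : disc p.1 -> disc p.2 -> shifted_logk p = (logk p + kshift%:E)%E.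
Proof.
move=> z1 z2; rewrite /shifted_logk; apply/max_idPl.
by rewrite -leeBlDr// sub0e logk_disc.
Qed.

Lemma shifted_logk_real p : disc p.1 -> disc p.2 -> 0 < cmod (p.1 - p.2) ->
  shifted_logk p = (kshift - ln (cmod (p.1 - p.2)))%:E.
Proof.
move=> z1 z2 d0; rewrite shifted_logkE// (logkE d0).
by rewrite -[LHS]/((- ln (cmod (p.1 - p.2)) + kshift)%:E) addrC.
Qed.

Lemma ln_max_cmod p : 0 < maxsq p ->
  0 < Num.max (cmod p.1) (cmod p.2) /\ ln (Num.max (cmod p.1) (cmod p.2)) = ln (maxsq p) / 2.
Proof.
move=> p0.
have E : Num.max (cmod p.1) (cmod p.2) = Num.sqrt (maxsq p).
  rewrite /maxsq; have [H|H] := leP (modsq p.1) (modsq p.2).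
    by rewrite max_r// ler_wsqrtr.
  by rewrite max_l// ler_wsqrtr// ltW.
rewrite E sqrtr_gt0 p0; split => //.
by rewrite ln_sqrt.
Qed.

Variables (N : nat) (zeta : complex R).
Hypothesis zN : N.-primitive_root zeta.
Let N0 : (0 < N)%N. Proof. exact: prim_order_gt0 zN. Qed.

Local Notation rt p m := (p.1, crot (unit_root zeta m) p.2).

Lemma disc_rt m (z : R2) : disc z -> disc (crot (unit_root zeta m) z).
Proof. by rewrite /disc/= modsq_rot (modsq_unit_root _ zN) mul1r. Qed.

Lemma maxsq_le p : disc p.1 -> disc p.2 -> maxsq p <= L.
Proof. by move=> z1 z2; rewrite ge_max z1 z2. Qed.

(** The average of log 1/|z - zeta^m w| over N-th roots of unity is at least log
    1/max(|z|,|w|) - (ln 2)/N, by prod_cmod_roots_le. *)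
Lemma average_logk_ge p : disc p.1 -> disc p.2 ->
  (N%:R%:E * (log_max p + (ln 2)%:E) <= \sum_(m < N) shifted_logk (rt p m) + (ln 2)%:E)%E.
Proof.
move=> z1 z2.
have [/existsP[m /eqP m0]|] := boolP [exists m : 'I_N, cmod (p.1 - crot (unit_root zeta m) p.2) == 0].
  rewrite (bigD1 m)//= shifted_logkE//; last exact: disc_rt.
  rewrite logk_diag// !addye ?leey//.
  by rewrite gt_eqF// (@lt_le_trans _ _ 0%E)// sume_ge0// => i _; exact: shifted_logk_ge0.
rewrite negb_exists => /forallP H.
have d0 (m : 'I_N) : 0 < cmod (p.1 - crot (unit_root zeta m) p.2).
  by rewrite lt_neqAle eq_sym H cmod_ge0.
have M0 : 0 < maxsq p.
  rewrite lt_neqAle le_max modsq_ge0/= andbT; apply/eqP => M0.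
  have z10 : modsq p.1 = 0 by apply/le_anti; rewrite modsq_ge0 M0 le_max lexx.
  have z20 : modsq p.2 = 0 by apply/le_anti; rewrite modsq_ge0 M0 le_max lexx orbT.
  have := d0 (Ordinal N0); rewrite (modsq_eq0 z10) (modsq_eq0 z20).
  by rewrite /crot/= !mulr0 subr0 addr0 subrr /cmod/= expr0n/= addr0 sqrtr0 ltxx.
have [mx0 mxE] := ln_max_cmod M0.
rewrite log_maxE ?maxsq_le//.
apply: (@le_trans _ _ (\sum_(m < N) (kshift - ln (cmod (p.1 - crot (unit_root zeta m) p.2)))%:E + (ln 2)%:E)%E).
  rewrite -EFinD -EFinM sumEFin -EFinD lee_fin sumrB sumr_const card_ord -ln_prod//.
  have := prod_cmod_roots_le p.1 p.2 zN.
  rewrite -ler_ln ?posrE ?prodr_gt0 ?mulr_gt0 ?exprn_gt0//.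
  rewrite (ln_mulX N (ltr0Sn R 1) mx0) mxE -[kshift *+ N]mulr_natl /kshift.
  move: (ln (\prod_(_ < _) _)) (ln (maxsq p)) (ln L) (ln 2) (N%:R) => X a b c n.
  by rewrite mulrDr; lra.
rewrite leeD2r// lee_sum// => m _.
by rewrite (@shifted_logk_real (rt p m) z1 (disc_rt m z2) (d0 m)).
Qed.

(** With rho the ratio of the smaller modulus to the larger one, - log(1 - rho) controls
    the distance from the finite average to its limit. *)
Definition gap (p : R2 * R2) : R :=
  - ln (1 - Num.min (cmod p.1) (cmod p.2) / Num.max (cmod p.1) (cmod p.2)).

(** By prod_cmod_roots_ge the product of distances is at least max^N (1 - rho^N), and
    rho^N <= rho. *)
Lemma average_logk_le p : disc p.1 -> disc p.2 -> modsq p.1 != modsq p.2 ->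
  (\sum_(m < N) shifted_logk (rt p m) <= N%:R%:E * (log_max p + (ln 2)%:E) + (gap p)%:E)%E.
Proof.
move=> z1 z2 z12.
have M0 : 0 < maxsq p.
  rewrite lt_max !lt_neqAle !modsq_ge0 !andbT -negb_and; apply/negP => /andP[/eqP e1 /eqP e2].
  by move: z12; rewrite -e1 -e2 eqxx.
have [mx0 mxE] := ln_max_cmod M0.
have c12 : cmod p.1 != cmod p.2.
  apply: contra z12 => /eqP c; rewrite -(sqr_sqrtr (modsq_ge0 p.1)) -(sqr_sqrtr (modsq_ge0 p.2)).
  by rewrite -!cmodE c.
set mx := Num.max (cmod p.1) (cmod p.2) in mx0 mxE *.
pose mn := Num.min (cmod p.1) (cmod p.2).
have mn0 : 0 <= mn by rewrite le_min !cmod_ge0.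
have mnx : mn < mx.
  by rewrite /mn /mx; case: (ltgtP (cmod p.1) (cmod p.2)) c12.
pose rho := mn / mx.
have r0 : 0 <= rho by rewrite divr_ge0 ?(ltW mx0).
have r1 : rho < 1 by rewrite ltr_pdivrMr// mul1r.
have low : mx ^+ N * (1 - rho) <= \prod_(m < N) cmod (p.1 - crot (unit_root zeta m) p.2).
  apply: le_trans (prod_cmod_roots_ge p.1 p.2 zN).
  rewrite -/mx -/mn (_ : mn = rho * mx); last by rewrite /rho mulfVK// gt_eqF.
  rewrite (_ : mx ^+ N - _ = mx ^+ N * (1 - rho ^+ N)); last by rewrite exprMn; ring.
  rewrite ler_wpM2l ?exprn_ge0 ?(ltW mx0)//.
  rewrite lerD2l lerN2; case: (N) N0 => // k _.
  by rewrite exprS ler_piMr// exprn_ile1// ltW.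
have prod0 : 0 < \prod_(m < N) cmod (p.1 - crot (unit_root zeta m) p.2).
  by apply: lt_le_trans low; rewrite mulr_gt0 ?exprn_gt0// subr_gt0.
have d0 (m : 'I_N) : 0 < cmod (p.1 - crot (unit_root zeta m) p.2).
  rewrite lt_neqAle cmod_ge0 andbT eq_sym; apply: contraTneq prod0 => m0.
  by rewrite (bigD1 m)//= m0 mul0r ltxx.
rewrite log_maxE ?maxsq_le//.
have E (m : 'I_N) : shifted_logk (rt p m) = (kshift - ln (cmod (p.1 - crot (unit_root zeta m) p.2)))%:E.
  exact: (@shifted_logk_real (rt p m) z1 (disc_rt m z2) (d0 m)).
rewrite (eq_bigr _ (fun m _ => E m)) sumEFin.
rewrite -[leRHS]/((N%:R * ((ln L - ln (maxsq p)) / 2 + ln 2) + gap p)%:E).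
rewrite lee_fin sumrB sumr_const card_ord -ln_prod//.
move: low; rewrite -ler_ln ?posrE ?mulr_gt0 ?exprn_gt0 ?subr_gt0//.
rewrite [mx ^+ N * _]mulrC (ln_mulX N _ mx0) ?subr_gt0// mxE -[kshift *+ N]mulr_natl.
rewrite /kshift /gap -/mx -/mn -/rho.
move: (ln (\prod_(_ < _) _)) (ln (maxsq p)) (ln L) (ln 2) (N%:R) (ln (1 - rho)) => X a b c n g.
by rewrite !mulrDr; lra.
Qed.

End averaging.

Section averaged_energy.
Variable R : realType.
Local Notation leb := (@lebesgue_measure R).
Local Notation R2 := (R * R)%type.
Variable L : R.
Hypothesis L1 : 1 <= L.
Variable mu : probability R2 R.
Hypothesis rotinv : rotation_invariant mu.
Hypothesis muD : mu (disc L) = 1%E.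

Local Notation nu := (mu \x mu)%E.
Local Notation ln2 := (ln 2 : R).

Let ln2_ge0 : 0 <= ln2. Proof. by rewrite ln_ge0// ler1n. Qed.

Let mD : measurable (disc L). Proof. exact: measurable_disc. Qed.

Lemma measurable_log_max : measurable_fun [set: R2 * R2] (log_max L).
Proof.
have iv0 (t : R) : 0 < t -> 0 <= t^-1 by move=> /ltW; rewrite invr_ge0.
have [m _] := @layer_tonelli _ L _ _ (prod_sigma_finite mu mu) (@maxsq R) _ (@measurable_maxsq R)
  (@measurable_inv R) iv0.
exact: measurable_funeM.
Qed.

Lemma rot_avg (f : R2 * R2 -> \bar R) N (zeta : complex R) : N.-primitive_root zeta ->
  measurable_fun [set: R2 * R2] f -> (forall p, 0 <= f p)%E ->
  (\int[nu]_p \sum_(m < N) f (p.1, crot (unit_root zeta m) p.2) =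
   N%:R%:E * \int[nu]_p f p)%E.
Proof.
move=> zN mf f0.
have mrt m : measurable_fun [set: R2 * R2] (fun p => f (p.1, crot (unit_root zeta m) p.2)).
  apply: (measurableT_comp mf); apply: measurable_fun_pair => //.
  exact: (measurableT_comp (@measurable_rot R _)).
rewrite ge0_integral_sum//.
under eq_bigr do rewrite ge0_integral_rot2 ?(modsq_unit_root _ zN)//.
by rewrite sumr_const card_ord mule_natl.
Qed.

Lemma integral_log_max_ln2 :
  (\int[nu]_p (log_max L p + ln2%:E) = \int[nu]_p log_max L p + ln2%:E)%E.
Proof.
rewrite ge0_integralD//; last 2 first.
- by move=> p _; exact: log_max_ge0.
- exact: measurable_log_max.
by rewrite integral_cst1//; exact: product_setT.
Qed.

Lemma average_logk_integral_ge N : (0 < N)%N ->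
  (N%:R%:E * (\int[nu]_p log_max L p + ln2%:E) <= N%:R%:E * \int[nu]_p shifted_logk L p + ln2%:E)%E.
Proof.
move=> N0; have [zeta zN] := prim_root_exists_complex R N0.
have me := measurable_log_max; have ms := @measurable_shifted_logk R L.
have e0 p : (0 <= log_max L p + ln2%:E)%E by rewrite adde_ge0 ?log_max_ge0.
have mel : measurable_fun [set: R2 * R2] (fun p => log_max L p + ln2%:E)%E by exact: emeasurable_funD.
rewrite -integral_log_max_ln2 -ge0_integralZl//.
have mrt m : measurable_fun [set: R2 * R2] (fun p => shifted_logk L (p.1, crot (unit_root zeta m) p.2)).
  apply: (measurableT_comp ms); apply: measurable_fun_pair => //.
  exact: (measurableT_comp (@measurable_rot R _)).
have msum : measurable_fun [set: R2 * R2] (fun p => \sum_(m < N) shifted_logk L (p.1, crot (unit_root zeta m) p.2))%E.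
  by apply: emeasurable_sum.
have sum0 p : (0 <= \sum_(m < N) shifted_logk L (p.1, crot (unit_root zeta m) p.2))%E.
  by apply: sume_ge0 => m _; exact: shifted_logk_ge0.
rewrite -(rot_avg zN ms (@shifted_logk_ge0 R L)) -[X in (_ + X)%E](integral_cst1 (product_setT mu)).
rewrite -ge0_integralD//.
apply: (ge0_le_integral_carrier (D := disc L `*` disc L)).
- exact: measurableX.
- exact: product_carrier.
- exact: measurable_funeM.
- exact: emeasurable_funD.
- by move=> p; rewrite mule_ge0.
- by move=> p; rewrite adde_ge0.
- by move=> p [z1 z2]; exact: average_logk_ge.
Qed.

(** Divide average_logk_integral_ge by N and let N tend to infinity. *)
Lemma integral_shifted_logk_ge : (\int[nu]_p log_max L p + ln2%:E <= \int[nu]_p shifted_logk L p)%E.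
Proof.
have : (0 <= \int[nu]_p shifted_logk L p)%E by apply: integral_ge0 => p _; exact: shifted_logk_ge0.
have H := average_logk_integral_ge.
have : (0 <= \int[nu]_p log_max L p)%E by apply: integral_ge0 => p _; exact: log_max_ge0.
move: (\int[nu]_p log_max L p)%E (\int[nu]_p shifted_logk L p)%E H => Y X H.
move=> Y0; case: X H => [x| |] H X0; [|by rewrite leey|by []].
case: Y H Y0 => [y| |] H Y0; [|by have := H 1%N isT; rewrite addye// mul1e mul1e -EFinD leye_eq|by []].
move: Y0 X0; rewrite !lee_fin => y0 x0.
rewrite leNgt; apply/negP => xy.
have e0 : 0 < y + ln2 - x by lra.
(* Large enough for the error ln 2 / N to be smaller than the gap between the two sides.
   *)
pose N := (Num.trunc (ln2 / (y + ln2 - x))).+1.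
have := H N isT; rewrite -EFinD -!EFinM -EFinD lee_fin => HN.
have : ln2 / (y + ln2 - x) < N%:R.
  by have /andP[] := truncn_itv (divr_ge0 ln2_ge0 (ltW e0)).
rewrite ltr_pdivrMr//; move: HN; rewrite mulrDr; nra.
Qed.

Hypothesis offdiag : (nu [set p | modsq p.1 = modsq p.2] = 0)%E.

Lemma gap_ge0 (p : R2 * R2) : 0 <= gap p.
Proof.
rewrite /gap oppr_ge0; apply: ln_le0; rewrite lerBlDr lerDl divr_ge0//.
  by rewrite le_min !cmod_ge0.
by rewrite le_max cmod_ge0.
Qed.

Lemma measurable_gap : measurable_fun [set: R2 * R2] (@gap R).
Proof.
have m1 : measurable_fun [set: R2 * R2] (fun p => cmod p.1).
  exact: (measurableT_comp (@measurable_cmod R)).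
have m2 : measurable_fun [set: R2 * R2] (fun p => cmod p.2).
  exact: (measurableT_comp (@measurable_cmod R)).
apply: measurable_fun_opp; apply: (measurableT_comp (@measurable_ln R)).
apply: measurable_funB => //; apply: measurable_funM; first exact: measurable_minr.
apply: (measurableT_comp (@measurable_inv R)); exact: measurable_maxr.
Qed.

(** The error of the average over N+1 roots of unity, cut at height M to allow dominated
    convergence. *)
Definition gap_err (M N : nat) : \bar R :=
  (\int[nu]_p (Num.min (gap p / N.+1%:R) M%:R)%:E)%E.

Lemma gap_err_cvg M : gap_err M N @[N --> \oo] --> 0%E.
Proof.
have mN N : measurable_fun [set: R2 * R2] (fun p => (Num.min (gap p / N.+1%:R) M%:R)%:E).
  apply/measurable_EFinP; apply: measurable_minr => //; apply: measurable_funM => //.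
  exact: measurable_gap.
have [] := @dominated_cvg_near _ _ _ nu setT
  (fun N p => (Num.min (gap p / N.+1%:R) M%:R)%:E) (fun=> 0%E) (fun=> M%:R%:E) measurableT mN.
- move=> p _; apply: cvg_EFin; first exact: nearW.
  apply: (@squeeze_cvgr _ _ _ _ (fun=> 0) (fun N => gap p / N.+1%:R)).
  + near=> N; rewrite ge_min lexx le_min ler0n divr_ge0 ?gap_ge0//.
  + exact: cvg_cst.
  + rewrite -(mulr0 (gap p)); apply: cvgM; [exact: cvg_cst|exact: cvg_harmonic].
- apply/integrableP; split; first exact: measurable_cst.
  rewrite abse_EFin ger0_norm//.
  by rewrite (integral_cst1 (product_setT mu)) ltry.
- apply: nearW => N p _; rewrite abse_EFin lee_fin ger0_norm.
    by rewrite ge_min lexx orbT.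
  by rewrite le_min ler0n divr_ge0 ?gap_ge0.
by move=> _; rewrite integral0.
Unshelve. all: by end_near. Qed.

Lemma measurable_eqmod : measurable [set p : R2 * R2 | modsq p.1 = modsq p.2].
Proof.
have m1 : measurable_fun [set: R2 * R2] (fun p => modsq p.1 - modsq p.2).
  by apply: measurable_funB; apply: (measurableT_comp (@measurable_modsq R)).
have := m1 measurableT _ (measurable_set1 0); rewrite setTI.
congr measurable; apply/seteqP; split => p /=; last by move=> ->; exact: subrr.
by move=> /eqP; rewrite subr_eq0 => /eqP.
Qed.

(** For the kernel cut at height M, the average over roots of unity exceeds the limiting
    value by at most min(gap/(N+1), M) off the set |z| = |w|. *)
Lemma trunc_integral_le (M N : nat) :
  (\int[nu]_p mine (shifted_logk L p) M%:R%:E <= \int[nu]_p log_max L p + ln2%:E + gap_err M N)%E.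
Proof.
have [zeta zN] := prim_root_exists_complex R (ltn0Sn N).
have me := measurable_log_max; have ms := @measurable_shifted_logk R L.
pose f p := mine (shifted_logk L p) M%:R%:E.
have mf : measurable_fun [set: R2 * R2] f by exact: measurable_mine.
have f0 p : (0 <= f p)%E by rewrite le_min shifted_logk_ge0 lee_fin ler0n.
have e0 p : (0 <= log_max L p + ln2%:E)%E by rewrite adde_ge0 ?log_max_ge0.
have mel : measurable_fun [set: R2 * R2] (fun p => log_max L p + ln2%:E)%E by exact: emeasurable_funD.
pose g p : \bar R := (Num.min (gap p / N.+1%:R) M%:R)%:E.
have g0 p : (0 <= g p)%E by rewrite lee_fin le_min ler0n divr_ge0 ?gap_ge0.
have mg : measurable_fun [set: R2 * R2] g.
  apply/measurable_EFinP; apply: measurable_minr => //; apply: measurable_funM => //.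
  exact: measurable_gap.
have mrt m : measurable_fun [set: R2 * R2] (fun p => f (p.1, crot (unit_root zeta m) p.2)).
  apply: (measurableT_comp mf); apply: measurable_fun_pair => //.
  exact: (measurableT_comp (@measurable_rot R _)).
have mb : measurable_fun [set: R2 * R2] (fun p => log_max L p + ln2%:E + g p)%E by exact: emeasurable_funD.
have b0 p : (0 <= log_max L p + ln2%:E + g p)%E by apply: adde_ge0.
have -> : (\int[nu]_p log_max L p + ln2%:E + gap_err M N = \int[nu]_p (log_max L p + ln2%:E + g p))%E.
  rewrite -integral_log_max_ln2 [RHS](ge0_integralD nu measurableT (fun p _ => e0 p) mel (fun p _ => g0 p) mg)//.
rewrite -(@lee_pmul2l _ N.+1%:R%:E)// -(rot_avg zN mf f0).
rewrite -ge0_integralZl//.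
have mE := measurable_eqmod.
apply: (ge0_le_integral_carrier (D := (disc L `*` disc L) `\` [set p | modsq p.1 = modsq p.2])).
- by apply: measurableD => //; exact: measurableX.
- rewrite setCD.
  have mC : measurable (~` (disc L `*` disc L)) by apply: measurableC; exact: measurableX.
  apply: measure_negligible; first exact: measurableU.
  apply: negligibleU; apply/negligibleP => //; exact: product_carrier.
- exact: emeasurable_sum.
- by apply: measurable_funeM; exact: emeasurable_funD.
- by move=> p; apply: sume_ge0.
- by move=> p; rewrite mule_ge0// adde_ge0.
move=> p [[z1 z2] /= /eqP z12].
rewrite muleDr//; last by rewrite ge0_adde_def ?inE.
have -> : (N.+1%:R%:E * g p = (Num.min (gap p) (N.+1%:R * M%:R))%:E)%E.
  rewrite -EFinM minr_pMr// mulrCA mulfV ?mulr1//.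
have [_|_] := leP (gap p) (N.+1%:R * M%:R).
  apply: le_trans (average_logk_le L1 zN z1 z2 z12).
  by apply: lee_sum => m _; rewrite ge_min lexx.
apply: (@le_trans _ _ (\sum_(m < N.+1) M%:R%:E)%E).
  by apply: lee_sum => m _; rewrite ge_min lexx orbT.
by rewrite sumEFin sumr_const card_ord -[M%:R *+ _]mulr_natl leeDr// mule_ge0.
Qed.

(** Let N tend to infinity at fixed cut-off M, then M by monotone convergence. Together
    with the lower bound: when circles are null, the logarithmic energy of a
    rotation-invariant measure is that of the kernel log 1/max(|z|,|w|). *)
Lemma integral_shifted_logk_le : (\int[nu]_p shifted_logk L p <= \int[nu]_p log_max L p + ln2%:E)%E.
Proof.
have trunc M : (\int[nu]_p mine (shifted_logk L p) M%:R%:E <= \int[nu]_p log_max L p + ln2%:E)%E.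
  have c : (\int[nu]_p log_max L p + ln2%:E + gap_err M N)%E @[N --> \oo] -->
      (\int[nu]_p log_max L p + ln2%:E + 0)%E.
    apply: cvgeD; [|exact: cvg_cst|exact: gap_err_cvg].
    by rewrite fin_num_adde_defl.
  rewrite -[leRHS]adde0; apply: (cvge_to_ge c); apply: nearW => N; exact: trunc_integral_le.
have mono : (\int[nu]_p mine (shifted_logk L p) M%:R%:E)%E @[M --> \oo] --> (\int[nu]_p shifted_logk L p)%E.
  apply: monotone_cvg => //.
  - by move=> M; apply: measurable_mine => //; exact: measurable_shifted_logk.
  - by move=> M p _; rewrite le_min shifted_logk_ge0 lee_fin ler0n.
  - move=> p _ n m nm; rewrite le_min !ge_min lexx/= lee_fin ler_nat nm orbT//.
  move=> p _; have := shifted_logk_ge0 L p; case: (shifted_logk L p) => [r r0| _|//].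
    apply: cvg_near_cst; near=> M; apply/min_idPl; rewrite lee_fin.
    near: M; exact: nbhs_infty_ger.
  apply: (@cvg_trans _ ((fun M : nat => M%:R%:E : \bar R) @ \oo)); last by apply/cvgeryP; exact: cvgr_idn.
  by apply: near_eq_cvg; near=> M; apply/esym/min_idPr; rewrite leey.
by apply: (cvge_to_le mono); exact: nearW.
Unshelve. all: by end_near. Qed.

End averaged_energy.

(** * A radial measure with prescribed distribution function *)

Section candidate.
Variable R : realType.
Local Notation leb := (@lebesgue_measure R).
Local Notation R2 := (R * R)%type.

Local Notation disc1 := [set z : R2 | modsq z <= 1].
Let mdisc1 : measurable disc1. Proof. exact: measurable_disc. Qed.

Lemma disc_area_inv_ge0 : 0 <= (disc_area R)^-1.
Proof. by rewrite invr_ge0 ltW// disc_area_gt0. Qed.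

(** The uniform probability on the unit disc, for which |z|^2 is uniformly distributed
    on [0,1]. *)
Definition unif (A : set R2) : \bar R := (((disc_area R)^-1)%:E * @area R (A `&` disc1))%E.

Let unif_m : {measure set R2 -> \bar R} :=
  mscale (NngNum disc_area_inv_ge0) (mrestr (@area R) mdisc1).

Lemma unif0 : unif set0 = 0%E. Proof. exact: (measure0 unif_m). Qed.
Lemma unif_ge0 A : (0 <= unif A)%E. Proof. exact: (measure_ge0 unif_m). Qed.
Lemma unif_semi_sigma_additive : semi_sigma_additive unif.
Proof. exact: (@measure_semi_sigma_additive _ _ _ unif_m). Qed.

HB.instance Definition _ := isMeasure.Build _ _ _ unif unif0 unif_ge0 unif_semi_sigma_additive.

Lemma unif1 : unif setT = 1%E.
Proof.
by rewrite /unif setTI area_disc1 -EFinM mulVf// gt_eqF// disc_area_gt0.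
Qed.

HB.instance Definition _ := Measure_isProbability.Build _ _ _ unif unif1.

Lemma unif_disc p : 0 <= p <= 1 -> unif [set z | modsq z <= p] = p%:E.
Proof.
move=> /andP[p0 p1]; rewrite /unif setIidl.
  rewrite area_disc// -EFinM mulrA mulVf ?mul1r//.
  by rewrite gt_eqF// disc_area_gt0.
by move=> z /= zp; exact: le_trans zp p1.
Qed.

Lemma area_indic (A : set R2) : measurable A ->
  (\int[@area R]_z (\1_A z)%:E = @area R A)%E.
Proof. by move=> mA; rewrite (integral_indic (@area R) measurableT mA) setIT. Qed.

Lemma measurable_circle p : measurable [set z : R2 | modsq z = p].
Proof.
have := @measurable_modsq R measurableT _ (measurable_set1 p); rewrite setTI.
by congr measurable.
Qed.

(** Circles correspond to points under z |-> |z|^2. *)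
Lemma area_circle p : @area R [set z | modsq z = p] = 0%E.
Proof.
have mE := measurable_circle p.
have m1 : measurable_fun [set: R] (fun s : R => (\1_[set p] s)%:E : \bar R).
  by apply/measurable_EFinP; exact: measurable_indic.
have i0 s : (0 <= (\1_[set p] s)%:E :> \bar R)%E by rewrite lee_fin.
rewrite -(area_indic mE).
transitivity (\int[@area R]_z (\1_[set p] (modsq z))%:E)%E.
  by apply: eq_integral => z _; rewrite !indicE.
rewrite (ge0_integral_area_radial m1 i0) integral_indic//=.
rewrite [X in (_ * X)%E](_ : _ = 0%E) ?mule0//.
have [p0|p0] := leP 0 p.
  rewrite setIidl; first exact: lebesgue_measure_set1.
  by move=> x /= ->; rewrite in_itv/= p0.
rewrite (_ : [set p] `&` _ = set0) ?measure0//.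
by apply/seteqP; split => // x [/= ->]; rewrite in_itv/= leNgt p0.
Qed.

Lemma unif_circle p : unif [set z | modsq z = p] = 0%E.
Proof.
have mE := measurable_circle p.
rewrite /unif [X in (_ * X)%E](_ : _ = 0%E) ?mule0//.
by apply: (subset_measure0 (B := [set z | modsq z = p])) => //; [exact: measurableI|exact: area_circle].
Qed.

Lemma unif_rot u A : modsq u = 1 -> measurable A -> unif (crot u @^-1` A) = unif A.
Proof.
move=> u1 mA; rewrite /unif; congr (_ * _)%E.
have -> : crot u @^-1` A `&` disc1 = crot u @^-1` (A `&` disc1).
  by apply/seteqP; split => z /= [Az]; rewrite modsq_rot u1 mul1r.
have mB : measurable (A `&` disc1) by exact: measurableI.
have mrB : measurable (crot u @^-1` (A `&` disc1)).
  by rewrite -[X in measurable X]setTI; exact: measurable_rot.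
have [_ H] := area_preserving_rot u1.
have m1 : measurable_fun [set: R2] (fun z => (\1_(A `&` disc1) z)%:E : \bar R).
  by apply/measurable_EFinP; exact: measurable_indic.
have i0 z : (0 <= (\1_(A `&` disc1) z)%:E :> \bar R)%E by rewrite lee_fin.
rewrite -(area_indic mB) -(area_indic mrB).
exact: (H _ m1 i0).
Qed.

Variables (Q : R2 -> \bar R) (q : R -> R).
Hypothesis Qnoo : forall z, (-oo < Q z)%E.
Hypothesis Qlsc : lower_semicontinuous Q.
Hypothesis Qrad : forall z, 0 < cmod z -> Q z = (q (cmod z))%:E.
Hypothesis qsmooth : forall (k : nat) (r : R), 0 < r -> derivable (derive1n k q) r 1.
Hypothesis Qsub : subharmonic Q.
Hypothesis Qgrowth :
  (2%:E < limf_einf (fun z => Q z / (ln (cmod z))%:E) (@at_infinity R))%E.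

Local Notation h := (radial_mass q).
Local Notation H := (quantile01 q).

Lemma quantile01_ge0 s : 0 <= H s.
Proof.
have := quantile01_nd Qnoo Qlsc Qrad qsmooth Qsub Qgrowth.
have H0 : H 0 = 0 by rewrite /quantile01 lexx.
move=> nd; have [s0|s0] := leP s 0; first by rewrite /quantile01 s0.
by rewrite -H0; apply: nd; exact: ltW.
Qed.

Lemma measurable_quantile01 : measurable_fun [set: R] H.
Proof.
have nd := quantile01_nd Qnoo Qlsc Qrad qsmooth Qsub Qgrowth.
apply: (measurability _ (RGenCInfty.measurableE R)) => //.
move=> _ [_ [x ->] <-]; rewrite setTI.
apply: is_interval_measurable => a b /= + _ c /andP[ac cb].
rewrite !in_itv/= !andbT => /le_trans; apply; exact: nd.
Qed.

(** Transports the law of |z|^2 by the quantile function without changing arguments, so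
    that it commutes with rotations. *)
Definition spread (z : R2) : R2 :=
  let c := Num.sqrt (H (modsq z)) / Num.sqrt (modsq z) in (c * z.1, c * z.2).

Lemma modsq_spread z : modsq (spread z) = H (modsq z).
Proof.
have [z0|z0] := ltP 0 (modsq z); last first.
  have E : modsq z = 0 by apply/le_anti; rewrite z0 modsq_ge0.
  by rewrite (modsq_eq0 E) /modsq/= !mulr0 expr0n/= addr0 /quantile01 lexx.
rewrite /spread [LHS]/modsq/= !exprMn -mulrDr -/(modsq z) exprVn.
by rewrite !sqr_sqrtr ?quantile01_ge0 ?modsq_ge0// mulfVK// gt_eqF.
Qed.

Lemma measurable_spread : measurable_fun [set: R2] spread.
Proof.
have mm := @measurable_modsq R.
have ms := @continuous_sqrt_measurable R.
have mc : measurable_fun [set: R2] (fun z => Num.sqrt (H (modsq z)) / Num.sqrt (modsq z)).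
  apply: measurable_funM.
    apply: (measurableT_comp ms); exact: (measurableT_comp measurable_quantile01).
  apply: (measurableT_comp (@measurable_inv R)); exact: (measurableT_comp ms).
by apply: measurable_fun_pair; apply: measurable_funM.
Qed.

Lemma spread_rot u z : modsq u = 1 -> spread (crot u z) = crot u (spread z).
Proof.
move=> u1; rewrite /spread modsq_rot u1 mul1r /crot/=.
by congr (_, _); ring.
Qed.

HB.instance Definition _ := isMeasurableFun.Build _ _ _ _ spread measurable_spread.

(** The image of the uniform measure on the disc under the quantile function: a
    rotation-invariant probability whose radial distribution function is min(h,1). *)
Definition candidate : probability R2 R := distribution unif spread.

Lemma candidateE A : candidate A = unif (spread @^-1` A). Proof. by []. Qed.

Lemma candidate_rotation_invariant : rotation_invariant candidate.
Proof.
move=> u A u1 mA; rewrite !candidateE -[RHS](unif_rot u1); last first.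
  by rewrite -[X in measurable X]setTI; exact: measurable_spread.
by congr unif; apply/seteqP; split => z /=; rewrite spread_rot.
Qed.

Lemma candidate_disc t : 0 < t -> candidate [set z | modsq z <= t] = (Num.min (h t) 1)%:E.
Proof.
move=> t0; have h0 := radial_mass_ge0 Qnoo Qlsc Qrad qsmooth Qsub t0.
rewrite candidateE -unif_disc; last by rewrite le_min h0 ler01 ge_min lexx orbT.
rewrite /unif; congr (_ * area _)%E; apply/seteqP; split => z /= []; rewrite modsq_spread.
  move=> Hz z1; split => //; rewrite le_min z1 andbT.
  have [z0|z0] := leP (modsq z) 0; first exact: le_trans h0.
  move: Hz; rewrite /quantile01 [modsq z <= 0]leNgt z0/= (min_idPl z1).
  by rewrite (quantile_le Qnoo Qlsc Qrad qsmooth Qsub Qgrowth z1 t0).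
rewrite le_min => /andP[zh z1] _; split => //.
rewrite /quantile01; case: ifPn => [_|]; first exact: ltW.
by rewrite -ltNge => z0; rewrite (min_idPl z1) (quantile_le Qnoo Qlsc Qrad qsmooth Qsub Qgrowth z1 t0).
Qed.

(** The map spread is injective in |z|^2 since h inverts the quantile function, so up to
    null sets the preimage of a circle is contained in a circle. *)
Lemma candidate_circle s : candidate [set z | modsq z = s] = 0%E.
Proof.
have mE (p : R) : measurable [set z : R2 | modsq z = p].
  have := @measurable_modsq R measurableT _ (measurable_set1 p); rewrite setTI.
  by congr measurable.
rewrite candidateE; apply: measure_negligible.
  by rewrite -[X in measurable X]setTI; exact: measurable_spread.
have n p : unif.-negligible [set z | modsq z = p] by apply/negligibleP => //; exact: unif_circle.
have n1 : unif.-negligible (~` disc1).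
  apply/negligibleP; first exact: measurableC.
  by rewrite -[LHS]/(unif (~` disc1)) /unif setICl measure0 mule0.
apply: negligibleS (negligibleU (negligibleU (n 0) (n (h s))) n1) => z /=.
rewrite modsq_spread => Hz.
have [z1|z1] := leP (modsq z) 1; last by right.
left; have [z0|z0] := leP (modsq z) 0; first by left; apply/le_anti; rewrite z0 modsq_ge0.
right; rewrite -Hz /quantile01 [modsq z <= 0]leNgt z0/= (min_idPl z1).
by rewrite (mass_quantileK Qnoo Qlsc Qrad qsmooth Qsub Qgrowth).
Qed.

(** By Tonelli: every section of the set |z| = |w| is a circle. *)
Lemma offdiag_null (mu : probability R2 R) : (forall s, mu [set z | modsq z = s] = 0%E) ->
  ((mu \x mu) [set p | modsq p.1 = modsq p.2] = 0)%E.
Proof.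
move=> mu0; rewrite /product_measure1.
rewrite (eq_integral (cst 0%E)) ?integral0// => z _ /=.
rewrite -[RHS](mu0 (modsq z)); congr (mu _).
apply/seteqP; split => w.
  by move=> /set_mem /= ->.
by move=> /= E; apply/mem_set.
Qed.

End candidate.

(** * Energy of rotation-invariant measures *)

Section energy.
Variable R : realType.
Local Notation leb := (@lebesgue_measure R).
Local Notation R2 := (R * R)%type.
Variables (Q : R2 -> \bar R) (q : R -> R).
Hypothesis Qnoo : forall z, (-oo < Q z)%E.
Hypothesis Qlsc : lower_semicontinuous Q.
Hypothesis Qrad : forall z, 0 < cmod z -> Q z = (q (cmod z))%:E.
Hypothesis qsmooth : forall (k : nat) (r : R), 0 < r -> derivable (derive1n k q) r 1.
Hypothesis Qsub : subharmonic Q.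
Hypothesis Qgrowth :
  (2%:E < limf_einf (fun z => Q z / (ln (cmod z))%:E) (@at_infinity R))%E.

Local Notation V := (radial_pot Q).
Local Notation h := (radial_mass q).

Let h_ge0 t : 0 < t -> 0 <= h t.
Proof. by move=> t0; exact: (radial_mass_ge0 Qnoo Qlsc Qrad qsmooth Qsub t0). Qed.

Definition pot_dens (t : R) : R := h t / t.
Local Notation w := pot_dens.

Lemma pot_dens_ge0 t : 0 < t -> 0 <= w t.
Proof. by move=> t0; rewrite divr_ge0 ?h_ge0 ?ltW. Qed.

Lemma cvg_pot_dens (t : R) : 0 < t -> w x @[x --> t] --> w t.
Proof.
move=> t0; apply: cvgM; first exact: (cvg_h qsmooth t0).
by apply: cvgV; [rewrite gt_eqF|exact: cvg_id].
Qed.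

Lemma measurable_pot_dens : measurable_fun [set: R] w.
Proof.
have m1 : measurable_fun [set x : R | 0 < x] w.
  apply: open_continuous_measurable_fun; first exact: open_gt.
  by move=> x /set_mem /= x0; exact: cvg_pot_dens.
have mD : measurable [set x : R | 0 < x].
  rewrite (_ : [set x : R | 0 < x] = `]0, +oo[%classic); first exact: measurable_itv.
  by apply/seteqP; split => x /=; rewrite in_itv/= andbT.
have := (measurable_restrictT w mD).1 m1.
apply: eq_measurable_fun => x _; rewrite /patch; case: ifPn => //.
rewrite notin_setE/= => /negP; rewrite -leNgt => x0.
by rewrite /pot_dens /radial_mass ler0_sqrtr// !mul0r.
Qed.

Let dV (t : R) : 0 < t -> is_derive t 1 V (w t).
Proof. exact: (is_derive_V Qrad qsmooth). Qed.

Let cV : V x @[x --> (0 : R)] --> V 0.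
Proof. exact: (continuous_V Qnoo Qlsc Qrad qsmooth Qsub). Qed.

Lemma integral_pot_layer L s : 0 < L -> 0 <= s -> s <= L ->
  (\int[leb]_t (layer L w s t)%:E = (V L - V s)%:E)%E.
Proof.
move=> L0; rewrite le_eqVlt => /predU1P[<-|s0] sL.
  apply: (integral_layer0 L0 measurable_pot_dens pot_dens_ge0 dV) => //.
  exact: cvg_pot_dens.
apply: integral_layer => //; exact: cvg_pot_dens.
Qed.

(** The potential is radially nondecreasing because h is nonnegative. *)
Lemma V_nd s t : 0 <= s -> s <= t -> V s <= V t.
Proof.
move=> s0; rewrite le_eqVlt => /predU1P[->//|st].
have t0 := le_lt_trans s0 st.
rewrite -subr_ge0 -lee_fin -(integral_pot_layer t0 s0 (ltW st)).
by apply: integral_ge0 => x _; rewrite lee_fin layer_ge0//; exact: pot_dens_ge0.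
Qed.

Lemma measurable_pot : measurable_fun [set: R2] Q.
Proof.
rewrite (_ : Q = fun z => (V (modsq z))%:E); last first.
  by apply/funext => z; exact: (QV Qnoo Qrad Qsub).
apply/measurable_EFinP; apply: (measurableT_comp _ (@measurable_modsq R)).
apply: continuous_measurable_fun; exact: (continuous_V Qnoo Qlsc Qrad qsmooth Qsub).
Qed.

Variable L : R.
Hypothesis L1 : 1 <= L.
Let L0 : 0 < L. Proof. exact: lt_le_trans L1. Qed.

Section one_measure.
Variable mu : probability R2 R.
Hypothesis muD : mu (disc L) = 1%E.
Local Notation nu := (mu \x mu)%E.

(** The radial distribution function F. *)
Definition mass_disc (t : R) : R := fine (mu [set z | modsq z <= t]).
Local Notation F := mass_disc.

Lemma mass_discE t : mu [set z | modsq z <= t] = (F t)%:E.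
Proof. by rewrite fineK// fin_num_measure//; exact: measurable_disc. Qed.

Lemma mass_disc_ge0 t : 0 <= F t.
Proof. by rewrite fine_ge0. Qed.

Lemma mass_disc_le1 t : F t <= 1.
Proof.
by rewrite -lee_fin -mass_discE; apply: probability_le1; exact: measurable_disc.
Qed.

Lemma measurable_mass_disc : measurable_fun [set: R] F.
Proof.
apply: (measurability _ (RGenCInfty.measurableE R)) => //.
move=> _ [_ [x ->] <-]; rewrite setTI.
apply: is_interval_measurable => a b /= + _ c /andP[ac cb].
rewrite !in_itv/= !andbT => /le_trans; apply.
rewrite -lee_fin -!mass_discE; apply: le_measure.
- by apply/mem_set; exact: measurable_disc.
- by apply/mem_set; exact: measurable_disc.
- by move=> z /= /le_trans; apply.
Qed.

Definition square_term : \bar R := (\int[leb]_t (cutoff L (fun t => t^-1) t * (F t * F t))%:E)%E.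
Definition pot_term : \bar R := (\int[leb]_t (cutoff L w t * F t)%:E)%E.

Lemma measurable_square_term :
  measurable_fun [set: R] (fun t => (cutoff L (fun t => t^-1) t * (F t * F t))%:E).
Proof.
apply/measurable_EFinP; apply: measurable_funM.
  by apply: measurable_cutoff; exact: measurable_inv.
by apply: measurable_funM; exact: measurable_mass_disc.
Qed.

Lemma measurable_pot_term : measurable_fun [set: R] (fun t => (cutoff L w t * F t)%:E).
Proof.
apply/measurable_EFinP; apply: measurable_funM; last exact: measurable_mass_disc.
by apply: measurable_cutoff; exact: measurable_pot_dens.
Qed.

Lemma square_ge0 t : (0 <= (cutoff L (fun t => t^-1) t * (F t * F t))%:E)%E.
Proof.
rewrite lee_fin mulr_ge0 ?mulr_ge0 ?mass_disc_ge0//.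
by apply: cutoff_ge0 => // x /ltW; rewrite invr_ge0.
Qed.

Lemma pot_ge0 t : (0 <= (cutoff L w t * F t)%:E)%E.
Proof.
rewrite lee_fin mulr_ge0 ?mass_disc_ge0//.
by apply: cutoff_ge0; exact: pot_dens_ge0.
Qed.

(** The set max(|z|^2,|w|^2) <= t is a product, which has measure F(t)^2. *)
Lemma integral_log_max : (\int[nu]_p log_max L p = (2^-1)%:E * square_term)%E.
Proof.
have iv0 (t : R) : 0 < t -> 0 <= t^-1 by move=> /ltW; rewrite invr_ge0.
have [m E] := @layer_tonelli _ L _ _ (prod_sigma_finite mu mu) (@maxsq R) _ (@measurable_maxsq R)
  (@measurable_inv R) iv0.
rewrite /log_max ge0_integralZl//; last first.
  by move=> p _; apply: integral_ge0 => t _; rewrite lee_fin layer_ge0.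
congr (_ * _)%E; apply: (etrans E); apply: eq_integral => t _.
rewrite [RHS]EFinM; congr (_ * _)%E.
have mt : measurable [set z : R2 | modsq z <= t] by exact: measurable_disc.
rewrite [RHS]EFinM -mass_discE -(product_square mu mt).
congr (nu _); apply/seteqP; split => p /=; rewrite /maxsq ge_max.
  by move=> /andP[].
by move=> [-> ->].
Qed.

Lemma mu_carrier : mu (~` disc L) = 0%E.
Proof.
by rewrite probability_setC; [rewrite [X in (_ - X)%E]muD subee|exact: measurable_disc].
Qed.

Lemma pot_term_le : (pot_term <= (V L - V 0)%:E)%E.
Proof.
rewrite -(integral_pot_layer L0 (lexx 0) (ltW L0)).
apply: ge0_le_integral => //.
- by move=> t _; rewrite lee_fin mulr_ge0 ?mass_disc_ge0// cutoff_ge0//; exact: pot_dens_ge0.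
- exact: measurable_pot_term.
- by apply/measurable_EFinP; apply: measurable_layer; exact: measurable_pot_dens.
move=> t _; rewrite lee_fin /layer; case: ifPn => [t0|].
  rewrite ler_piMr ?mass_disc_le1// cutoff_ge0//; exact: pot_dens_ge0.
by rewrite -ltNge => t0; rewrite /cutoff ltNge (ltW t0) mul0r.
Qed.

(** Layer-cake formula for V(L) - V(|z|^2). *)
Lemma integral_potE : (\int[mu]_z Q z = (V L)%:E - pot_term)%E.
Proof.
have mQ := measurable_pot.
have [m E] := @layer_tonelli _ L _ _ mu (@modsq R) _ (@measurable_modsq R)
  measurable_pot_dens pot_dens_ge0.
pose W (z : R2) := (\int[leb]_t (layer L w (modsq z) t)%:E)%E.
have W0 z : (0 <= W z)%E.
  by apply: integral_ge0 => t _; rewrite lee_fin layer_ge0//; exact: pot_dens_ge0.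
have EW : (\int[mu]_z W z = pot_term)%E.
  by apply: (etrans E); apply: eq_integral => t _; rewrite [RHS]EFinM -mass_discE.
have ptfin : pot_term \is a fin_num.
  rewrite ge0_fin_numE; first by rewrite (le_lt_trans pot_term_le)// ltry.
  apply: integral_ge0 => t _; rewrite lee_fin mulr_ge0 ?mass_disc_ge0// cutoff_ge0//; exact: pot_dens_ge0.
have QE z : Q z = (V (modsq z))%:E by exact: (QV Qnoo Qrad Qsub).
have mD : measurable (disc L) by exact: measurable_disc.
(* A shift making the potential nonnegative on the disc. *)
pose c := `|V 0| + `|V L|.
have c0 : 0 <= c by rewrite addr_ge0.
have cL : 0 <= V L + c by have := ler_norm (- V L); rewrite normrN /c; have := normr_ge0 (V 0); lra.
rewrite (integral_shift (probability_setT mu) mD mu_carrier mQ c0); last first.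
  move=> z zD; rewrite QE lee_fin.
  have := V_nd (lexx 0) (modsq_ge0 z); have := ler_norm (- V 0).
  by rewrite normrN /c; have := normr_ge0 (V L); lra.
pose g z := maxe (Q z + c%:E)%E 0%E.
have g0 z : (0 <= g z)%E by rewrite le_max lexx orbT.
have mg : measurable_fun [set: R2] g by apply: measurable_maxe => //; exact: emeasurable_funD.
have key : (\int[mu]_z g z + pot_term = (V L + c)%:E)%E.
  rewrite -EW -ge0_integralD// -[RHS](integral_cst1 (probability_setT mu)).
  apply: (ge0_integral_carrier mD mu_carrier) => //.
  - exact: emeasurable_funD.
  - by move=> z; rewrite adde_ge0.
  move=> z zD; rewrite /W (integral_pot_layer L0 (modsq_ge0 z) zD) /g QE.
  rewrite -EFinD -EFin_max -EFinD; congr EFin; rewrite max_l; first ring.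
  have := V_nd (lexx 0) (modsq_ge0 z); have := ler_norm (- V 0).
  by rewrite normrN /c; have := normr_ge0 (V L); lra.
have -> : (\int[mu]_z maxe (Q z + c%:E) 0 = (V L + c)%:E - pot_term)%E.
  by rewrite -key addeK.
move: ptfin; case: pot_term => // b _.
by rewrite -[LHS]/((V L + c - b - c)%:E) -[RHS]/((V L - b)%:E); congr EFin; ring.
Qed.

(** With integral_log_max this expresses the energy of a rotation-invariant measure
    through F alone, up to the comparison of the two kernels. *)
Lemma energyE : energy Q mu =
  (\int[nu]_p shifted_logk L p - (kshift L)%:E + ((V L)%:E - pot_term))%E.
Proof.
rewrite /energy integral_potE; congr (_ + _)%E.
have mD : measurable (disc L) by exact: measurable_disc.
apply: (@integral_shift _ _ _ nu (disc L `*` disc L) (product_setT mu) _ _ (@logk R)).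
- exact: measurableX.
- exact: product_carrier.
- exact: measurable_logk.
- exact: kshift_ge0.
- by move=> p [z1 z2]; exact: logk_disc.
Qed.

Lemma pot_term_fin : pot_term \is a fin_num.
Proof.
rewrite ge0_fin_numE; first by rewrite (le_lt_trans pot_term_le)// ltry.
by apply: integral_ge0 => t _; exact: pot_ge0.
Qed.

End one_measure.

Local Notation Tc := (mass_quantile q 1).
Local Notation mucand := (candidate Qnoo Qlsc Qrad qsmooth Qsub Qgrowth).

Lemma mass_at_crit : h Tc = 1.
Proof. by rewrite (mass_quantileK Qnoo Qlsc Qrad qsmooth Qsub Qgrowth). Qed.

Lemma crit_gt0 : 0 < Tc.
Proof. by rewrite (quantile_gt0 Qnoo Qlsc Qrad qsmooth Qsub Qgrowth). Qed.

Hypothesis TL : Tc <= L.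

Lemma candidate_carrier : mucand (disc L) = 1%E.
Proof.
rewrite [LHS]candidate_disc// min_r//; rewrite -mass_at_crit.
by apply: (radial_mass_nd Qnoo Qlsc Qrad qsmooth Qsub) => //; exact: crit_gt0.
Qed.

Lemma candidate_mass t : 0 < t -> mass_disc mucand t = Num.min (h t) 1.
Proof. by move=> t0; rewrite /mass_disc candidate_disc. Qed.

(** On [0,1] the parabola f^2 - 2 a f is minimal at f = min(a,1). *)
Lemma min_square (a f : R) : 0 <= f <= 1 ->
  Num.min a 1 * Num.min a 1 + 2 * (a * f) <= f * f + 2 * (a * Num.min a 1).
Proof.
move=> /andP[f0 f1]; have [a1|a1] := leP a 1.
  have := sqr_ge0 (a - f); rewrite expr2; lra.
have : 0 <= (1 - f) * (2 * a - (1 + f)) by rewrite mulr_ge0//; lra.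
lra.
Qed.

Variable sigma : probability R2 R.
Hypothesis sD : sigma (disc L) = 1%E.
Hypothesis srot : rotation_invariant sigma.

(** Integrate min_square, with a = h(t) and f = F(t), against dt/t. It is stated without
    subtraction because the quadratic terms may be infinite. *)
Lemma term_compare : (square_term mucand + 2%:E * pot_term sigma <=
  square_term sigma + 2%:E * pot_term mucand)%E.
Proof.
have mP m := measurable_pot_term m; have mS m := measurable_square_term m.
have p0 m t := pot_ge0 m t; have s0 m t := square_ge0 m t.
have mP2 m : measurable_fun [set: R] (fun t => 2%:E * (cutoff L w t * mass_disc m t)%:E)%E.
  exact: measurable_funeM.
have p20 m t : (0 <= 2%:E * (cutoff L w t * mass_disc m t)%:E)%E by rewrite mule_ge0// lee_fin.
have mSP m m' : measurable_fun [set: R] (fun t => (cutoff L (fun t => t^-1) t * (mass_disc m t * mass_disc m t))%:E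
    + 2%:E * (cutoff L w t * mass_disc m' t)%:E)%E by exact: emeasurable_funD.
have E m : (2%:E * pot_term m = \int[leb]_t (2%:E * (cutoff L w t * mass_disc m t)%:E))%E.
  by apply/esym; apply: ge0_integralZl => //; exact: mP.
rewrite !E /square_term.
rewrite -[leLHS](ge0_integralD leb measurableT (fun t _ => s0 mucand t) (mS mucand) (fun t _ => p20 sigma t) (mP2 sigma)).
rewrite -[leRHS](ge0_integralD leb measurableT (fun t _ => s0 sigma t) (mS sigma) (fun t _ => p20 mucand t) (mP2 mucand)).
apply: ge0_le_integral => //.
- by move=> t _; exact: adde_ge0.
- exact: mSP.
- exact: mSP.
move=> t _; rewrite -!EFinM -!EFinD lee_fin /cutoff.
case: ifPn => [/andP[t0 _]|_]; last by rewrite !mul0r.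
rewrite candidate_mass// /pot_dens.
have F01 : 0 <= mass_disc sigma t <= 1 by rewrite mass_disc_ge0 mass_disc_le1.
have ti0 : 0 <= t^-1 by rewrite invr_ge0 ltW.
have := ler_wpM2l ti0 (min_square (h t) F01).
by congr (_ <= _); ring.
Qed.

(** For the candidate the kernel log 1/max(|z|,|w|) gives the energy exactly, because
    its circles are null; for sigma it gives a lower bound. The comparison of F^2 - 2hF
    then concludes. *)
Lemma energy_candidate_le : (energy Q mucand <= energy Q sigma)%E.
Proof.
rewrite (energyE candidate_carrier) (energyE sD).
have X1 := integral_shifted_logk_ge L1 srot sD.
have X2 := integral_shifted_logk_le L1 (candidate_rotation_invariant Qnoo Qlsc Qrad qsmooth Qsub Qgrowth)
  candidate_carrier (offdiag_null (candidate_circle Qnoo Qlsc Qrad qsmooth Qsub Qgrowth)).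
have TC := term_compare.
have pc := pot_term_fin mucand; have ps := pot_term_fin sigma.
have sq0 m : (0 <= square_term m)%E by apply: integral_ge0 => t _; exact: square_ge0.
have s1 := sq0 sigma; have s2 := sq0 mucand.
rewrite !integral_log_max in X1 X2.
move: X1 X2 TC s1 s2; move: pc ps.
case: (pot_term mucand) => // b1 _; case: (pot_term sigma) => // b2 _.
move: (square_term sigma) (square_term mucand) => A1 A2.
move: (\int[sigma \x sigma]_p shifted_logk L p)%E (\int[mucand \x mucand]_p shifted_logk L p)%E => Y1 Y2.
(* If the quadratic term of sigma is infinite, so is its energy. *)
case: A1 => [a1| |]//; last first.
  rewrite gt0_muley ?lte_fin ?invr_gt0// addye// leye_eq => /eqP -> _ _ _ _.
  by rewrite !addye// leey.
case: A2 => [a2| |]// H1 H2 H3 _ _.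
move: H1 H2 H3; case: Y1 => [y1| |]//; last by move=> _ _ _; rewrite !addye// leey.
case: Y2 => [y2| |]//.
  rewrite -!EFinM -!EFinD -?EFinN -?EFinD !lee_fin; lra.
by move=> _ _ _; rewrite leNye.
Qed.

End energy.

(** * The droplet and its outer edge *)

Section droplet.
Variable R : realType.
Local Notation R2 := (R * R)%type.
Local Notation supp := (@Defs.support R).
Variables (Q : R2 -> \bar R) (q : R -> R).
Hypothesis Qnoo : forall z, (-oo < Q z)%E.
Hypothesis Qlsc : lower_semicontinuous Q.
Hypothesis Qrad : forall z, 0 < cmod z -> Q z = (q (cmod z))%:E.
Hypothesis qsmooth : forall (k : nat) (r : R), 0 < r -> derivable (derive1n k q) r 1.
Hypothesis Qsub : subharmonic Q.
Hypothesis Qgrowth :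
  (2%:E < limf_einf (fun z => Q z / (ln (cmod z))%:E) (@at_infinity R))%E.
Variable sigma : probability R2 R.
Hypothesis eq_sigma : is_equilibrium_measure Q sigma.

Local Notation h := (radial_mass q).
Local Notation Tc := (mass_quantile q 1).
Local Notation mucand := (candidate Qnoo Qlsc Qrad qsmooth Qsub Qgrowth).
Local Notation S := (supp sigma).

Let hmono s t : 0 < s -> s <= t -> h s <= h t.
Proof. exact: (radial_mass_nd Qnoo Qlsc Qrad qsmooth Qsub). Qed.

Let T0 : 0 < Tc. Proof. exact: (crit_gt0 Qnoo Qlsc Qrad qsmooth Qsub Qgrowth). Qed.
Let hT : h Tc = 1. Proof. exact: (mass_at_crit Qnoo Qlsc Qrad qsmooth Qsub Qgrowth). Qed.

Lemma sigma_rotation_invariant : rotation_invariant sigma.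
Proof.
apply: (equilibrium_rotation_invariant _ _ eq_sigma).
  exact: (measurable_pot Qnoo Qlsc Qrad qsmooth Qsub).
by move=> u z u1; rewrite !(QV Qnoo Qrad Qsub) modsq_rot u1 mul1r.
Qed.

(** The candidate has energy at most that of the minimizer, so by uniqueness it is the
    minimizer. *)
Lemma sigma_disc t : 0 < t -> sigma [set z | modsq z <= t] = (Num.min (h t) 1)%:E.
Proof.
move=> t0; have [cS H] := eq_sigma; have [L0 L00 HL] := compact_sub_disc cS.
(* A disc carrying both measures. *)
pose L := Num.max L0 (Num.max 1 Tc).
have L1 : 1 <= L by rewrite !le_max lexx !orbT.
have TL : Tc <= L by rewrite !le_max lexx !orbT.
have sD : sigma (disc L) = 1%E.
  by apply: support_disc => z /HL zL; rewrite (le_trans zL)// le_max lexx.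
have cD := candidate_carrier Qnoo Qlsc Qrad qsmooth Qsub Qgrowth L1 TL.
have cc : compact (supp mucand).
  apply: (@subclosed_compact _ _ (disc L)); [exact: closed_support|exact: compact_disc|].
  apply: support_sub; first exact: closed_disc.
  rewrite [LHS](probability_setC mucand (measurable_disc L)).
  by rewrite [X in (_ - X)%E]cD subee.
have [H1 H2] := H mucand cc.
have E : energy Q mucand = energy Q sigma.
  apply/le_anti; rewrite H1 andbT.
  exact: (energy_candidate_le _ _ _ _ _ _ L1 TL sD sigma_rotation_invariant).
by rewrite -(H2 E _ (measurable_disc t)) candidate_disc.
Qed.

Lemma droplet_rot u z : modsq u = 1 -> S z -> S (crot u z).
Proof.
move=> u1 Sz U oU Uz.
rewrite -(sigma_rotation_invariant u1 (measurable_open oU)).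
apply: Sz => //; apply: open_comp => // y _; exact: continuous_crot.
Qed.

(** Points of equal modulus differ by a rotation. *)
Lemma droplet_radial z w : modsq z = modsq w -> S z -> S w.
Proof.
move=> zw Sz; have [z0|z0] := eqVneq (modsq z) 0.
  have w0 : modsq w = 0 by rewrite -zw.
  by rewrite (modsq_eq0 w0) -(modsq_eq0 z0).
(* The quotient w / z of complex numbers. *)
pose u : R2 := ((w.1 * z.1 + w.2 * z.2) / modsq z, (w.2 * z.1 - w.1 * z.2) / modsq z).
have u1 : modsq u = 1.
  rewrite /modsq/= !exprMn -mulrDl.
  rewrite (_ : _ ^+ 2 + _ ^+ 2 = modsq w * modsq z); last by rewrite /modsq; ring.
  by rewrite -zw exprVn -expr2 mulfV// sqrf_eq0.
suff -> : w = crot u z by exact: droplet_rot.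
have zz : z.1 ^+ 2 + z.2 ^+ 2 != 0 by [].
rewrite /crot/u /modsq/= [LHS]surjective_pairing.
by congr (_, _); field.
Qed.

Lemma droplet_sub z : S z -> modsq z <= Tc.
Proof.
apply: (support_sub (A := [set z | modsq z <= Tc])); first exact: closed_disc.
rewrite [LHS](probability_setC sigma (measurable_disc Tc)).
by rewrite [X in (_ - X)%E](sigma_disc T0) hT minxx subee.
Qed.

(** If the circle |z|^2 = s missed the droplet, which is closed, a neighbouring annulus
    would be null and h would be constant on it. *)
Lemma droplet_mem s : 0 < s -> s <= Tc ->
  (forall a, 0 < a -> a < s -> h a < h s) -> S (Num.sqrt s, 0).
Proof.
move=> s0 sT hs; apply: contrapT => nS.
have sE : modsq (Num.sqrt s, 0 : R) = s by rewrite /modsq/= expr0n/= addr0 sqr_sqrtr// ltW.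
have cS : closed (@modsq R @` S).
  apply: compact_closed; first exact: Rhausdorff.
  apply: continuous_compact; last by have [] := eq_sigma.
  by apply: continuous_subspaceT; exact: continuous_modsq.
have ns : (~` (@modsq R @` S)) s.
  move=> /= [z Sz zs]; apply: nS; apply: droplet_radial Sz; by rewrite zs sE.
have /nbhs_ballP[e /= e0 He] := open_nbhs_nbhs (conj (closed_openC cS) ns).
pose m := Num.min (e / 2) (s / 2); pose a := s - m.
have m0 : 0 < m by rewrite lt_min !divr_gt0.
have me : m <= e / 2 by rewrite ge_min lexx.
have ms : m <= s / 2 by rewrite ge_min lexx orbT.
have a0 : 0 < a by rewrite /a; lra.
have as_ : a < s by rewrite /a; lra.
have ann0 : sigma [set z | a < modsq z <= s] = 0%E.
  have mA : measurable [set z : R2 | a < modsq z <= s].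
    have := @measurable_modsq R measurableT _ (measurable_itv `]a, s]); rewrite setTI.
    by congr measurable; apply/seteqP; split => z /=; rewrite in_itv.
  apply: (subset_measure0 (B := ~` S)) => //.
  - by apply: measurableC; apply: measurable_closed; exact: closed_support.
  - move=> z /= /andP[az zs] Sz; apply: (He (modsq z)); last by exists z.
    rewrite /ball/= ger0_norm ?subr_ge0//; rewrite /a in az; lra.
  - exact: support_setC.
have : sigma [set z | modsq z <= s] = (sigma [set z | (modsq z <= a)%R] + sigma [set z | (a < modsq z <= s)%R])%E.
  rewrite -measureU//; first last.
  - by apply/seteqP; split => // z /= [za /andP[az _]]; move: az; rewrite ltNge za.
  - have := @measurable_modsq R measurableT _ (measurable_itv `]a, s]); rewrite setTI.
    by congr measurable; apply/seteqP; split => z /=; rewrite in_itv.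
  - exact: measurable_disc.
  congr (sigma _); apply/seteqP; split => z /=.
    by move=> zs; have [za|za] := leP (modsq z) a; [left|right].
  by case=> [za|/andP[]//]; apply: le_trans za _; exact: ltW.
rewrite ann0 adde0 !sigma_disc// => -[].
have h1 : h s <= 1 by rewrite -hT hmono.
have hlt := hs a a0 as_.
rewrite !min_l//; last by rewrite (le_trans (ltW hlt)).
by move=> E; move: hlt; rewrite E ltxx.
Qed.

Lemma droplet_edge : S (Num.sqrt Tc, 0).
Proof.
apply: droplet_mem => // a a0 aT; rewrite hT.
exact: (quantile_lt Qnoo Qlsc Qrad qsmooth Qsub Qgrowth (lexx 1) a0 aT).
Qed.

(** The droplet lies in |z|^2 <= T, and it contains the circle |z|^2 = T since h < 1
    before T. *)
Lemma outer_radius_droplet : outer_radius S = Num.sqrt Tc.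
Proof.
have ub : ubound (@cmod R @` S) (Num.sqrt Tc).
  by move=> _ [z Sz <-]; rewrite cmodE ler_wsqrtr// droplet_sub.
have mem : (@cmod R @` S) (Num.sqrt Tc).
  by exists (Num.sqrt Tc, 0); [exact: droplet_edge|exact: cmod_sqrt].
apply/le_anti/andP; split; first by apply: ge_sup => //; exists (Num.sqrt Tc).
by apply: ub_le_sup => //; exists (Num.sqrt Tc).
Qed.

Hypothesis Qstrict : forall z, cmod z = outer_radius S ->
  \forall w \near z, 0 < laplacian (fine \o Q) w.

(** The neighbourhood provided by strict subharmonicity, read along the radius through
    (sqrt T, 0). *)
Lemma radial_dens_edge : exists2 e, 0 < e <= Tc / 2 &
  forall s, Tc - e <= s <= Tc -> 0 < radial_dens q s.
Proof.
have cE : cmod (Num.sqrt Tc, 0) = outer_radius S by rewrite outer_radius_droplet cmod_sqrt.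
have c : (fun s : R => (Num.sqrt s, 0 : R)) s @[s --> Tc] --> (Num.sqrt Tc, 0 : R).
  have c1 : Num.sqrt s @[s --> Tc] --> Num.sqrt Tc by exact: sqrt_continuous.
  have c2 : (fun=> 0 : R) s @[s --> Tc] --> (0 : R) by exact: cvg_cst.
  exact: (cvg_pair c1 c2).
have N : \forall s \near Tc, 0 < laplacian (fine \o Q) (Num.sqrt s, 0) by exact: (c _ (Qstrict cE)).
move: N => /nbhs_ballP[e /= e0 He].
exists (Num.min (e / 2) (Tc / 2)).
  by rewrite lt_min !divr_gt0//= ge_min lexx orbT.
set m := Num.min _ _; have m0 : 0 < m by rewrite lt_min !divr_gt0.
have me : m <= e / 2 by rewrite ge_min lexx.
have ms : m <= Tc / 2 by rewrite ge_min lexx orbT.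
move=> s /andP[s1 s2]; have s0 : 0 < s by have := T0; lra.
have sE : modsq (Num.sqrt s, 0 : R) = s by rewrite /modsq/= expr0n/= addr0 sqr_sqrtr// ltW.
have : ball Tc e s by rewrite /ball/= ger0_norm ?subr_ge0//; lra.
move=> /He /=; rewrite (laplacian_radial Qnoo Qrad qsmooth Qsub) sE//.
by rewrite pmulr_rgt0.
Qed.

(** Near the edge h is strictly increasing, so no circle is missed. *)
Lemma droplet_annulus : exists2 e, 0 < e & forall s, Tc - e <= s <= Tc -> S (Num.sqrt s, 0).
Proof.
have [e /andP[e0 eT] He] := radial_dens_edge.
exists (e / 2); first by rewrite divr_gt0.
move=> s /andP[s1 s2]; have TT := T0; have s0 : 0 < s by lra.
apply: droplet_mem => // a a0 as_.
pose b := Num.max a (Tc - e).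
have ab : a <= b by rewrite le_max lexx.
have bs : b < s by rewrite gt_max as_/=; lra.
have b0 : 0 < b by exact: lt_le_trans ab.
apply: (le_lt_trans (hmono a0 ab)).
have [c [bc cs E]] := mvt_derive (f := h) (df := radial_dens q) bs
  (fun x (H : b <= x <= s) => is_derive_h qsmooth (lt_le_trans b0 (andP H).1)).
rewrite -subr_gt0 E mulr_gt0 ?subr_gt0//; apply: He.
have be : Tc - e <= b by rewrite le_max lexx orbT.
by apply/andP; split; lra.
Qed.

End droplet.

(** * Half-Gaussian integrals *)

Section gauss_tail.
Variable R : realType.
Local Notation leb := (@lebesgue_measure R).
Local Notation gauss := (@gauss_fun R).

(** The Gaussian distribution function without normalization: it tends to sqrt pi. *)
Definition Phi (t : R) : R := (\int[leb]_(w in `]-oo, t]) gauss w)%R.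

Lemma integrable_gauss (A : set R) : measurable A ->
  leb.-integrable A (EFin \o gauss).
Proof. by move=> mA; apply: integrableS (integrableT_gauss); rewrite //. Qed.

Lemma EFin_Phi t : ((Phi t)%:E = \int[leb]_(w in `]-oo, t]) (gauss w)%:E)%E.
Proof.
rewrite /Phi /Rintegral fineK//.
by apply: integrable_fin_num => //; exact: integrable_gauss.
Qed.

Lemma is_derive_Phi (t : R) : is_derive t 1 Phi (gauss t).
Proof.
have t1 : t < t + 1 by rewrite ltrDl.
have ig : leb.-integrable `]-oo, t + 1] (EFin \o gauss) by exact: integrable_gauss.
have [] := @continuous_FTC1 R gauss -oo%O t (t + 1) t1 ig.
- by rewrite ltNyr.
- exact: continuous_gauss_fun.
move=> d0 d1; have d0' : derivable Phi t 1 := d0.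
have d1' : derive1 Phi t = gauss t := d1.
by apply: (DeriveDef d0'); rewrite -derive1E; exact: d1'.
Qed.

Lemma Phi_0 : Phi 0 = Num.sqrt pi / 2.
Proof.
apply: EFin_inj; rewrite EFin_Phi -integral0y_gauss.
rewrite ge0_integration_by_substitution0//.
- by apply: eq_integral => x _; rewrite /gauss_fun sqrrN.
- by apply/measurable_EFinP; exact: measurable_gauss_fun.
- by move=> r; rewrite lee_fin gauss_fun_ge0.
Qed.

Lemma Phi_split t : 0 <= t ->
  Phi t = Num.sqrt pi / 2 + @gauss_integral_proof.integral0_gauss R t.
Proof.
move=> t0; rewrite -Phi_0.
have E : (\int[leb]_(w in `]-oo, t]) (gauss w)%:E =
    \int[leb]_(w in `]-oo, 0%R]) (gauss w)%:E +
    \int[leb]_(w in `[0%R, t]) (gauss w)%:E)%E.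
  have mg (A : set R) : measurable_fun A (EFin \o gauss).
    by apply: measurable_funTS; apply/measurable_EFinP; exact: measurable_gauss_fun.
  rewrite -(@integral_itv_obnd_cbnd _ _ (BRight t) (EFin \o gauss))//.
  rewrite (@itv_bndbnd_setU _ _ -oo%O (BRight 0) (BRight t)) ?bnd_simp//.
  rewrite ge0_integral_setU//; [exact: mg| |].
  - by move=> x _; rewrite lee_fin gauss_fun_ge0.
  - apply/disj_setPS => x [] /=; rewrite !in_itv/= => x0 /andP[].
    by rewrite ltNge x0.
apply: EFin_inj; rewrite EFinD (EFin_Phi t) (EFin_Phi 0) E; congr (_ + _)%E.
rewrite /gauss_integral_proof.integral0_gauss /Rintegral fineK//.
by apply: integrable_fin_num => //; exact: integrable_gauss.
Qed.

Lemma Phi_cvg : Phi t @[t --> +oo] --> (Num.sqrt pi : R).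
Proof.
have c : @gauss_integral_proof.integral0_gauss R x @[x --> +oo] --> Num.sqrt pi / 2.
  have : Num.sqrt (@gauss_integral_proof.integral0_gauss R x ^+ 2) @[x --> +oo]
      --> Num.sqrt (pi / 4).
    apply: continuous_cvg => //; first exact: sqrt_continuous.
    exact: gauss_integral_proof.cvg_integral0_gauss_sqr.
  rewrite sqrtrM ?pi_ge0// sqrtrV// (_ : 4 = 2 ^+ 2); last by rewrite expr2 -natrM.
  rewrite sqrtr_sqr ger0_norm//.
  rewrite (_ : (fun _ => Num.sqrt _) = @gauss_integral_proof.integral0_gauss R)//.
  apply/funext => r; rewrite sqrtr_sqr// ger0_norm//.
  exact: gauss_integral_proof.integral0_gauss_ge0.
have : (Num.sqrt pi / 2 + @gauss_integral_proof.integral0_gauss R x) @[x --> +oo] -->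
   (Num.sqrt pi / 2 + Num.sqrt pi / 2 : R) by apply: cvgD => //; exact: cvg_cst.
rewrite -splitr; apply: cvg_trans; apply: near_eq_cvg.
near=> x; rewrite Phi_split//; near: x; exact: nbhs_pinfty_ge.
Unshelve. all: by end_near. Qed.

Lemma Phi_ge t : 0 <= t -> Num.sqrt pi / 2 <= Phi t.
Proof.
move=> t0; rewrite Phi_split// lerDl.
exact: gauss_integral_proof.integral0_gauss_ge0.
Qed.

Lemma Phi_gt0 t : 0 <= t -> 0 < Phi t.
Proof.
by move=> t0; rewrite (lt_le_trans _ (Phi_ge t0))// divr_gt0// sqrtr_gt0 pi_gt0.
Qed.

(** Complete the square and substitute w = t - v. *)
Lemma integral_half_gauss (t : R) :
  (\int[leb]_(v in `[0%R, +oo[) (expR (- v ^+ 2 + 2 * t * v))%:E =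
   (expR (t ^+ 2) * Phi t)%:E)%E.
Proof.
pose F w : \bar R := ((EFin \o gauss) \_ `]-oo, t]) w.
have mF : measurable_fun [set: R] F.
  apply/(measurable_restrictT _ _).1 => //.
  by apply: measurable_funTS; apply/measurable_EFinP; exact: measurable_gauss_fun.
have F0 w : (0 <= F w)%E.
  by apply: erestrict_ge0 => x _; rewrite lee_fin gauss_fun_ge0.
have mF' : measurable_fun [set: R] (fun w => F (- w)).
  by apply: (measurableT_comp mF); exact: measurable_funN.
rewrite EFinM EFin_Phi [in RHS]integral_mkcond -[X in (_ * X)%E]/(\int[leb]_w F w)%E.
rewrite -(ge0_integral_opp mF F0).
have -> : (\int[leb]_x F (- x)%R = \int[leb]_x F (- (1 * x + - t))%R)%E.
  by rewrite (ge0_integral_affine (- t) ltr01 mF')// invr1 mul1e.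
rewrite -ge0_integralZl//; last first.
  have m : measurable_fun [set: R] (fun x : R => F (- (1 * x - t))).
    by apply: (measurableT_comp mF); mfun.
  exact: m.
rewrite [LHS]integral_mkcond; apply: eq_integral => v _.
rewrite /F /patch mul1r opprB.
have -> : (t - v \in `]-oo, t]%classic) = (v \in `[0%R, +oo[%classic).
  by apply/idP/idP; rewrite !inE/= !in_itv/= andbT; lra.
case: ifP => _; last by rewrite mule0.
by rewrite /= -EFinM /gauss_fun -expRD; congr (expR _)%:E; ring.
Qed.

(** The integrand is the logarithmic derivative of Phi, which grows from sqrt(pi)/2 to
    sqrt(pi). *)
Lemma integral_inv_half_gauss :
  (\int[leb]_(t in `[0%R, +oo[) ((expR (t ^+ 2) * Phi t)^-1)%:E = (ln 2)%:E)%E.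
Proof.
have dF (x : R) : 0 <= x -> is_derive x 1 (fun t => ln (Phi t)) ((expR (x ^+ 2) * Phi x)^-1).
  move=> x0.
  have H1 := is_derive_Phi x.
  have H2 := is_derive1_ln (Phi_gt0 x0).
  have := is_derive1_comp H2 H1.
  rewrite /GRing.scale/= /gauss_fun expRN => H.
  by rewrite invfM mulrC.
have sp : 0 < Num.sqrt (pi : R) by rewrite sqrtr_gt0 pi_gt0.
rewrite (@ge0_continuous_FTC2y _ _ (fun t => ln (Phi t)) 0 (ln (Num.sqrt pi))).
- rewrite Phi_0 -EFinB -ln_div ?posrE ?divr_gt0//.
  by congr (ln _)%:E; field; rewrite gt_eqF.
- by move=> x x0; rewrite invr_ge0 mulr_ge0 ?expR_ge0// ltW// Phi_gt0.
- apply: derivable_within_continuous => x; rewrite in_itv/= andbT => x0.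
  have d1 := is_derive_Phi x.
  apply: ex_derive; apply: is_deriveV.
  by rewrite gt_eqF// mulr_gt0 ?expR_gt0 ?Phi_gt0.
- apply: (cvg_comp Phi (@ln R)); first exact: Phi_cvg.
  exact: continuous_ln.
- by move=> x x0; have [] := dF x (ltW x0).
- apply: cvg_at_right_filter; have [d0 _] := dF 0 (lexx _).
  exact: (differentiable_continuous ((derivable1_diffP _ _).1 d0)).
- move=> x; rewrite in_itv/= andbT => x0.
  by rewrite derive1E; have [_ ->] := dF x (ltW x0).
Qed.

End gauss_tail.

(** * Laplace asymptotics at the hard edge *)

Section edge.
Variable R : realType.
Local Notation leb := (@lebesgue_measure R).
Variables (V h : R -> R) (T dl e0 : R) (S' : set R).
Hypothesis mV : measurable_fun [set: R] V.
Hypothesis T0 : 0 < T.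
Hypothesis dl0 : 0 < dl.
Hypothesis dV : forall s : R, 0 < s -> is_derive s 1 V (h s / s).
Hypothesis hmono : forall s t : R, 0 < s -> s <= t -> h s <= h t.
Hypothesis hT : h T = 1.
Hypothesis dh : is_derive T 1 h dl.
Hypothesis mS : measurable S'.
Hypothesis Ssub : forall s, S' s -> 0 < s <= T.
Hypothesis e00 : 0 < e0.
Hypothesis ann : forall s, T - e0 <= s <= T -> S' s.

(** The radial density of the monomial of degree n - k; small k means high degree, the
    degrees whose mass sits near the edge. *)
Definition wgt (n k : nat) (s : R) : R := s ^+ (n - k) * expR (- (n%:R * V s)).
(** With the value at the edge normalized to 1, the masses are comparable to the width
    lam of the edge layer. *)
Definition nwgt n k s := wgt n k s / wgt n k T.
(** The exponent of the top degree, maximal at the edge on ]0, T]. *)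
Definition Psi (s : R) := ln s - V s.

Lemma wgtE n k s : 0 < s -> (k <= n)%N ->
  wgt n k s = expR (n%:R * Psi s - k%:R * ln s).
Proof.
move=> s0 kn; rewrite /wgt -{1}(@lnK _ s)// -expRM_natl -expRD natrB// /Psi.
by congr expR; ring.
Qed.

Lemma nwgtE n k s : 0 < s -> (k <= n)%N ->
  nwgt n k s = expR (n%:R * (Psi s - Psi T) + k%:R * (ln T - ln s)).
Proof.
move=> s0 kn; rewrite /nwgt !wgtE// -expRN -expRD; congr expR; ring.
Qed.

Lemma wgt_ge0 n k s : 0 <= s -> 0 <= wgt n k s.
Proof. by move=> s0; rewrite mulr_ge0 ?expR_ge0 ?exprn_ge0. Qed.

Lemma wgtT_gt0 n k : 0 < wgt n k T.
Proof. by rewrite mulr_gt0 ?expR_gt0 ?exprn_gt0. Qed.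

Lemma nwgt_ge0 n k s : 0 <= s -> 0 <= nwgt n k s.
Proof. by move=> s0; rewrite divr_ge0 ?wgt_ge0// ltW. Qed.

Lemma measurable_wgt n k : measurable_fun [set: R] (wgt n k).
Proof. by mfun; exact: mV. Qed.

Lemma measurable_nwgt n k : measurable_fun [set: R] (nwgt n k).
Proof. by apply: measurable_funM => //; exact: measurable_wgt. Qed.

Lemma is_derive_Psi (s : R) : 0 < s -> is_derive s 1 Psi ((1 - h s) * s^-1).
Proof.
move=> s0; have d1 := is_derive1_ln s0; have d2 := dV s0.
by apply: is_derive_eq; rewrite mulrBl mul1r.
Qed.

Lemma h_le1 s : 0 < s -> s <= T -> h s <= 1.
Proof. by move=> s0 sT; rewrite -hT hmono. Qed.

Lemma Psi_le s : 0 < s -> s <= T -> Psi s <= Psi T.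
Proof.
move=> s0 sT; apply: (derive_ge0_le (df := fun s => (1 - h s) * s^-1)) => //.
  by move=> x /andP[sx _]; apply: is_derive_Psi; exact: lt_le_trans sx.
move=> x /andP[sx xT]; have x0 := lt_le_trans s0 sx.
by rewrite mulr_ge0 ?subr_ge0 ?h_le1// invr_ge0 ltW.
Qed.

(** The first derivative of Psi at T vanishes because h(T) = 1, and the second one
    equals minus dl/T. *)
Lemma Psi_expand eta : 0 < eta -> exists2 d, 0 < d &
  forall y, 0 <= y <= d ->
    `|Psi (T - y) - Psi T + dl / (2 * T) * y ^+ 2| <= eta * y ^+ 2.
Proof.
move=> eta0.
have dT : is_derive T 1 (fun s => (1 - h s) * s^-1) (- (dl / T)).
  have T0' : T != 0 by rewrite gt_eqF.
  have d1 := is_deriveV T0' (is_derive_id T 1).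
  have d2 := is_deriveB (is_derive_cst (1 : R) T 1) dh.
  have d3 := is_deriveM d2 d1.
  apply: (is_derive_eq d3).
  rewrite (_ : (cst 1 - h) T = 0); last by rewrite -[LHS]/(1 - h T) hT subrr.
  by rewrite scale0r add0r sub0r scalerN /GRing.scale/= mulrC.
have near_d : \forall x \near T, is_derive (x : R) 1 Psi ((1 - h x) * x^-1).
  near=> x; apply: is_derive_Psi; near: x; exact: lt_nbhsr.
have [d d0 H] := derive_expand2 near_d dT eta0.
exists d => // y /andP[y0 yd].
have := H (T - y); rewrite addrAC subrr add0r normrN ger0_norm// => /(_ yd).
rewrite hT subrr mul0r mul0r subr0 sqrrN.
congr (`|_| <= _); field; by rewrite gt_eqF.
Unshelve. all: by end_near. Qed.

(** A fixed neighbourhood of the edge where the quadratic approximation holds up to a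
    factor between 1/2 and 3/2. *)
Lemma edge_radius : exists e, [/\ 0 < e, e <= e0, e <= T / 2 &
  forall y, 0 <= y <= e ->
    dl / (4 * T) * y ^+ 2 <= Psi T - Psi (T - y) <= 3 * dl / (4 * T) * y ^+ 2].
Proof.
have eta0 : 0 < dl / (4 * T) by rewrite divr_gt0// mulr_gt0.
have [d d0 H] := Psi_expand eta0.
exists (Num.min d (Num.min e0 (T / 2))); split.
- by rewrite !lt_min d0 e00 divr_gt0.
- by rewrite !ge_min lexx orbT.
- by rewrite !ge_min lexx !orbT.
move=> y /andP[y0]; rewrite le_min => /andP[yd _].
have := H y; rewrite y0 yd => /(_ isT); rewrite ler_norml => /andP[H1 H2].
have E : dl / (2 * T) * y ^+ 2 = 2 * (dl / (4 * T) * y ^+ 2).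
  by field; rewrite gt_eqF.
have E3 : 3 * dl / (4 * T) * y ^+ 2 = 3 * (dl / (4 * T) * y ^+ 2).
  by field; rewrite gt_eqF.
rewrite E3; rewrite E in H1 H2.
by apply/andP; split; lra.
Qed.

(** A strict decrease of Psi away from the edge forces h < 1 there by the mean value
    theorem. *)
Lemma h_lt1 e : 0 < e -> e <= T / 2 -> dl / (4 * T) * e ^+ 2 <= Psi T - Psi (T - e) ->
  h (T - e) < 1.
Proof.
move=> ee0 eT H.
have Te : 0 < T - e by lra.
have [c [c1 c2 E]] : exists c, [/\ T - e < c, c < T &
    Psi T - Psi (T - e) = ((1 - h c) * c^-1) * (T - (T - e))].
  apply: (mvt_derive (df := fun s => (1 - h s) * s^-1)); first lra.
  by move=> x /andP[x1 x2]; apply: is_derive_Psi; exact: lt_le_trans x1.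
have c0 : 0 < c by exact: lt_trans c1.
apply: (@le_lt_trans _ _ (h c)); first by apply: hmono => //; exact: ltW.
have : 0 < ((1 - h c) * c^-1) * (T - (T - e)).
  by rewrite -E (lt_le_trans _ H)// mulr_gt0 ?divr_gt0 ?mulr_gt0// exprn_gt0.
rewrite opprB addrCA subrr addr0 pmulr_lgt0// pmulr_lgt0 ?invr_gt0//.
by rewrite subr_gt0.
Qed.

(** The exponent n Psi(s) - k ln s has derivative (n (1 - h(s)) - k) / s, which is
    nonnegative up to c when k is at most (1 - h(c)) n. *)
Lemma nwgt_far n k s c : (k <= n)%N -> 0 < s -> s <= c -> c <= T ->
  k%:R <= (1 - h c) * n%:R -> nwgt n k s <= nwgt n k c.
Proof.
move=> kn s0 sc cT kh; have c0 := lt_le_trans s0 sc.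
rewrite /nwgt ler_pM2r ?invr_gt0 ?wgtT_gt0// !wgtE// ler_expR.
apply: (derive_ge0_le (f := fun s => n%:R * Psi s - k%:R * ln s)
  (df := fun s => n%:R * ((1 - h s) * s^-1) - k%:R * s^-1)) => // x /andP[sx xc].
  have x0 := lt_le_trans s0 sx.
  have d1 := is_derive1_ln x0; have d2 := is_derive_Psi x0.
  by apply: is_derive_eq; rewrite /GRing.scale/= ?mulr0 ?addr0.
have x0 := lt_le_trans s0 sx.
rewrite mulrA -mulrBl mulr_ge0 ?invr_ge0 ?(ltW x0)// subr_ge0.
rewrite (le_trans kh)// mulrC ler_wpM2l// lerB//; exact: hmono.
Qed.

(** The scale of the index: k is of order 1/mu, that is of order sqrt n. *)
Definition mu_ (n : nat) : R := (Num.sqrt (2 * T * dl * n%:R))^-1.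
(** The scale of the distance to the edge, chosen so that n dl / (2T) lam^2 = 1. *)
Definition lam n := 2 * T * mu_ n.

Lemma mu_gt0 n : (0 < n)%N -> 0 < mu_ n.
Proof.
by move=> n0; rewrite invr_gt0 sqrtr_gt0 !mulr_gt0// ltr0n.
Qed.

Lemma mu_sq n : (0 < n)%N -> n%:R * mu_ n ^+ 2 = (2 * T * dl)^-1.
Proof.
move=> n0; have n0' : 0 < n%:R :> R by rewrite ltr0n.
rewrite /mu_ exprVn sqr_sqrtr; last by rewrite !mulr_ge0// ltW.
by field; rewrite !gt_eqF.
Qed.

Lemma lam_gt0 n : (0 < n)%N -> 0 < lam n.
Proof. by move=> n0; rewrite !mulr_gt0// mu_gt0. Qed.

Lemma lam_sq n : (0 < n)%N -> n%:R * (dl / (2 * T)) * lam n ^+ 2 = 1.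
Proof.
move=> n0; rewrite (_ : _ * _ * _ = (n%:R * mu_ n ^+ 2) * (2 * T * dl)).
  by rewrite mu_sq// mulVf// gt_eqF// !mulr_gt0.
by rewrite /lam; field; rewrite gt_eqF.
Qed.

Lemma mu_near e : 0 < e -> \forall n \near \oo, mu_ n < e.
Proof.
move=> ee0.
have c0 : 0 < 2 * T * dl by rewrite !mulr_gt0.
near=> n.
have n0 : (0 < n)%N by near: n; exact: nbhs_infty_gt.
have n0' : 0 < n%:R :> R by rewrite ltr0n.
rewrite ltNge; apply/negP => eemu.
have : e ^+ 2 <= mu_ n ^+ 2 by rewrite lerXn2r ?nnegrE// ?ltW// mu_gt0.
have -> : mu_ n ^+ 2 = (2 * T * dl)^-1 / n%:R.
  by rewrite -(mu_sq n0); field; rewrite gt_eqF.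
rewrite ler_pdivlMr// leNgt => /negP; apply.
rewrite -ltr_pdivrMl ?exprn_gt0//.
near: n; exact: nbhs_infty_gtr.
Unshelve. all: by end_near. Qed.

Lemma mu_cvg0 : mu_ n @[n --> \oo] --> (0 : R).
Proof.
apply/cvgrPdist_le => e ee0; near=> n.
rewrite sub0r normrN ger0_norm; last by rewrite invr_ge0 sqrtr_ge0.
apply/ltW; near: n; exact: mu_near.
Unshelve. all: by end_near. Qed.

(** The normalized density in the edge variable v, where s = T - lam v. *)
Definition phi n k v : R := if T - lam n * v \in S' then nwgt n k (T - lam n * v) else 0.

Lemma phi_ge0 n k v : 0 <= phi n k v.
Proof.
rewrite /phi; case: ifPn => //; rewrite inE => /Ssub/andP[/ltW s0 _].
exact: nwgt_ge0.
Qed.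

Lemma measurable_phi n k : measurable_fun [set: R] (phi n k).
Proof.
have m1 : measurable_fun [set: R] (fun s => if s \in S' then nwgt n k s else 0).
  have := (measurable_restrictT (nwgt n k) mS).1 (measurable_funTS (measurable_nwgt n k)).
  by apply: eq_measurable_fun => x _; rewrite /patch.
apply: (measurableT_comp m1); mfun.
Qed.

Definition Gam n k : \bar R := (\int[leb]_(v in `[0%R, +oo[) (phi n k v)%:E)%E.

(** The affine substitution s = T - lam v. *)
Lemma mass_Gam n k : (0 < n)%N ->
  (\int[leb]_(s in S') (nwgt n k s)%:E = (lam n)%:E * Gam n k)%E.
Proof.
move=> n0; have l0 := lam_gt0 n0.
pose F s : \bar R := ((EFin \o nwgt n k) \_ S') s.
have mF : measurable_fun [set: R] F.
  apply: (measurable_restrictT (EFin \o nwgt n k) mS).1.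
  by apply: measurable_funTS; apply/measurable_EFinP; exact: measurable_nwgt.
have F0 w : (0 <= F w)%E.
  by apply: erestrict_ge0 => x /Ssub/andP[/ltW s0 _]; rewrite lee_fin nwgt_ge0.
have mF' : measurable_fun [set: R] (fun w => F (- w)).
  by apply: (measurableT_comp mF); exact: measurable_funN.
rewrite integral_mkcond -[LHS]/(\int[leb]_w F w)%E.
rewrite -(ge0_integral_opp mF F0).
have /(congr1 (fun x => (lam n)%:E * x)%E) := ge0_integral_affine (- T) l0 mF' (fun=> F0 _).
rewrite muleA -EFinM mulfV ?gt_eqF// mul1e => <-.
congr (_ * _)%E; rewrite /Gam [RHS]integral_mkcond; apply: eq_integral => v _.
rewrite /F /patch /phi opprB.
case: ifPn => [|_]; last by rewrite if_same.
rewrite inE => Sv; rewrite ifT// inE/= in_itv/= andbT.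
have /andP[_] := Ssub Sv; rewrite lerBlDr lerDl pmulr_rge0//.
Qed.

(** The quadratic expansion of Psi gives - v^2 and the linear one of the logarithm gives
    2tv. *)
Lemma phi_cvg (k_ : nat -> nat) (t v : R) : 0 <= t -> 0 <= v ->
  (\forall n \near \oo, (k_ n <= n)%N) ->
  (k_ n)%:R * mu_ n @[n --> \oo] --> t ->
  phi n (k_ n) v @[n --> \oo] --> expR (- v ^+ 2 + 2 * t * v).
Proof.
move=> t0 v0 kn kt.
have [e [ee0 ee1 eT _]] := edge_radius.
pose en n := n%:R * (Psi (T - lam n * v) - Psi T) +
   (k_ n)%:R * (ln T - ln (T - lam n * v)).
have lam_near d : 0 < d -> \forall n \near \oo, lam n * v <= d.
  move=> d0; near=> n; rewrite /lam.
  have : mu_ n < d / (2 * T * (v + 1)).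
    by near: n; apply: mu_near; rewrite divr_gt0// !mulr_gt0// ltr_wpDl.
  rewrite ltr_pdivlMr ?mulr_gt0 ?ltr_wpDl// => H.
  have mu0 : 0 <= mu_ n by rewrite invr_ge0 sqrtr_ge0.
  have : 0 <= 2 * T * mu_ n by rewrite !mulr_ge0// ltW.
  move: H; rewrite (_ : mu_ n * _ = 2 * T * mu_ n * v + 2 * T * mu_ n); last by ring.
  lra.
have c1 : n%:R * (Psi (T - lam n * v) - Psi T) @[n --> \oo] --> - v ^+ 2.
  apply/cvgrPdist_le => z z0.
  pose eta := z * (dl / (2 * T)) / (v ^+ 2 + 1).
  have v1 : 0 < v ^+ 2 + 1 by rewrite ltr_wpDl// sqr_ge0.
  have eta0 : 0 < eta by rewrite divr_gt0// mulr_gt0// divr_gt0// mulr_gt0.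
  have [d d0 H] := Psi_expand eta0.
  near=> n.
  have n0 : (0 < n)%N by near: n; exact: nbhs_infty_gt.
  have n0' : 0 < n%:R :> R by rewrite ltr0n.
  have l0 := lam_gt0 n0.
  have yd : 0 <= lam n * v <= d.
    by rewrite mulr_ge0 ?(ltW l0)//=; near: n; exact: lam_near.
  have L := lam_sq n0.
  have := H _ yd.
  rewrite -(@ler_pM2l _ n%:R)// -[X in X * `|_| <= _](gtr0_norm n0') -normrM.
  rewrite mulrDr (_ : n%:R * (_ * _ ^+ 2) = v ^+ 2); last first.
    by rewrite -[RHS]mul1r -[X in _ = X * _]L exprMn !mulrA.
  rewrite (_ : - v ^+ 2 - _ = - (n%:R * (Psi (T - lam n * v) - Psi T) + v ^+ 2)); last by ring.
  rewrite normrN => {}H; apply: (le_trans H).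
  rewrite (_ : n%:R * _ = z * (v ^+ 2 / (v ^+ 2 + 1)) * (n%:R * (dl / (2 * T)) * lam n ^+ 2)); last first.
    by rewrite /eta exprMn; field; rewrite !gt_eqF.
  rewrite L mulr1 ger_pMr// ler_pdivrMr// mul1r lerDl//.
have c2 : (k_ n)%:R * (ln T - ln (T - lam n * v)) @[n --> \oo] --> 2 * t * v.
  have cl : lam n * v @[n --> \oo] --> (0 : R).
    rewrite -(mul0r v); apply: cvgM; last exact: cvg_cst.
    rewrite -(mulr0 (2 * T)); apply: cvgM; [exact: cvg_cst|exact: mu_cvg0].
  have ckm : 2 * ((k_ n)%:R * mu_ n) * v @[n --> \oo] --> 2 * t * v.
    by apply: cvgM; [apply: cvgM => //; exact: cvg_cst|exact: cvg_cst].
  apply: (@squeeze_cvgr _ _ _ _ (fun n => 2 * ((k_ n)%:R * mu_ n) * v)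
     (fun n => 2 * ((k_ n)%:R * mu_ n) * v * (T / (T - lam n * v)))) => //.
    near=> n.
    have n0 : (0 < n)%N by near: n; exact: nbhs_infty_gt.
    have l0 := lam_gt0 n0.
    have yT : lam n * v <= T / 2 by near: n; apply: lam_near; rewrite divr_gt0.
    have y0 : 0 <= lam n * v by rewrite mulr_ge0// ltW.
    have Ty : 0 < T - lam n * v by lra.
    have /andP[b1 _] := ln_sub_bounds T0 y0 yT.
    have E : 2 * ((k_ n)%:R * mu_ n) * v = (k_ n)%:R * (lam n * v / T).
      by rewrite /lam; field; rewrite gt_eqF.
    rewrite E -(mulrA (k_ n)%:R); apply/andP; split; rewrite ler_wpM2l//.
    rewrite -ln_div ?posrE//; apply: (le_trans (ln_le_sub1 _)).
      by rewrite divr_gt0.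
    rewrite le_eqVlt; apply/orP; left; apply/eqP.
    by field; rewrite !gt_eqF.
  rewrite -[X in _ --> X]mulr1; apply: cvgM => //.
  rewrite (_ : 1 = T * (T - 0)^-1 :> R); last by rewrite subr0 divff// gt_eqF.
  apply: cvgM; first exact: cvg_cst.
  apply: cvgV; first by rewrite subr0 gt_eqF.
  by apply: cvgB => //; exact: cvg_cst.
have : expR (en n) @[n --> \oo] --> expR (- v ^+ 2 + 2 * t * v).
  apply: continuous_cvg; first exact: continuous_expR.
  exact: cvgD.
apply: cvg_trans; apply: near_eq_cvg; near=> n.
have n0 : (0 < n)%N by near: n; exact: nbhs_infty_gt.
have l0 := lam_gt0 n0.
have ye : lam n * v <= e by near: n; apply: lam_near.
have y0 : 0 <= lam n * v by rewrite mulr_ge0// ltW.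
have kn' : (k_ n <= n)%N by near: n.
rewrite /phi ifT.
  by rewrite nwgtE//; lra.
rewrite inE; apply: ann; lra.
Unshelve. all: by end_near. Qed.

(** A Gaussian bound uniform in n. Within distance e of the edge it is the quadratic
    bound on Psi; further inside, the density is at most its value at distance e, and
    the inequality v <= T/lam (as s > 0) turns this into a weaker Gaussian in v. *)
Lemma phi_bound e n k B v : 0 < e -> e <= e0 -> e <= T / 2 ->
  (forall y, 0 <= y <= e -> dl / (4 * T) * y ^+ 2 <= Psi T - Psi (T - y)) ->
  (0 < n)%N -> (k <= n)%N -> k%:R <= (1 - h (T - e)) * n%:R ->
  k%:R * mu_ n <= B -> 0 <= v ->
  phi n k v <= expR (- ((e / T) ^+ 2 / 2 * v ^+ 2) + 4 * B * v).
Proof.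
move=> ee0 ee1 eT He n0 kn kh kB v0.
have n0' : 0 < n%:R :> R by rewrite ltr0n.
have l0 := lam_gt0 n0.
have L := lam_sq n0.
have near_bound y : 0 <= y <= e ->
    nwgt n k (T - y) <= expR (- ((y / lam n) ^+ 2 / 2) + 4 * B * (y / lam n)).
  move=> ye; have /andP[y0 ye'] := ye.
  rewrite nwgtE//; last by lra.
  rewrite ler_expR lerD//.
    have H := ler_wpM2l (ltW n0') (He _ ye).
    rewrite -opprB mulrN lerN2 (le_trans _ H)//.
    rewrite le_eqVlt; apply/orP; left; apply/eqP.
    rewrite -[LHS]mul1r -[X in X * _ = _]L.
    by field; rewrite !gt_eqF.
  have yT2 : y <= T / 2 by lra.
  have /andP[_ b2] := ln_sub_bounds T0 y0 yT2.
  rewrite (@le_trans _ _ (k%:R * (2 * y / T)))//; first by rewrite ler_wpM2l.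
  rewrite (_ : k%:R * (2 * y / T) = 4 * (k%:R * mu_ n) * (y / lam n)); last first.
    have m0 := mu_gt0 n0.
    by rewrite /lam; field; rewrite !gt_eqF.
  apply: ler_wpM2r; first by rewrite divr_ge0// ltW.
  exact: ler_wpM2l.
have B0 : 0 <= B by apply: le_trans kB; rewrite mulr_ge0// ltW// mu_gt0.
have eT1 : (e / T) ^+ 2 <= 1.
  rewrite expr_le1// ?divr_ge0 ?(ltW ee0) ?(ltW T0)//.
  rewrite ler_pdivrMr// mul1r; lra.
rewrite /phi; case: ifPn => [|_]; last exact: expR_ge0.
rewrite inE => /Ssub/andP[s0 _].
have y0 : 0 <= lam n * v by rewrite mulr_ge0// ltW.
have [ye|ye] := leP (lam n * v) e.
  rewrite (le_trans (near_bound _ _)) ?y0//.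
  rewrite [lam n * v]mulrC mulfK ?gt_eqF// ler_expR lerD2r lerN2.
  by rewrite mulrAC ler_wpM2r// ler_piMl// sqr_ge0.
have Te : 0 < T - e by lra.
rewrite (le_trans (nwgt_far kn s0 _ _ kh)) ?lerB ?(ltW ye)//; first by lra.
rewrite (le_trans (near_bound e _)) ?(ltW ee0) ?lexx//.
have vE : e / lam n <= v by rewrite ler_pdivrMr// mulrC ltW.
have vT : e / T * v <= e / lam n.
  rewrite -mulrA ler_wpM2l ?(ltW ee0)// mulrC ler_pdivrMr// mulrC ler_pdivlMr//; lra.
have evT : 0 <= e / T * v by rewrite mulr_ge0// divr_ge0 ?(ltW ee0) ?(ltW T0).
rewrite ler_expR lerD//; last by rewrite ler_wpM2l// mulr_ge0.
rewrite lerN2 mulrAC -exprMn ler_wpM2r//.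
by rewrite lerXn2r ?nnegrE// (le_trans evT).
Qed.

(** Dominated convergence with phi_bound; k = o(n) puts the threshold of nwgt_far out of
    reach. *)
Lemma Gam_cvg (k_ : nat -> nat) (t : R) : 0 <= t ->
  (k_ n)%:R * mu_ n @[n --> \oo] --> t ->
  Gam n (k_ n) @[n --> \oo] --> (expR (t ^+ 2) * Phi t)%:E.
Proof.
move=> t0 kt.
have [e [ee0 ee1 eT He]] := edge_radius.
have He' y : 0 <= y <= e -> dl / (4 * T) * y ^+ 2 <= Psi T - Psi (T - y).
  by move=> /He/andP[].
have hlt : h (T - e) < 1.
  by apply: h_lt1 => //; apply: He'; rewrite (ltW ee0) lexx.
have kB : \forall n \near \oo, (k_ n)%:R * mu_ n <= t + 1.
  have /cvgrPdist_le/(_ _ ltr01) := kt.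
  by apply: filterS => n; rewrite ler_distl => /andP[]; lra.
have k_lin (c : R) : 0 < c -> \forall n \near \oo, (k_ n)%:R <= c * n%:R.
  move=> c0.
  have TD : 0 < 2 * T * dl by rewrite !mulr_gt0.
  have t1 : 0 < t + 1 by lra.
  near=> n.
  have n0 : (0 < n)%N by near: n; exact: nbhs_infty_gt.
  have n0' : 0 < n%:R :> R by rewrite ltr0n.
  have m0 := mu_gt0 n0; have ms := mu_sq n0.
  rewrite -(@ler_pM2r _ (mu_ n))// (@le_trans _ _ (t + 1))//.
    by near: n.
  have : mu_ n < c / (2 * T * dl * (t + 1)).
    by near: n; apply: mu_near; rewrite divr_gt0// mulr_gt0.
  rewrite ltr_pdivlMr; last by rewrite mulr_gt0.
  move=> H; rewrite -(@ler_pM2r _ (mu_ n))//.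
  rewrite (_ : c * n%:R * mu_ n * mu_ n = c * (n%:R * mu_ n ^+ 2)); last by ring.
  rewrite ms ler_pdivlMr// (le_trans _ (ltW H))//.
  by rewrite le_eqVlt; apply/orP; left; apply/eqP; ring.
have kn : \forall n \near \oo, (k_ n <= n)%N.
  by apply: filterS (k_lin 1 ltr01) => n; rewrite mul1r ler_nat.
have c0 : 0 < (e / T) ^+ 2 / 2 by rewrite divr_gt0// exprn_gt0// divr_gt0.
rewrite -integral_half_gauss.
have [] := @dominated_cvg_near _ _ _ leb `[0%R, +oo[%classic
  (fun n v => (phi n (k_ n) v)%:E) (fun v => (expR (- v ^+ 2 + 2 * t * v))%:E)
  _ (measurable_itv _) _ _ (integrable_gauss_linear (4 * (t + 1)) c0) _ => //.
- by move=> n; apply/measurable_EFinP; apply: measurable_funTS; exact: measurable_phi.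
- move=> v; rewrite /= in_itv/= andbT => v0.
  by apply: cvg_EFin; [exact: nearW|exact: phi_cvg].
- near=> n; move=> v; rewrite /= in_itv/= andbT => v0.
  rewrite lee_fin ger0_norm ?phi_ge0//.
  apply: phi_bound => //.
  + by near: n; exact: nbhs_infty_gt.
  + by near: n.
  + by near: n; apply: k_lin; rewrite subr_gt0.
  + by near: n.
Unshelve. all: by end_near. Qed.

(** Restrict the integral to 1 <= v <= 2, where the exponent is at least 2 k mu - 6.
    This exponential growth in k mu is what dominates the sum over k. *)
Lemma Gam_ge e n k : 0 < e -> e <= e0 -> e <= T / 2 ->
  (forall y, 0 <= y <= e -> Psi T - Psi (T - y) <= 3 * dl / (4 * T) * y ^+ 2) ->
  (0 < n)%N -> (k <= n)%N -> 2 * lam n <= e ->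
  ((expR (2 * (k%:R * mu_ n) - 6))%:E <= Gam n k)%E.
Proof.
move=> ee0 ee1 eT He n0 kn le.
have n0' : 0 < n%:R :> R by rewrite ltr0n.
have l0 := lam_gt0 n0; have L := lam_sq n0; have m0 := mu_gt0 n0.
set a := expR _.
apply: (@le_trans _ _ (\int[leb]_(v in `[1%R, 2%R]) a%:E)%E).
  rewrite integral_cst//= lebesgue_measure_itv/= lte_fin ltr1n/= -EFinB -EFinM lee_fin.
  by rewrite (_ : 2 - 1 = 1) ?mulr1//; lra.
apply: (@le_trans _ _ (\int[leb]_(v in `[1%R, 2%R]) (phi n k v)%:E)%E).
  apply: ge0_le_integral => //.
  - by move=> x _; rewrite lee_fin expR_ge0.
  - by apply/measurable_EFinP; apply: measurable_funTS; exact: measurable_phi.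
  move=> v; rewrite /= in_itv/= => /andP[v1 v2]; rewrite lee_fin.
  have y0 : 0 <= lam n * v by rewrite mulr_ge0 ?(ltW l0)//; lra.
  have ye : lam n * v <= e.
    by rewrite (le_trans _ le)// mulrC ler_pM2r.
  rewrite /phi ifT; last by rewrite inE; apply: ann; lra.
  rewrite nwgtE//; last lra.
  rewrite ler_expR addrC lerD//.
    have H := He _ (introT andP (conj y0 ye)).
    rewrite -opprB mulrN lerN2.
    have : n%:R * (Psi T - Psi (T - lam n * v)) <= n%:R * (3 * dl / (4 * T) * (lam n * v) ^+ 2).
      by rewrite ler_wpM2l.
    move/le_trans; apply.
    rewrite (_ : n%:R * (3 * dl / (4 * T) * (lam n * v) ^+ 2) = 3 / 2 * v ^+ 2 * (n%:R * (dl / (2 * T)) * lam n ^+ 2)); last first.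
      by field; rewrite !gt_eqF.
    by rewrite L; nra.
  have yT2 : lam n * v <= T / 2 by lra.
  have /andP[b1 _] := ln_sub_bounds T0 y0 yT2.
  rewrite (@le_trans _ _ (k%:R * (lam n * v / T)))//; last by rewrite ler_wpM2l.
  rewrite (_ : k%:R * (lam n * v / T) = 2 * (k%:R * mu_ n) * v); last first.
    by rewrite /lam; field; rewrite !gt_eqF.
  by rewrite ler_peMr// mulr_ge0// mulr_ge0// ltW.
apply: ge0_subset_integral => //.
- by apply/measurable_EFinP; apply: measurable_funTS; exact: measurable_phi.
- by move=> x _; rewrite lee_fin phi_ge0.
- by move=> x /=; rewrite !in_itv/= andbT => /andP[x1 _]; lra.
Qed.

Definition edge_mass n k x : \bar R := (\int[leb]_(s in `](T - x)%R, T]) (nwgt n k s)%:E)%E.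

Variable Vlb : R.
Hypothesis VlbP : forall s, 0 < s <= T -> Vlb <= V s.

Lemma mass_lty n k (A : set R) : measurable A -> (forall s, A s -> 0 < s <= T) ->
  (\int[leb]_(s in A) (nwgt n k s)%:E < +oo)%E.
Proof.
move=> mA AT.
pose c := T ^+ (n - k) * expR (- (n%:R * Vlb)) / wgt n k T.
apply: (@le_lt_trans _ _ (\int[leb]_(s in `]0%R, T]) (fun=> c%:E) s)%E); last first.
  rewrite integral_cst//= lebesgue_measure_itv/= lte_fin T0 -EFinB -EFinM ltry//.
have c0 : 0 <= c by rewrite divr_ge0// ?mulr_ge0 ?expR_ge0// ?exprn_ge0 ?ltW// wgtT_gt0.
apply: (@le_trans _ _ (\int[leb]_(s in A) (fun=> c%:E) s)%E).
  apply: ge0_le_integral => //.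
  - by move=> s /AT /andP[/ltW s0 _]; rewrite lee_fin nwgt_ge0.
  - by apply/measurable_EFinP; apply: measurable_funTS; exact: measurable_nwgt.
  move=> s As; have /andP[s0 sT] := AT _ As.
  rewrite lee_fin /nwgt /c ler_pM2r ?invr_gt0 ?wgtT_gt0//.
  rewrite ler_pM ?exprn_ge0 ?expR_ge0// ?(ltW s0)//.
    by rewrite lerXn2r ?nnegrE// ltW.
  by rewrite ler_expR lerN2 ler_wpM2l// VlbP// s0.
by apply: ge0_subset_integral => // s /AT; rewrite /= in_itv.
Qed.

Lemma Gam_ge0 n k : (0 <= Gam n k)%E.
Proof. by apply: integral_ge0 => v _; rewrite lee_fin phi_ge0. Qed.

Lemma Gam_fin n k : (0 < n)%N -> Gam n k \is a fin_num.
Proof.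
move=> n0; rewrite ge0_fin_numE ?Gam_ge0//.
have := mass_lty n k mS Ssub; rewrite mass_Gam//.
move: (Gam n k) (Gam_ge0 n k) => [r| |]//=; rewrite ?ltry// => _.
by rewrite gt0_muley ?lte_fin ?lam_gt0.
Qed.

(** On ]T - x, T] the factor from Psi is at most 1 and the one from the logarithm at
    most e^(2kx/T). *)
Lemma edge_mass_le n k x : 0 <= x <= T / 2 -> (k <= n)%N ->
  (edge_mass n k x <= (x * expR (2 * k%:R * x / T))%:E)%E.
Proof.
move=> /andP[x0 xT] kn.
apply: (@le_trans _ _ (\int[leb]_(v in `](T - x)%R, T]) (expR (2 * k%:R * x / T))%:E)%E).
  apply: ge0_le_integral => //.
  - by move=> s /=; rewrite in_itv/= => /andP[s0 _]; rewrite lee_fin nwgt_ge0//; lra.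
  - by apply/measurable_EFinP; apply: measurable_funTS; exact: measurable_nwgt.
  move=> s; rewrite /= in_itv/= => /andP[s1 s2]; rewrite lee_fin.
  have s0 : 0 < s by lra.
  rewrite nwgtE// ler_expR -[leRHS]add0r lerD//.
    by rewrite mulr_ge0_le0// subr_le0 Psi_le.
  have y0 : 0 <= T - s by lra.
  have yT : T - s <= T / 2 by lra.
  have /andP[_] := ln_sub_bounds T0 y0 yT.
  rewrite (_ : T - (T - s) = s); last by lra.
  move=> b2.
  rewrite -!mulrA mulrCA ler_wpM2l// (le_trans b2)// mulrA ler_pM2r ?invr_gt0//.
  by rewrite ler_pM2l//; lra.
rewrite integral_cst//= lebesgue_measure_itv/= lte_fin -EFinD opprB addrCA subrr addr0.
case: ifPn => [_|_]; first by rewrite -EFinM mulrC.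
by rewrite mule0 lee_fin mulr_ge0// expR_ge0.
Qed.

(** On the same interval the logarithmic factor is at least 1. *)
Lemma edge_mass_ge e n k x : 0 < e -> e <= e0 -> e <= T / 2 ->
  (forall y, 0 <= y <= e -> Psi T - Psi (T - y) <= 3 * dl / (4 * T) * y ^+ 2) ->
  0 <= x <= e -> (k <= n)%N ->
  ((x * expR (- (n%:R * (3 * dl / (4 * T) * x ^+ 2))))%:E <= edge_mass n k x)%E.
Proof.
move=> ee0 ee1 eT He /andP[x0 xe] kn.
set a := expR _.
apply: (@le_trans _ _ (\int[leb]_(v in `](T - x)%R, T]) a%:E)%E).
  rewrite integral_cst//= lebesgue_measure_itv/= lte_fin -EFinD opprB addrCA subrr addr0.
  case: ifPn => [_|]; first by rewrite -EFinM mulrC.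
  rewrite -leNgt => xx; have -> : x = 0 by lra.
  by rewrite mul0r mule0.
apply: ge0_le_integral => //.
- by move=> s _; rewrite lee_fin expR_ge0.
- by apply/measurable_EFinP; apply: measurable_funTS; exact: measurable_nwgt.
move=> s; rewrite /= in_itv/= => /andP[s1 s2]; rewrite lee_fin.
have s0 : 0 < s by lra.
rewrite nwgtE// ler_expR -[leLHS]addr0 lerD//; last first.
  by rewrite mulr_ge0// subr_ge0 ler_ln ?posrE.
have y0 : 0 <= T - s <= e by lra.
have := He _ y0; rewrite (_ : T - (T - s) = s); last by lra.
move=> H.
rewrite -opprB mulrN lerN2 ler_wpM2l// (le_trans H)// ler_wpM2l//.
  by rewrite divr_ge0// mulr_ge0// ltW.
by rewrite lerXn2r ?nnegrE//; lra.
Qed.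

Lemma edge_mass_ge0 n k x : x <= T -> (0 <= edge_mass n k x)%E.
Proof.
move=> xT; apply: integral_ge0 => s; rewrite /= in_itv/= => /andP[s0 _].
by rewrite lee_fin nwgt_ge0//; lra.
Qed.

(** By mass_Gam the denominator is the total mass, so this is the fraction of it within
    x of the edge. *)
Definition edge_fraction n k x := fine (edge_mass n k x) / (lam n * fine (Gam n k)).

Lemma mass_split n k x : 0 <= x <= e0 -> x <= T / 2 ->
  (\int[leb]_(s in S') (nwgt n k s)%:E =
   \int[leb]_(s in S' `&` [set s | (s <= T - x)%R]) (nwgt n k s)%:E + edge_mass n k x)%E.
Proof.
move=> /andP[x0 xe] xT.
have mle : measurable [set s : R | s <= T - x].
  rewrite (_ : [set s : R | _] = `]-oo, (T - x)]%classic); first exact: measurable_itv.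
  by apply/seteqP; split => s /=; rewrite in_itv.
have SE : S' = (S' `&` [set s | s <= T - x]) `|` `](T - x), T].
  apply/seteqP; split => s /=.
    move=> Ss; have /andP[_ sT] := Ssub Ss; rewrite in_itv/= sT andbT.
    by have [h1|h1] := leP s (T - x); [left|right].
  case=> [[]//|]; rewrite in_itv/= => /andP[s1 s2]; apply: ann; lra.
rewrite {1}SE ge0_integral_setU//.
- exact: measurableI.
- by apply/measurable_EFinP; apply: measurable_funTS; exact: measurable_nwgt.
- move=> s /=; rewrite in_itv/= => sS; rewrite lee_fin nwgt_ge0//.
  by case: sS => [[/Ssub/andP[]/ltW]//|/andP[s1 _]]; lra.
- apply/disj_setPRL => s /=; rewrite in_itv/= => /andP[s1 _] [_].
  by rewrite leNgt s1.
Qed.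

Lemma mass_gt0 n k : (k <= n)%N -> (0 < \int[leb]_(s in S') (nwgt n k s)%:E)%E.
Proof.
move=> kn; have [e [ee0 ee1 eT He]] := edge_radius.
rewrite (mass_split n k (introT andP (conj (ltW ee0) ee1)) eT).
rewrite -[ltLHS]add0e lee_ltD//.
  by apply: integral_ge0 => s [/Ssub/andP[/ltW s0 _] _]; rewrite lee_fin nwgt_ge0.
apply: lt_le_trans (edge_mass_ge ee0 ee1 eT _ (introT andP (conj (ltW ee0) (lexx e))) kn).
  by rewrite lte_fin mulr_gt0 ?expR_gt0.
by move=> y /He/andP[].
Qed.

Lemma mass_fin n k : (\int[leb]_(s in S') (nwgt n k s)%:E)%E \is a fin_num.
Proof.
rewrite ge0_fin_numE; first exact: mass_lty.
by apply: integral_ge0 => s /Ssub/andP[/ltW s0 _]; rewrite lee_fin nwgt_ge0.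
Qed.

(** In this form the gap probability factors through 1 - edge_fraction. *)
Lemma mass_ratio n k x : (0 < n)%N -> (k <= n)%N -> 0 <= x <= e0 -> x <= T / 2 ->
  (\int[leb]_(s in S' `&` [set s | (s <= T - x)%R]) (nwgt n k s)%:E =
   ((1 - edge_fraction n k x) * fine (\int[leb]_(s in S') (nwgt n k s)%:E))%:E)%E.
Proof.
move=> n0 kn xe xT; have M0 := mass_gt0 kn; have Mf := mass_fin n k.
have Gf := Gam_fin k n0.
have Ef : edge_mass n k x \is a fin_num.
  have /andP[x0 _] := xe; have xT2 : 0 <= x <= T / 2 by rewrite x0.
  rewrite ge0_fin_numE ?(le_lt_trans (edge_mass_le xT2 kn)) ?ltry//.
  by apply: edge_mass_ge0; have := T0; lra.
have lG : lam n * fine (Gam n k) = fine (\int[leb]_(s in S') (nwgt n k s)%:E)%E.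
  by rewrite mass_Gam// fineM.
have MS := mass_split n k xe xT.
rewrite /edge_fraction lG mulrBl mul1r mulfVK; last by rewrite gt_eqF// fine_gt0// M0 ltey_eq Mf.
rewrite EFinB !fineK// MS addeK//.
Qed.

Variables (x_ : nat -> R) (alpha : R).
Hypothesis x_ge0 : forall n, 0 <= x_ n.
Hypothesis x_cvg : n%:R * x_ n @[n --> \oo] --> alpha.

Lemma invn_mu n : (0 < n)%N -> n%:R^-1 = 2 * T * dl * mu_ n ^+ 2.
Proof.
move=> n0; have n0' : 0 < n%:R :> R by rewrite ltr0n.
have m0 := mu_gt0 n0; have ms := mu_sq n0.
have TD : 2 * T * dl != 0 by rewrite gt_eqF// !mulr_gt0.
apply: (mulfI (lt0r_neq0 n0')); rewrite mulfV ?gt_eqF//.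
by rewrite mulrCA ms mulfV.
Qed.

Lemma lam_mu n : (0 < n)%N -> n%:R * (lam n * mu_ n) = dl^-1.
Proof.
move=> n0; have ms := mu_sq n0.
rewrite (_ : _ * _ = 2 * T * (n%:R * mu_ n ^+ 2)); last by rewrite /lam; ring.
by rewrite ms; field; rewrite !gt_eqF.
Qed.

Lemma x_cvg0 : x_ n @[n --> \oo] --> (0 : R).
Proof.
have : n%:R * x_ n * (2 * T * dl * (mu_ n * mu_ n)) @[n --> \oo] --> alpha * (2 * T * dl * (0 * 0)).
  apply: cvgM => //; apply: cvgM; first exact: cvg_cst.
  by apply: cvgM; exact: mu_cvg0.
rewrite !mulr0; apply: cvg_trans; apply: near_eq_cvg; near=> n.
have n0 : (0 < n)%N by near: n; exact: nbhs_infty_gt.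
rewrite -expr2 -invn_mu// mulrC mulKf// pnatr_eq0 -lt0n//.
Unshelve. all: by end_near. Qed.

Lemma x_near e : 0 < e -> \forall n \near \oo, x_ n <= e.
Proof.
move=> ee0; have /cvgrPdist_le/(_ _ ee0) := x_cvg0.
by apply: filterS => n; rewrite sub0r normrN ger0_norm.
Qed.

Lemma alpha_ge0 : 0 <= alpha.
Proof.
rewrite leNgt; apply/negP => a0.
have : 0 < - alpha / 2 by lra.
move=> a2; have /cvgrPdist_le/(_ _ a2) := x_cvg.
move=> [N _ /(_ N (leqnn N))]/=; rewrite ler_distl => /andP[H _].
have p0 : 0 <= N%:R * x_ N by rewrite mulr_ge0.
lra.
Qed.

Lemma edge_fraction_ge0 n k x : x <= T -> 0 <= edge_fraction n k x.
Proof.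
move=> xT; rewrite divr_ge0 ?fine_ge0 ?edge_mass_ge0// mulr_ge0 ?fine_ge0 ?Gam_ge0//.
by rewrite /lam mulr_ge0 ?invr_ge0 ?sqrtr_ge0// mulr_ge0// ltW.
Qed.

Definition edge_fraction_const := (alpha + 1) * dl * expR (2 * (alpha + 1) / T) * expR 6.

(** The numerator is of order x_n and the denominator at least lam e^(2 k mu - 6). The
    bound is both a domination for the sum and a uniform smallness for the product. *)
Lemma edge_fraction_bound : \forall n \near \oo, forall k, (k <= n)%N ->
  edge_fraction n k (x_ n) <= mu_ n * (edge_fraction_const * expR (- (2 * (k%:R * mu_ n)))).
Proof.
have [e [ee0 ee1 eT He]] := edge_radius.
have He' y : 0 <= y <= e -> Psi T - Psi (T - y) <= 3 * dl / (4 * T) * y ^+ 2.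
  by move=> /He/andP[].
have le_near : \forall n \near \oo, 2 * lam n <= e.
  near=> n.
  have : mu_ n < e / (4 * T) by near: n; apply: mu_near; rewrite divr_gt0// mulr_gt0.
  rewrite ltr_pdivlMr ?mulr_gt0// /lam => H; rewrite ltW// (le_lt_trans _ H)//.
  by rewrite le_eqVlt; apply/orP; left; apply/eqP; ring.
have nx : \forall n \near \oo, n%:R * x_ n <= alpha + 1.
  have /cvgrPdist_le/(_ _ ltr01) := x_cvg.
  by apply: filterS => n; rewrite ler_distl => /andP[]; lra.
near=> n => k kn.
have n0 : (0 < n)%N by near: n; exact: nbhs_infty_gt.
have l0 := lam_gt0 n0; have m0 := mu_gt0 n0; have lm := lam_mu n0.
have le2 : 2 * lam n <= e by near: n.
have nx1 : n%:R * x_ n <= alpha + 1 by near: n.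
have xT : x_ n <= T / 2 by near: n; apply: x_near; rewrite divr_gt0.
have x0 := x_ge0 n.
have n0' : 0 < n%:R :> R by rewrite ltr0n.
have G1 := Gam_ge ee0 ee1 eT He' n0 kn le2.
have Gf := Gam_fin k n0.
have E1 : fine (edge_mass n k (x_ n)) <= x_ n * expR (2 * (alpha + 1) / T).
  have H := edge_mass_le (introT andP (conj x0 xT)) kn.
  have Ef : edge_mass n k (x_ n) \is a fin_num.
    rewrite ge0_fin_numE ?(le_lt_trans H) ?ltry//.
    by apply: edge_mass_ge0; lra.
  rewrite -lee_fin fineK// (le_trans H)// lee_fin ler_wpM2l// ler_expR.
  rewrite ler_pM2r ?invr_gt0// -mulrA ler_wpM2l//.
  by rewrite (le_trans _ nx1)// ler_wpM2r// ler_nat.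
have G2 : expR (2 * (k%:R * mu_ n) - 6) <= fine (Gam n k).
  by rewrite -lee_fin fineK.
rewrite /edge_fraction ler_pdivrMr; last first.
  by rewrite mulr_gt0// (lt_le_trans _ G2)// expR_gt0.
apply: (le_trans E1).
have -> : mu_ n * (edge_fraction_const * expR (- (2 * (k%:R * mu_ n)))) * (lam n * fine (Gam n k)) =
  (lam n * mu_ n * dl * (alpha + 1) * expR (2 * (alpha + 1) / T)) *
   (expR 6 * expR (- (2 * (k%:R * mu_ n))) * fine (Gam n k)).
  by rewrite /edge_fraction_const; ring.
have -> : lam n * mu_ n * dl = n%:R^-1.
  apply: (mulfI (lt0r_neq0 n0')); rewrite mulfV ?gt_eqF// mulrA lm mulVf// gt_eqF//.
rewrite -[leLHS]mulr1 ler_pM//.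
- by rewrite mulr_ge0// expR_ge0.
- rewrite ler_pM2r ?expR_gt0// mulrC ler_pdivlMr// mulrC//.
- rewrite -expRD -ler_pdivrMl ?expR_gt0// mulr1 -expRN opprD opprK addrC//.
Unshelve. all: by end_near. Qed.

(** Its integral is the sum of the fractions: the sum becomes an integral to which
    dominated convergence applies. *)
Definition step n t : R := \sum_(k < n)
  \1_(`[k%:R * mu_ n, k.+1%:R * mu_ n[%classic : set R) t * (edge_fraction n k.+1 (x_ n) / mu_ n).

Lemma stepE n t : (0 < n)%N -> 0 <= t ->
  let K := Num.trunc (t / mu_ n) in
  step n t = if (K < n)%N then edge_fraction n K.+1 (x_ n) / mu_ n else 0.
Proof.
move=> n0 t0 K; have m0 := mu_gt0 n0.
have tm : 0 <= t / mu_ n by rewrite divr_ge0// ltW.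
have /andP[K1 K2] := truncn_itv tm.
have ind (k : nat) : (t \in `[k%:R * mu_ n, k.+1%:R * mu_ n[%classic) = (k == K).
  apply/idP/idP.
    rewrite inE/= in_itv/= -ler_pdivlMr// -ltr_pdivrMr// => /andP[k1 k2].
    rewrite eqn_leq; apply/andP; split.
      by rewrite -ltnS -(ltr_nat R) (le_lt_trans k1).
    by rewrite -ltnS -(ltr_nat R) (le_lt_trans K1).
  move=> /eqP ->; rewrite inE/= in_itv/= -ler_pdivlMr// -ltr_pdivrMr//.
  by rewrite K1 K2.
rewrite /step; case: ifPn => Kn.
  rewrite (bigD1 (Ordinal Kn))//= big1 ?addr0.
    by rewrite indicE ind eqxx mul1r.
  move=> k; rewrite -val_eqE/= => kK.
  by rewrite indicE ind (negbTE kK) mul0r.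
rewrite big1// => k _; rewrite indicE ind; case: eqP => [kK|]; last by rewrite mul0r.
by move: Kn; rewrite -kK ltn_ord.
Qed.

Lemma measurable_step n : measurable_fun [set: R] (step n).
Proof.
by apply: measurable_sum => k; apply: measurable_funM.
Qed.

Lemma integral_step n : (0 < n)%N -> x_ n <= T ->
  (\int[leb]_(t in `[0%R, +oo[) (step n t)%:E = (\sum_(k < n) edge_fraction n k.+1 (x_ n))%:E)%E.
Proof.
move=> n0 xT; have m0 := mu_gt0 n0.
have mi (k : 'I_n) : measurable_fun [set: R]
    (\1_(`[k%:R * mu_ n, k.+1%:R * mu_ n[%classic : set R) : R -> R).
  by apply: measurable_indic; exact: measurable_itv.
under eq_integral do rewrite /step -sumEFin.
rewrite ge0_integral_sum//; last 2 first.
- by move=> k; apply: measurable_funTS; apply/measurable_EFinP; apply: measurable_funM.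
- move=> k t _; rewrite lee_fin mulr_ge0// divr_ge0 ?edge_fraction_ge0// ltW//.
rewrite -sumEFin; apply: eq_bigr => k _.
under eq_integral do rewrite EFinM muleC.
rewrite ge0_integralZl//; last 2 first.
- by apply: measurable_funTS; apply/measurable_EFinP.
- by rewrite lee_fin divr_ge0 ?edge_fraction_ge0// ltW.
rewrite integral_indic//.
rewrite setIidl; last first.
  move=> t /=; rewrite !in_itv/= andbT => /andP[+ _].
  by apply: le_trans; rewrite mulr_ge0// ltW.
rewrite [X in (_ * X)%E](lebesgue_measure_itv `[k%:R * mu_ n, k.+1%:R * mu_ n[).
rewrite /= lte_fin ltr_pM2r// ltr_nat ltnSn.
rewrite -EFinB -EFinM; congr EFin.
rewrite -natr1; field; by rewrite gt_eqF.
Qed.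

(** On the cell containing t the index satisfies k mu -> t, so the denominator converges
    by Gam_cvg, while n times the numerator tends to alpha because the density is close
    to 1 within O(1/n) of the edge. *)
Lemma step_cvg t : 0 <= t ->
  step n t @[n --> \oo] --> alpha * dl * (expR (t ^+ 2) * Phi t)^-1.
Proof.
move=> t0.
have [e [ee0 ee1 eT He]] := edge_radius.
have He' y : 0 <= y <= e -> Psi T - Psi (T - y) <= 3 * dl / (4 * T) * y ^+ 2.
  by move=> /He/andP[].
(* The cell containing t, shifted by one because the product runs over k from 1 to n. *)
pose K n := (Num.trunc (t / mu_ n)).+1.
have Kt : (K n)%:R * mu_ n @[n --> \oo] --> t.
  apply: (@squeeze_cvgr _ _ _ _ (fun n => t) (fun n => t + mu_ n)).
  - near=> n.
    have n0 : (0 < n)%N by near: n; exact: nbhs_infty_gt.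
    have m0 := mu_gt0 n0.
    have tm : 0 <= t / mu_ n by rewrite divr_ge0// ltW.
    have /andP[K1 K2] := truncn_itv tm.
    rewrite -ler_pdivrMr// ltW//= /K -natr1 mulrDl mul1r lerD2r -ler_pdivlMr//.
  - exact: cvg_cst.
  - rewrite -[X in _ --> X]addr0; apply: cvgD; [exact: cvg_cst|exact: mu_cvg0].
have Kn : \forall n \near \oo, (K n <= n)%N.
  have TD : 0 < 2 * T * dl * (t + 1) by rewrite !mulr_gt0//; lra.
  near=> n.
  have n0 : (0 < n)%N by near: n; exact: nbhs_infty_gt.
  have n0' : 0 < n%:R :> R by rewrite ltr0n.
  have m0 := mu_gt0 n0; have ms := mu_sq n0.
  have tm : 0 <= t / mu_ n by rewrite divr_ge0// ltW.
  have /andP[K1 _] := truncn_itv tm.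
  rewrite /K -(ltr_nat R) (le_lt_trans K1)// ltr_pdivrMr//.
  have : mu_ n < (2 * T * dl * (t + 1))^-1 by near: n; apply: mu_near; rewrite invr_gt0.
  rewrite -(@ltr_pM2r _ (2 * T * dl * (t + 1)))// mulVf ?gt_eqF// => H.
  have : n%:R * mu_ n * (mu_ n * (2 * T * dl * (t + 1))) < n%:R * mu_ n * 1.
    by rewrite ltr_pM2l// mulr_gt0.
  rewrite (_ : _ * (mu_ n * _) = n%:R * mu_ n ^+ 2 * (2 * T * dl) * (t + 1)); last by ring.
  rewrite ms mulVf; last by rewrite gt_eqF// !mulr_gt0.
  by rewrite mul1r mulr1; lra.
have cG : fine (Gam n (K n)) @[n --> \oo] --> expR (t ^+ 2) * Phi t.
  exact: fine_cvg (Gam_cvg t0 Kt).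
have cE : n%:R * fine (edge_mass n (K n) (x_ n)) @[n --> \oo] --> alpha.
  apply: (@squeeze_cvgr _ _ _ _
    (fun n => n%:R * x_ n * expR (- (3 * dl / (4 * T) * (n%:R * x_ n * x_ n))))
    (fun n => n%:R * x_ n * expR (4 * dl * (((K n)%:R * mu_ n) * (n%:R * x_ n) * mu_ n)))).
  - near=> n.
    have n0 : (0 < n)%N by near: n; exact: nbhs_infty_gt.
    have n0' : 0 < n%:R :> R by rewrite ltr0n.
    have m0 := mu_gt0 n0.
    have x0 := x_ge0 n.
    have xe : x_ n <= e by near: n; apply: x_near.
    have Kn' : (K n <= n)%N by near: n.
    have xT : x_ n <= T / 2 by lra.
    have L1 := edge_mass_ge ee0 ee1 eT He' (introT andP (conj x0 xe)) Kn'.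
    have L2 := edge_mass_le (introT andP (conj x0 xT)) Kn'.
    have Ef : edge_mass n (K n) (x_ n) \is a fin_num.
      rewrite ge0_fin_numE ?(le_lt_trans L2) ?ltry//.
      by apply: edge_mass_ge0; lra.
    rewrite -!mulrA !ler_pM2l// -!lee_fin fineK//; apply/andP; split.
      apply: le_trans L1; rewrite lee_fin le_eqVlt; apply/orP; left; apply/eqP.
      by congr (_ * expR _); ring.
    apply: (le_trans L2); rewrite lee_fin le_eqVlt; apply/orP; left; apply/eqP.
    congr (_ * expR _).
    rewrite (_ : 4 * _ = 2 * (K n)%:R * x_ n * (n%:R * (2 * T * dl * mu_ n ^+ 2)) / T); last first.
      by field; rewrite gt_eqF.
    by rewrite -invn_mu// mulfV ?gt_eqF// mulr1.
  - rewrite -[X in _ --> X]mulr1; apply: cvgM => //.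
    rewrite -[X in _ --> X](@expR0 R); apply: continuous_cvg; first exact: continuous_expR.
    rewrite -oppr0 -(mulr0 (3 * dl / (4 * T))); apply: cvgN; apply: cvgM; first exact: cvg_cst.
    by rewrite -(mulr0 alpha); apply: cvgM => //; exact: x_cvg0.
  - rewrite -[X in _ --> X]mulr1; apply: cvgM => //.
    rewrite -[X in _ --> X](@expR0 R); apply: continuous_cvg; first exact: continuous_expR.
    rewrite -(mulr0 (4 * dl)); apply: cvgM; first exact: cvg_cst.
    rewrite -(mulr0 (t * alpha)); apply: cvgM; last exact: mu_cvg0.
    exact: cvgM.
have G0 : 0 < expR (t ^+ 2) * Phi t by rewrite mulr_gt0 ?expR_gt0 ?Phi_gt0.
have : n%:R * fine (edge_mass n (K n) (x_ n)) * dl * (fine (Gam n (K n)))^-1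
    @[n --> \oo] --> alpha * dl * (expR (t ^+ 2) * Phi t)^-1.
  apply: cvgM; last by apply: cvgV => //; rewrite gt_eqF.
  by apply: cvgM => //; exact: cvg_cst.
apply: cvg_trans; apply: near_eq_cvg; near=> n.
have n0 : (0 < n)%N by near: n; exact: nbhs_infty_gt.
have n0' : 0 < n%:R :> R by rewrite ltr0n.
have Kn' : (K n <= n)%N by near: n.
have m0 := mu_gt0 n0; have l0 := lam_gt0 n0; have lm := lam_mu n0.
rewrite stepE//= Kn' /edge_fraction -/(K n).
rewrite -[dl]invrK -lm !invfM.
move: (fine (edge_mass _ _ _)) => E; move: (fine (Gam _ _))^-1 => G.
by field; rewrite !gt_eqF.
Unshelve. all: by end_near. Qed.

Lemma measurable_inv_half_gauss :
  measurable_fun (`[0%R, +oo[%classic : set R) (fun t : R => (expR (t ^+ 2) * Phi t)^-1).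
Proof.
have mP : measurable_fun [set: R] (@Phi R).
  apply: continuous_measurable_fun => t.
  have d := is_derive_Phi t.
  by apply/differentiable_continuous/derivable1_diffP; exact: ex_derive.
have m1 : measurable_fun [set: R] (fun t : R => expR (- (t ^+ 2) - ln (Phi t))).
  mfun.
  by apply: (measurableT_comp _ mP); exact: measurable_ln.
apply: eq_measurable_fun (measurable_funTS m1) => t.
rewrite inE/= in_itv/= andbT => t0.
rewrite -opprD expRN expRD lnK ?posrE//; exact: Phi_gt0.
Qed.

(** Dominated convergence for the step functions. *)
Lemma sum_edge_fraction_cvg : \sum_(k < n) edge_fraction n k.+1 (x_ n) @[n --> \oo] --> alpha * dl * ln 2.
Proof.
have C0 : 0 <= edge_fraction_const.
  by rewrite /edge_fraction_const !mulr_ge0 ?expR_ge0// ?(ltW dl0)// addr_ge0// alpha_ge0.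
have nxT : \forall n \near \oo, x_ n <= T by exact: x_near.
have [] := @dominated_cvg_near _ _ _ leb `[0%R, +oo[%classic
  (fun n t => (step n t)%:E)
  (fun t => (alpha * dl * (expR (t ^+ 2) * Phi t)^-1)%:E)
  (fun t => (edge_fraction_const%:E * (expR (- (2 * t)))%:E)%E) (measurable_itv _).
- by move=> n; apply/measurable_EFinP; apply: measurable_funTS; exact: measurable_step.
- move=> t; rewrite /= in_itv/= andbT => t0.
  by apply: cvg_EFin; [exact: nearW|exact: step_cvg].
- by apply: integrableZl => //; exact: integrable_expN.
- near=> n; move=> t; rewrite /= in_itv/= andbT => t0.
  have n0 : (0 < n)%N by near: n; exact: nbhs_infty_gt.
  have m0 := mu_gt0 n0.
  have xT : x_ n <= T by near: n.
  have tm : 0 <= t / mu_ n by rewrite divr_ge0// ltW.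
  have /andP[K1 K2] := truncn_itv tm.
  rewrite -EFinM lee_fin stepE//=; case: ifPn => Kn; last first.
    by rewrite normr0 mulr_ge0// expR_ge0.
  rewrite ger0_norm; last by rewrite divr_ge0 ?edge_fraction_ge0// ltW.
  rewrite ler_pdivrMr//.
  have H : forall k, (k <= n)%N ->
    edge_fraction n k (x_ n) <= mu_ n * (edge_fraction_const * expR (- (2 * (k%:R * mu_ n)))).
    by near: n; exact: edge_fraction_bound.
  rewrite (le_trans (H _ Kn))// mulrC ler_pM2r// ler_wpM2l// ler_expR lerN2 ler_pM2l//.
  by rewrite -ler_pdivrMr// ltW.
move=> _.
under [X in _ --> X -> _]eq_integral => t _ do rewrite EFinM.
rewrite ge0_integralZl//; last 3 first.
- apply/measurable_EFinP; exact: measurable_inv_half_gauss.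
- move=> t; rewrite /= in_itv/= andbT => t0.
  by rewrite lee_fin invr_ge0 mulr_ge0 ?expR_ge0// ltW// Phi_gt0.
- by rewrite lee_fin mulr_ge0 ?alpha_ge0// ltW.
rewrite integral_inv_half_gauss -EFinM => H.
have : (\sum_(k < n) edge_fraction n k.+1 (x_ n))%:E @[n --> \oo] --> (alpha * dl * ln 2)%:E.
  apply: cvg_trans H; apply: near_eq_cvg; near=> n.
  rewrite integral_step//; first by near: n; exact: nbhs_infty_gt.
  by near: n.
by move/fine_cvg.
Unshelve. all: by end_near. Qed.

(** Squeeze with e^(-p/(1-p)) <= 1 - p <= e^(-p), all the fractions being uniformly
    small. *)
Lemma prod_edge_fraction_cvg : \prod_(k < n) (1 - edge_fraction n k.+1 (x_ n)) @[n --> \oo] -->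
  expR (- (alpha * dl * ln 2)).
Proof.
have C0 : 0 <= edge_fraction_const.
  by rewrite /edge_fraction_const !mulr_ge0 ?expR_ge0// ?(ltW dl0)// addr_ge0// alpha_ge0.
have c1 : edge_fraction_const * mu_ n @[n --> \oo] --> (0 : R).
  by rewrite -(mulr0 edge_fraction_const); apply: cvgM; [exact: cvg_cst|exact: mu_cvg0].
have half_near : \forall n \near \oo, edge_fraction_const * mu_ n <= 2^-1.
  have h2 : 0 < 2^-1 :> R by rewrite invr_gt0.
  have /cvgrPdist_le/(_ _ h2) := c1.
  by apply: filterS => n; rewrite sub0r normrN => /(le_trans (ler_norm _)).
apply: (@squeeze_cvgr _ _ _ _
  (fun n => expR (- ((\sum_(k < n) edge_fraction n k.+1 (x_ n)) * (1 - edge_fraction_const * mu_ n)^-1)))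
  (fun n => expR (- \sum_(k < n) edge_fraction n k.+1 (x_ n)))).
- near=> n.
  have n0 : (0 < n)%N by near: n; exact: nbhs_infty_gt.
  have m0 := mu_gt0 n0.
  have xT : x_ n <= T by near: n; exact: x_near.
  have Cm : edge_fraction_const * mu_ n <= 2^-1 by near: n.
  have H : forall k, (k <= n)%N ->
    edge_fraction n k (x_ n) <= mu_ n * (edge_fraction_const * expR (- (2 * (k%:R * mu_ n)))).
    by near: n; exact: edge_fraction_bound.
  have p1 (k : 'I_n) : edge_fraction n k.+1 (x_ n) <= edge_fraction_const * mu_ n.
    rewrite (le_trans (H _ (ltn_ord k)))// mulrC ler_pM2r// ler_piMr//.
    by rewrite -expR0 ler_expR oppr_le0 !mulr_ge0// ltW.
  have p0 (k : 'I_n) : 0 <= edge_fraction n k.+1 (x_ n) by apply: edge_fraction_ge0.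
  rewrite mulr_suml -!sumrN !expR_sum; apply/andP; split; apply: ler_prod => k _.
    rewrite expR_ge0/=.
    have q0 : 0 < 1 - edge_fraction n k.+1 (x_ n) by have := p1 k; lra.
    rewrite -[leRHS]lnK ?posrE// ler_expR.
    rewrite -[ln _]opprK -lnV ?posrE// lerN2 (le_trans (ln_le_sub1 _)) ?invr_gt0//.
    rewrite (_ : _ - 1 = edge_fraction n k.+1 (x_ n) / (1 - edge_fraction n k.+1 (x_ n))); last by field; rewrite gt_eqF.
    rewrite ler_wpM2l// lef_pV2 ?posrE//; last lra.
    by rewrite lerD2l lerN2.
  rewrite subr_ge0 (le_trans (p1 k))/=; last lra.
  by rewrite (le_trans _ (expR_ge1Dx _))// .
- apply: continuous_cvg; first exact: continuous_expR.
  apply: cvgN; rewrite -[X in _ --> X]mulr1; apply: cvgM; first exact: sum_edge_fraction_cvg.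
  rewrite -[X in _ --> X]invr1; apply: cvgV; first exact: oner_neq0.
  by rewrite -[X in _ --> X]subr0; apply: cvgB => //; exact: cvg_cst.
- apply: continuous_cvg; first exact: continuous_expR.
  apply: cvgN; exact: sum_edge_fraction_cvg.
Unshelve. all: by end_near. Qed.

End edge.

(** * Uniform convergence of distribution functions *)

Section monotone_uniform.
Variable R : realType.

(** Polya's argument: convergence on a finite grid controls monotone functions between
    grid points, the limit varying by at most the mesh. *)
Lemma uniform_expR (F : nat -> R -> R) (K : set R) :
  (forall n, {homo F n : x y / x <= y}) ->
  (forall x, x <= 0 -> F n x @[n --> \oo] --> expR x) ->
  compact K -> K `<=` [set x | x <= 0] ->
  {uniform K, F @ \oo --> @expR R}.
Proof.
move=> nd pw cK K0.
have [M [M0 HM]] : exists M, 0 < M /\ forall x, K x -> - M <= x.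
  have [M0 [_ HM]] := @compact_bounded R R^o K cK.
  exists (`|M0| + 1); split; first by rewrite ltr_wpDl.
  move=> x Kx; have : `|x| <= `|M0| + 1.
    by apply: HM => //; rewrite (le_lt_trans (ler_norm M0))// ltrDl.
  by rewrite ler_norml => /andP[].
have lip (x y : R) : x <= y -> y <= 0 -> expR y - expR x <= y - x.
  move=> xy y0.
  have -> : expR x = expR y * expR (x - y) by rewrite -expRD addrCA subrr addr0.
  have H1 := expR_ge1Dx (x - y).
  have e0 := expR_ge0 y; have e1 : expR y <= 1 by rewrite -expR0 ler_expR.
  rewrite -{1}(mulr1 (expR y)) -mulrBr.
  have H2 : 1 - expR (x - y) <= y - x by lra.
  apply: (le_trans (ler_wpM2l e0 H2)); rewrite ler_piMl//; lra.
move=> P /uniform_nbhs[E [entE sub]].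
have [e /= e0 He] : exists2 e : R, 0 < e & forall x y, `|x - y| < e -> E (x, y).
  move: entE; rewrite -entourage_ballE => -[e /= e0 He].
  by exists e => // x y xy; apply: He.
pose N := (Num.trunc (2 * M / e)).+1.
have N0 : 0 < N%:R :> R by rewrite ltr0n.
have MN : M / N%:R < e / 2.
  have Me : 0 <= 2 * M / e by rewrite divr_ge0 ?mulr_ge0 ?(ltW M0) ?(ltW e0).
  have /andP[_ H] := truncn_itv Me.
  rewrite ltr_pdivrMr//; rewrite ltr_pdivrMr// in H; rewrite -/N in H; lra.
pose a (i : nat) : R := - M + i%:R * (M / N%:R).
have aN : a N = 0 by rewrite /a mulrCA mulfV ?gt_eqF// mulr1 addNr.
have a0 (i : 'I_N.+1) : a i <= 0.
  rewrite -aN lerD2l ler_pM2r ?divr_gt0// ler_nat -ltnS//.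
have near_a : \forall n \near \oo, forall i : 'I_N.+1, `|expR (a i) - F n (a i)| < e / 2.
  apply: filter_forall => i; move: (i) => {}i.
  by have /cvgrPdist_lt := pw _ (a0 i); apply; rewrite divr_gt0.
apply: filterS near_a => n Hn; apply: sub => x Kx /=.
apply: He.
have x0 : x <= 0 := K0 _ Kx; have xM := HM _ Kx.
pose i := Num.trunc ((x + M) / (M / N%:R)).
have d0 : 0 < M / N%:R by rewrite divr_gt0.
have xd : 0 <= (x + M) / (M / N%:R) by rewrite divr_ge0 ?(ltW d0)//; lra.
have /andP[i1 i2] := truncn_itv xd; rewrite -/i in i1 i2.
have ax : a i <= x by rewrite /a -lerBrDl opprK -ler_pdivlMr.
have xa : x < a i.+1 by rewrite /a -ltrBDl opprK -ltr_pdivrMr.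
have step : a i.+1 - a i = M / N%:R by rewrite /a -natr1; ring.
have iN : (i <= N)%N.
  rewrite -(ler_nat R) (le_trans i1)// ler_pdivrMr// mulrCA mulfV ?gt_eqF// mulr1; lra.
have Hi := Hn (Ordinal (iN : (i < N.+1)%N)); rewrite /= ltr_norml in Hi.
have [iN1|iN1] := ltnP i N.
  have Hi1 := Hn (Ordinal (iN1 : (i.+1 < N.+1)%N)); rewrite /= ltr_norml in Hi1.
  have l1 := lip _ _ ax x0.
  have a10 : a i.+1 <= 0 by exact: (a0 (Ordinal (iN1 : (i.+1 < N.+1)%N))).
  have l2 := lip _ _ (ltW xa) a10.
  have n1 := nd n _ _ ax; have n2 := nd n _ _ (ltW xa).
  rewrite ltr_norml; lra.
have iE : i = N by apply/eqP; rewrite eqn_leq iN iN1.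
have xE : x = a i by apply/le_anti; rewrite ax iE aN x0.
rewrite xE ltr_norml; lra.
Qed.

End monotone_uniform.

(** * The gap probability as a product *)

Section gap_probability.
Variable R : realType.
Local Notation leb := (@lebesgue_measure R).
Local Notation R2 := (R * R)%type.
Local Notation pm n := (pmeas (@area R) n).
Variables (Q : R2 -> \bar R) (V : R -> R) (S : set R2) (T : R).
Hypothesis QV : forall z, Q z = (V (modsq z))%:E.
Hypothesis mV : measurable_fun [set: R] V.
Hypothesis clS : closed S.
Hypothesis radS : forall z w, modsq z = modsq w -> S z -> S w.
Hypothesis T0 : 0 < T.

(** The droplet in the variable |z|^2; the value 0 is left out so that logarithms make
    sense. *)
Definition sq_section : set R := [set s | 0 < s /\ S (Num.sqrt s, 0)].

Lemma measurable_sq_section : measurable sq_section.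
Proof.
have m1 : measurable_fun [set: R] (fun s : R => (Num.sqrt s, 0 : R)).
  by apply: measurable_fun_pair => //; exact: continuous_sqrt_measurable.
have := m1 measurableT _ (measurable_closed clS); rewrite setTI => m2.
rewrite (_ : sq_section = `]0, +oo[%classic `&` (fun s : R => (Num.sqrt s, 0 : R)) @^-1` S).
  by apply: measurableI => //; exact: measurable_itv.
by apply/seteqP; split => s /=; rewrite in_itv/= andbT.
Qed.

(** Truncating the weight rather than the domain of integration keeps the problem in the
    form treated by integral_vdm. *)
Definition weight n (D : set R) (z : R2) : R :=
  if z \in S `&` [set z | D (modsq z)] then expR (- (n%:R * V (modsq z))) else 0.

Lemma weight_ge0 n D z : 0 <= weight n D z.
Proof. by rewrite /weight; case: ifP => // _; exact: expR_ge0. Qed.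

Lemma measurable_weight n D : measurable D -> measurable_fun [set: R2] (weight n D).
Proof.
move=> mD.
have mV' := measurableT_comp mV (@measurable_modsq R).
have mA : measurable (S `&` [set z | D (modsq z)]).
  apply: measurableI; first exact: measurable_closed.
  by have := @measurable_modsq R measurableT _ mD; rewrite setTI.
have m1 : measurable_fun [set: R2] (fun z => expR (- (n%:R * V (modsq z)))) by mfun.
have := (measurable_restrictT _ mA).1 (measurable_funTS m1).
by apply: eq_measurable_fun => z _; rewrite /patch.
Qed.

Lemma weight_rot n D u z : modsq u = 1 -> weight n D (crot u z) = weight n D z.
Proof.
move=> u1; have E : modsq (crot u z) = modsq z by rewrite modsq_rot u1 mul1r.
rewrite /weight E; congr (if _ then _ else _).
apply/idP/idP => /set_mem[Sz /= Dz]; apply/mem_set; split => /=; rewrite ?E// -?E//.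
  by apply: radS Sz.
by apply: radS Sz.
Qed.

(** A point outside the droplet has infinite potential, hence factor 0. *)
Lemma gibbs_weightE n (t : n.-tuple R2) : (0 < n)%N ->
  gibbs_weight (localized Q S) t = ((vdm t)%:E * \prod_(j < n) (weight n setT (tnth t j))%:E)%E.
Proof.
move=> n0; rewrite /gibbs_weight -/(vdm t); congr (_ * _)%E.
have wE z : S z -> weight n setT z = expR (- (n%:R * V (modsq z))).
  by move=> Sz; rewrite /weight ifT//; apply/mem_set; split.
have lE z : S z -> localized Q S z = (V (modsq z))%:E.
  by move=> Sz; rewrite /localized ifT ?QV//; exact/mem_set.
have [/forallP H|] := boolP [forall j : 'I_n, tnth t j \in S].
  have H' j : S (tnth t j) by exact/set_mem/H.
  under eq_bigr do rewrite lE//.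
  under [in RHS]eq_bigr do rewrite wE//.
  rewrite sumEFin prodEFin -EFinM -EFinN /=; congr EFin.
  by rewrite mulr_sumr -sumrN expR_sum.
rewrite negb_forall => /existsP[j /negP Sj].
have Sj' : ~ S (tnth t j) by move=> /mem_set.
have -> : (\sum_(i < n) localized Q S (tnth t i) = +oo)%E.
  rewrite (bigD1 j)//= /localized memNset// addye//.
  rewrite gt_eqF//; elim/big_ind : _ => //.
    by move=> [x| |] [y| |] // _ _; exact: ltNyr.
  by move=> i _; case: ifP => // _; rewrite QV ltNyr.
rewrite gt0_muley ?lte_fin ?ltr0n//= (bigD1 j)//=.
by rewrite {1}/weight memNset ?mul0e// => -[].
Qed.

Definition moment n (D : set R) (j : nat) : \bar R :=
  (\int[@area R]_z ((modsq z ^+ j)%:E * (weight n D z)%:E))%E.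

Lemma integral_vdm_weight n D : measurable D ->
  (\int[pm n]_t ((vdm t)%:E * \prod_(j < n) (weight n D (tnth t j))%:E) =
   (n`!%:R)%:E * \prod_(j < n) moment n D j)%E.
Proof.
move=> mD; rewrite (integral_vdm n (w := fun z => (weight n D z)%:E))//.
- by apply/measurable_EFinP; exact: measurable_weight.
- by move=> z; rewrite lee_fin weight_ge0.
- by move=> u z u1; rewrite weight_rot.
Qed.

(** Pass to the variable s = |z|^2 and divide by the value of the density at T. *)
Lemma moment_radial n D k : measurable D -> (k <= n)%N ->
  moment n D (n - k) = ((disc_area R * wgt V n k T)%:E *
    \int[leb]_(s in sq_section `&` D) (nwgt V T n k s)%:E)%E.
Proof.
move=> mD kn.
pose A : set R := [set s | S (Num.sqrt s, 0)] `&` D.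
have mA : measurable A.
  apply: measurableI => //.
  have m1 : measurable_fun [set: R] (fun s : R => (Num.sqrt s, 0 : R)).
    by apply: measurable_fun_pair => //; exact: continuous_sqrt_measurable.
  by have := m1 measurableT _ (measurable_closed clS); rewrite setTI.
(* The absolute value keeps the integrand nonnegative on the whole line. *)
pose F (s : R) : \bar R := (if s \in A then `|s| ^+ (n - k) * expR (- (n%:R * V s)) else 0)%:E.
have F0 s : (0 <= F s)%E.
  by rewrite lee_fin; case: ifP => // _; rewrite mulr_ge0 ?expR_ge0 ?exprn_ge0.
have mF : measurable_fun [set: R] F.
  apply/measurable_EFinP.
  have m1 : measurable_fun [set: R] (fun s => `|s| ^+ (n - k) * expR (- (n%:R * V s))).
    by mfun; [exact: normr_measurable|exact: mV].
  have := (measurable_restrictT _ mA).1 (measurable_funTS m1).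
  by apply: eq_measurable_fun => z _; rewrite /patch.
have -> : moment n D (n - k) = (\int[@area R]_z F (modsq z))%E.
  apply: eq_integral => z _; rewrite -EFinM /F /weight (ger0_norm (modsq_ge0 z)).
  have sE : modsq (Num.sqrt (modsq z), 0 : R) = modsq z.
    by rewrite [LHS]/modsq/= expr0n/= addr0 sqr_sqrtr ?modsq_ge0.
  have -> : (z \in S `&` [set z | D (modsq z)]) = (modsq z \in A).
    apply/idP/idP => /set_mem[Sz /= Dz]; apply/mem_set; split => //=.
      by apply: radS Sz; rewrite sE.
    by apply: radS Sz; rewrite sE.
  by case: ifP => //; rewrite mulr0.
rewrite (ge0_integral_area_radial mF F0) -integral_itv_obnd_cbnd; last first.
  exact: measurable_funTS.
rewrite EFinM -muleA; congr (_ * _)%E.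
have w0 := wgtT_gt0 V T0 n k.
rewrite -ge0_integralZl//; first last.
- by rewrite lee_fin ltW.
- by move=> s [[/ltW s0 _] _]; rewrite lee_fin nwgt_ge0.
- by apply/measurable_EFinP; apply: measurable_funTS; exact: measurable_nwgt.
- by apply: measurableI => //; exact: measurable_sq_section.
rewrite [LHS]integral_mkcond [RHS]integral_mkcond; apply: eq_integral => s _.
rewrite /patch; have [s0|s0] := ltP 0 s; last first.
  rewrite !memNset//.
    by move=> [[]]; rewrite ltNge s0.
  by rewrite /= in_itv/= andbT ltNge s0.
rewrite (_ : s \in `]0, +oo[%classic = true); last first.
  by apply/mem_set; rewrite /= in_itv/= s0.
have -> : (s \in sq_section `&` D) = (s \in A).
  apply/idP/idP => /set_mem[]; first by move=> [_ Ss] Ds; apply/mem_set; split.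
  by move=> Ss Ds; apply/mem_set; split.
rewrite /F; case: ifP => // _.
rewrite (ger0_norm (ltW s0)) -/(wgt V n k s) -EFinM /nwgt; congr EFin.
by rewrite mulrCA mulfV ?mulr1// gt_eqF.
Qed.

Lemma measurable_tuple_set n (D : set R) : measurable D ->
  measurable [set t : n.-tuple R2 | forall j, D (modsq (tnth t j))].
Proof.
move=> mD.
rewrite (_ : [set t : n.-tuple R2 | forall j, D (modsq (tnth t j))] =
   \bigcap_(j in [set: 'I_n]) [set t | D (modsq (tnth t j))]); last first.
  by apply/seteqP; split => t /= H j; [move=> _; exact: H|exact: H].
apply: fin_bigcap_measurable => // j _.
have m1 : measurable_fun setT (fun t : n.-tuple R2 => modsq (tnth t j)).
  apply: (measurableT_comp (@measurable_modsq R)); exact: measurable_tnth.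
by have := m1 measurableT _ mD; rewrite setTI.
Qed.

(** The indicator of the event is a product over the points and is absorbed into the
    weights. *)
Lemma integral_gibbs_weight n D : (0 < n)%N -> measurable D ->
  (\int[power_measure (@area R) n]_(t in [set t : n.-tuple R2 | forall j, D (modsq (tnth t j))])
     gibbs_weight (localized Q S) t = (n`!%:R)%:E * \prod_(j < n) moment n D j)%E.
Proof.
move=> n0 mD; rewrite -(integral_vdm_weight n mD) -(pmeasE (@area R) n) integral_mkcond.
apply: eq_integral => t _; rewrite /patch.
case: ifPn => [/set_mem H|/negP H].
  rewrite gibbs_weightE//; congr (_ * _)%E; apply: eq_bigr => j _; congr EFin.
  rewrite /weight; congr (if _ then _ else _).
  apply/idP/idP => /set_mem[Sz _]; apply/mem_set; split => //=; exact: H.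
have [j Hj] : exists j : 'I_n, ~ D (modsq (tnth t j)).
  by apply/existsNP => H'; apply: H; apply/mem_set.
by rewrite (bigD1 j)//= {1}/weight memNset ?mul0e ?mule0// => -[].
Qed.

End gap_probability.

Section gap_product.
Variable R : realType.
Local Notation leb := (@lebesgue_measure R).
Local Notation R2 := (R * R)%type.
Variables (Q : R2 -> \bar R) (V h : R -> R) (S : set R2) (T dl e0 Vlb : R).
Hypothesis QV : forall z, Q z = (V (modsq z))%:E.
Hypothesis mV : measurable_fun [set: R] V.
Hypothesis clS : closed S.
Hypothesis radS : forall z w, modsq z = modsq w -> S z -> S w.
Hypothesis T0 : 0 < T.
Hypothesis dl0 : 0 < dl.
Hypothesis dV : forall s : R, 0 < s -> is_derive s 1 V (h s / s).
Hypothesis hmono : forall s t : R, 0 < s -> s <= t -> h s <= h t.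
Hypothesis hT : h T = 1.
Hypothesis dh : is_derive T 1 h dl.
Local Notation S' := (sq_section S).
Hypothesis Ssub : forall s, S' s -> 0 < s <= T.
Hypothesis e00 : 0 < e0.
Hypothesis ann : forall s, T - e0 <= s <= T -> S' s.
Hypothesis VlbP : forall s, 0 < s <= T -> Vlb <= V s.

Let mS := measurable_sq_section clS.

Definition mass n k : R := fine (\int[leb]_(s in S') (nwgt V T n k s)%:E)%E.

Lemma mass_pos n k : (k <= n)%N -> 0 < mass n k.
Proof.
move=> kn; rewrite /mass fine_gt0// (mass_gt0 mV T0 dl0 dV hT dh mS Ssub e00 ann kn)/=.
by rewrite ltey_eq (mass_fin mV T0 mS Ssub VlbP).
Qed.

Definition cst_moment n k : R := disc_area R * wgt V n k T.

Lemma cst_moment_gt0 n k : 0 < cst_moment n k.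
Proof. by rewrite mulr_gt0 ?disc_area_gt0// wgtT_gt0. Qed.

Lemma moment_total n (j : 'I_n) :
  moment V S n setT j = (cst_moment n (n - j) * mass n (n - j))%:E.
Proof.
rewrite -{1}(subKn (ltnW (ltn_ord j))) (moment_radial mV clS radS T0 measurableT (leq_subr _ _)).
rewrite setIT [RHS]EFinM /mass fineK//; exact: (mass_fin mV T0 mS Ssub VlbP).
Qed.

Lemma moment_trunc n (j : 'I_n) x : 0 <= x <= e0 -> x <= T / 2 ->
  moment V S n [set s | s <= T - x] j =
  (cst_moment n (n - j) * ((1 - edge_fraction V T dl S' n (n - j) x) * mass n (n - j)))%:E.
Proof.
move=> xe xT.
have mle : measurable [set s : R | s <= T - x].
  rewrite (_ : [set s : R | _] = `]-oo, (T - x)]%classic); first exact: measurable_itv.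
  by apply/seteqP; split => s /=; rewrite in_itv.
have n0 : (0 < n)%N by exact: leq_ltn_trans (ltn_ord j).
rewrite -{1}(subKn (ltnW (ltn_ord j))) (moment_radial mV clS radS T0 mle (leq_subr _ _)).
by rewrite (mass_ratio mV T0 dl0 dV hmono hT dh mS Ssub e00 ann VlbP n0 (leq_subr _ _) xe xT).
Qed.

(** Finite and positive, so that division by it is ordinary division of reals. *)
Lemma partition_functionE n : (0 < n)%N -> exists2 Z, 0 < Z &
  partition_function (localized Q S) n = Z%:E /\
  Z = n`!%:R * \prod_(j < n) (cst_moment n (n - j) * mass n (n - j)).
Proof.
move=> n0; exists (n`!%:R * \prod_(j < n) (cst_moment n (n - j) * mass n (n - j))).
  rewrite mulr_gt0 ?ltr0n ?fact_gt0// prodr_gt0// => j _.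
  by rewrite mulr_gt0 ?cst_moment_gt0 ?mass_pos// leq_subr.
split => //; rewrite /partition_function.
have := integral_gibbs_weight QV mV clS radS n0 (@measurableT _ R).
rewrite (_ : [set t | _] = setT); last by apply/seteqP; split.
move=> ->; rewrite EFinM; congr (_ * _)%E.
by rewrite -prodEFin; apply: eq_bigr => j _; rewrite moment_total.
Qed.

Lemma measurable_gibbs_weight n : (0 < n)%N ->
  measurable_fun [set: n.-tuple R2] (gibbs_weight (localized Q S) (n := n)).
Proof.
move=> n0; rewrite (_ : gibbs_weight _ (n := n) =
    (fun t => (vdm t * \prod_(j < n) weight V S n setT (tnth t j))%:E)); last first.
  by apply/funext => t; rewrite (gibbs_weightE S QV)// prodEFin EFinM.
apply/measurable_EFinP; apply: measurable_funM; first exact: measurable_vdm.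
apply: measurable_prod => j _.
apply: (measurableT_comp (measurable_weight mV clS n measurableT)); exact: measurable_tnth.
Qed.

Lemma gibbs_weight_ge0 n (t : n.-tuple R2) : (0 < n)%N -> (0 <= gibbs_weight (localized Q S) t)%E.
Proof.
move=> n0; rewrite (gibbs_weightE S QV)// prodEFin -EFinM lee_fin mulr_ge0 ?vdm_ge0//.
by apply: prodr_ge0 => j _; exact: weight_ge0.
Qed.

(** Numerator and partition function are products of moments with the same factor n!;
    the ratio of corresponding moments is 1 - edge_fraction. *)
Lemma gap_product n x : (0 < n)%N -> 0 <= x <= e0 -> x <= T / 2 ->
  (\int[power_measure (@area R) n]_(t in [set t : n.-tuple R2 | forall j, (modsq (tnth t j) <= T - x)%R])
     gibbs_density (localized Q S) t =
   (\prod_(k < n) (1 - edge_fraction V T dl S' n k.+1 x))%:E)%E.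
Proof.
move=> n0 xe xT.
have mle : measurable [set s : R | s <= T - x].
  rewrite (_ : [set s : R | _] = `]-oo, (T - x)]%classic); first exact: measurable_itv.
  by apply/seteqP; split => s /=; rewrite in_itv.
have mA := @measurable_tuple_set R n _ mle.
have [Z Z0 [ZE Zr]] := partition_functionE n0.
have IW := integral_gibbs_weight QV mV clS radS n0 mle.
rewrite /gibbs_density -(pmeasE (@area R) n).
under eq_integral do rewrite ZE inver gt_eqF// muleC.
rewrite ge0_integralZl//; first last.
- by rewrite lee_fin invr_ge0 ltW.
- by move=> t _; exact: gibbs_weight_ge0.
- by apply: measurable_funTS; exact: measurable_gibbs_weight.
rewrite [X in (_ * X)%E](_ : _ = (n`!%:R)%:E * \prod_(j < n) moment V S n [set s | (s <= T - x)%R] j)%E; last first.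
  by rewrite -IW -(pmeasE (@area R) n).
under eq_bigr do rewrite (moment_trunc _ xe xT).
rewrite prodEFin -!EFinM; congr EFin.
have P0 : \prod_(j < n) (cst_moment n (n - j) * mass n (n - j)) != 0.
  rewrite gt_eqF// prodr_gt0// => j _.
  by rewrite mulr_gt0 ?cst_moment_gt0 ?mass_pos// leq_subr.
have -> : \prod_(j < n) (cst_moment n (n - j) * ((1 - edge_fraction V T dl S' n (n - j) x) * mass n (n - j))) =
    \prod_(j < n) (1 - edge_fraction V T dl S' n (n - j) x) * \prod_(j < n) (cst_moment n (n - j) * mass n (n - j)).
  by rewrite -big_split/=; apply: eq_bigr => j _; rewrite mulrCA.
rewrite Zr; set P := \prod_(j < n) (_ * _) in P0 *; set U := \prod_(j < n) (1 - _).
have F0 : n`!%:R != 0 :> R by rewrite pnatr_eq0 -lt0n fact_gt0.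
transitivity U; first by field; rewrite F0 P0.
rewrite /U (reindex_inj rev_ord_inj)/=; apply: eq_bigr => k _.
by rewrite subKn.
Qed.

Lemma max_modulus_le n (t : n.-tuple R2) r : 0 <= r ->
  (max_modulus t <= r) <-> (forall j, modsq (tnth t j) <= r ^+ 2).
Proof.
move=> r0.
have E z : (cmod z <= r) = (modsq z <= r ^+ 2) :> bool.
  by rewrite cmodE -[in LHS](ger0_norm r0) -sqrtr_sqr ler_sqrt// sqr_ge0.
split.
  move=> H j; rewrite -E; apply: le_trans H; rewrite /max_modulus.
  by apply: le_bigmax.
by move=> H; apply: bigmax_le => // j _; rewrite E.
Qed.

End gap_product.

(** * The limit law of the spectral radius *)

Lemma measurable_max_modulus (R : realType) n :
  measurable_fun [set: n.-tuple (R * R)] (@max_modulus R n).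
Proof.
have E : @max_modulus R n = fun t => \big[Num.max/0]_(j < n) Num.sqrt (modsq (tnth t j)).
  by apply/funext => t; apply: eq_bigr => j _; rewrite cmodE.
rewrite E; elim: (index_enum _) => [|j s IH].
  by under eq_fun do rewrite big_nil; exact: measurable_cst.
under eq_fun do rewrite big_cons.
apply: measurable_maxr IH; apply: (measurableT_comp (@continuous_sqrt_measurable R)).
exact: (measurableT_comp (@measurable_modsq R) (measurable_tnth _)).
Qed.

Lemma ln4E (R : realType) : ln 4 = 2 * ln 2 :> R.
Proof.
have -> : 4 = 2 ^+ 2 :> R by rewrite expr2; lra.
by rewrite lnXn// mulr_natl.
Qed.

Section limit_law.
Variable R : realType.
Local Notation R2 := (R * R)%type.
Local Notation supp := (@Defs.support R).
Variables (Q : R2 -> \bar R) (q : R -> R).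
Hypothesis Qnoo : forall z, (-oo < Q z)%E.
Hypothesis Qlsc : lower_semicontinuous Q.
Hypothesis Qrad : forall z, 0 < cmod z -> Q z = (q (cmod z))%:E.
Hypothesis qsmooth : forall (k : nat) (r : R), 0 < r -> derivable (derive1n k q) r 1.
Hypothesis Qsub : subharmonic Q.
Hypothesis Qgrowth :
  (2%:E < limf_einf (fun z => Q z / (ln (cmod z))%:E) (@at_infinity R))%E.
Variable sigma : probability R2 R.
Hypothesis eq_sigma : is_equilibrium_measure Q sigma.
Local Notation S := (supp sigma).
Hypothesis Qstrict : forall z, cmod z = outer_radius S ->
  \forall w \near z, 0 < laplacian (fine \o Q) w.
Local Notation T := (mass_quantile q 1).
Local Notation dl := (radial_dens q T).
Local Notation R0 := (Num.sqrt T).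
Variables (d : nat -> measure_display) (Omega : forall n, measurableType (d n)).
Variable P : forall n, probability (Omega n) R.
Variable z : forall n, Omega n -> n.-tuple R2.
Arguments z : clear implicits.
Hypothesis hz : forall n, is_normal_matrix_ensemble (localized Q S) (P n) (z n).

Let T0 : 0 < T := crit_gt0 Qnoo Qlsc Qrad qsmooth Qsub Qgrowth.

Lemma edge_density_gt0 : 0 < dl.
Proof.
have [e /andP[e0 _]] := radial_dens_edge Qnoo Qlsc Qrad qsmooth Qsub Qgrowth eq_sigma Qstrict.
by apply; rewrite lexx andbT gerBl ltW.
Qed.

Lemma ddbar_edge : ddbar (fine \o Q) (outer_radius S, 0) = dl.
Proof.
rewrite (outer_radius_droplet Qnoo Qlsc Qrad qsmooth Qsub Qgrowth eq_sigma) /ddbar.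
have E : modsq (R0, 0 : R) = T by rewrite /modsq/= expr0n/= addr0 sqr_sqrtr// ltW.
rewrite (laplacian_radial Qnoo Qrad qsmooth Qsub) E//.
by rewrite mulrC mulKf.
Qed.

(** The product formula and its limit, specialized to the droplet. The formula p stays
    abstract because the limit law only uses these two properties. *)
Lemma prob_max_modulus_le : exists2 m, 0 < m &
  exists p : nat -> R -> R,
  (forall n x, (0 < n)%N -> 0 <= x <= m ->
    P n [set y | max_modulus (z n y) <= Num.sqrt (T - x)] = (p n x)%:E) /\
  (forall (x_ : nat -> R) (alpha : R), (forall n, 0 <= x_ n) ->
    n%:R * x_ n @[n --> \oo] --> alpha ->
    p n (x_ n) @[n --> \oo] --> expR (- (alpha * dl * ln 2))).
Proof.
have [e1 e10 ann1] := droplet_annulus Qnoo Qlsc Qrad qsmooth Qsub Qgrowth eq_sigma Qstrict.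
pose e0 := Num.min e1 (T / 2).
have e00 : 0 < e0 by rewrite lt_min e10 divr_gt0.
have e0T : e0 <= T / 2 by rewrite ge_min lexx orbT.
have e01 : e0 <= e1 by rewrite ge_min lexx.
have ann s : T - e0 <= s <= T -> sq_section S s.
  move=> /andP[s1 s2]; split; last by apply: ann1; rewrite s2 andbT; lra.
  by have := T0; lra.
have QVE := QV Qnoo Qrad Qsub.
have mV : measurable_fun [set: R] (radial_pot Q).
  by apply: continuous_measurable_fun; exact: (continuous_V Qnoo Qlsc Qrad qsmooth Qsub).
have clS := @closed_support R sigma.
have radS : forall z w, modsq z = modsq w -> S z -> S w.
  exact: (droplet_radial Qnoo Qlsc Qrad qsmooth Qsub eq_sigma).
have dl0 := edge_density_gt0.
have dV := is_derive_V Qrad qsmooth.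
have hmono := radial_mass_nd Qnoo Qlsc Qrad qsmooth Qsub.
have hT := mass_at_crit Qnoo Qlsc Qrad qsmooth Qsub Qgrowth.
have dh := is_derive_h qsmooth T0.
have Ssub s : sq_section S s -> 0 < s <= T.
  move=> [s0 Ss]; rewrite s0/=.
  have := droplet_sub Qnoo Qlsc Qrad qsmooth Qsub Qgrowth eq_sigma Ss.
  by rewrite /modsq/= expr0n/= addr0 sqr_sqrtr// ltW.
have Vlb s : 0 < s <= T -> radial_pot Q 0 <= radial_pot Q s.
  by move=> /andP[/ltW s0 _]; apply: (V_nd Qnoo Qlsc Qrad qsmooth Qsub).
exists e0 => //.
exists (fun n x => \prod_(k < n) (1 - edge_fraction (radial_pot Q) T dl (sq_section S) n k.+1 x)).
split; last first.
  move=> x_ alpha x0 xc.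
  exact: (prod_edge_fraction_cvg mV T0 dl0 dV hmono hT dh (measurable_sq_section clS) Ssub e00 ann Vlb).
move=> n x n0 /andP[x0 xe].
have xT : x <= T / 2 by exact: le_trans e0T.
have xe' : 0 <= x <= e0 by rewrite x0.
rewrite -(gap_product QVE mV clS radS T0 dl0 dV hmono hT dh Ssub e00 ann Vlb n0 xe' xT).
have mle : measurable [set s : R | s <= T - x].
  rewrite (_ : [set s : R | _] = `]-oo, (T - x)]%classic); first exact: measurable_itv.
  by apply/seteqP; split => s /=; rewrite in_itv.
have Tx : 0 <= T - x by have := T0; lra.
rewrite -(hz n).2; last exact: measurable_tuple_set mle.
congr (P n _); apply/seteqP; split => y /=.
  by move=> /(max_modulus_le _ (sqrtr_ge0 _)) H j; have := H j; rewrite sqr_sqrtr.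
by move=> H; apply/(max_modulus_le _ (sqrtr_ge0 _)) => j; rewrite sqr_sqrtr.
Qed.

Definition scaled_edge n (y : Omega n) : R :=
  R0 * n%:R * dl * (max_modulus (z n y) - R0) * ln 4.
Arguments scaled_edge : clear implicits.

Lemma measurable_scaled_edge n xi : measurable [set y | scaled_edge n y <= xi].
Proof.
have m : measurable_fun [set: Omega n] (scaled_edge n).
  apply: measurable_funM; last exact: measurable_cst.
  apply: measurable_funM; first exact: measurable_cst.
  apply: measurable_funB; last exact: measurable_cst.
  exact: (measurableT_comp (@measurable_max_modulus R n) (hz n).1).
rewrite (_ : [set y | _] = (scaled_edge n) @^-1` `]-oo, xi]%classic).
  by rewrite -[X in measurable X]setTI; apply: m => //; exact: measurable_itv.
by apply/seteqP; split => y /=; rewrite in_itv.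
Qed.

Lemma scaled_edge_cdf_nd n :
  {homo (fun xi => fine (P n [set y | scaled_edge n y <= xi])) : x y / x <= y}.
Proof.
move=> x y xy; apply: fine_le.
- by apply: fin_num_measure; exact: measurable_scaled_edge.
- by apply: fin_num_measure; exact: measurable_scaled_edge.
apply: le_measure; [exact/mem_set/measurable_scaled_edge..|].
by move=> w /= H; exact: le_trans xy.
Qed.

(** The event omega_n <= xi is |z|_n <= R_0 + c/(R_0 n) with c = xi/(delta ln 4), that
    is |z|^2 <= T - x_n with n x_n -> - 2c. *)
Lemma scaled_edge_cdf_cvg xi : xi <= 0 ->
  fine (P n [set y | scaled_edge n y <= xi]) @[n --> \oo] --> expR xi.
Proof.
move=> xi0; have [m m0 [p [pE pc]]] := prob_max_modulus_le.
have dl0 := edge_density_gt0.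
have l4 : 0 < ln 4 :> R by rewrite ln_gt0// ltr1n.
have l2 : 0 < ln 2 :> R by rewrite ln_gt0// ltr1n.
have R00 : 0 < R0 by rewrite sqrtr_gt0.
have RT : R0 ^+ 2 = T by rewrite sqr_sqrtr// ltW.
pose c := xi / (dl * ln 4).
have c0 : c <= 0 by rewrite ler_pdivrMr ?mul0r// mulr_gt0.
pose r n := R0 + c / (R0 * n%:R).
have rE n : (0 < n)%N -> T - r n ^+ 2 = (- 2 * c - c ^+ 2 / T / n%:R) / n%:R.
  move=> n0; have -> : c ^+ 2 / T = c ^+ 2 / R0 ^+ 2 by rewrite RT.
  have -> : T - r n ^+ 2 = R0 ^+ 2 - r n ^+ 2 by rewrite RT.
  rewrite /r; have nn : n%:R != 0 :> R by rewrite pnatr_eq0 -lt0n.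
  by field; rewrite nn gt_eqF.
have inv0 : n%:R^-1 @[n --> \oo] --> (0 : R).
  by apply/gtr0_cvgV0; [near=> n; rewrite ltr0n; near: n; exact: nbhs_infty_gt|exact: cvgr_idn].
have far (B : R) : 0 < B -> \forall n \near \oo, [/\ (0 < n)%N, B / n%:R < 1 & B < n%:R].
  move=> B0; near=> n; have n0 : (0 < n)%N by near: n; exact: nbhs_infty_gt.
  have Bn : B < n%:R by near: n; exact: nbhs_infty_gtr.
  by split => //; rewrite ltr_pdivrMr ?ltr0n// mul1r.
(* Beyond B the radius is nonnegative and T minus its square lies in [0, m]. *)
pose B := 1 + (- c / T) + 2 * (- c / m).
have cT : 0 <= - c / T by apply: divr_ge0; [rewrite oppr_ge0|exact: ltW].
have cm : 0 <= - c / m by apply: divr_ge0; [rewrite oppr_ge0|exact: ltW].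
have B0 : 0 < B by rewrite /B; lra.
(* The maximum only affects finitely many n; it makes x nonnegative for all of them. *)
pose x n := Num.max 0 (T - r n ^+ 2).
have good : \forall n \near \oo,
    [/\ (0 < n)%N, 0 <= r n & 0 <= T - r n ^+ 2 <= m].
  apply: filterS (far B B0) => n [n0 _ Bn].
  have nn : 0 < n%:R :> R by rewrite ltr0n.
  have cn : - c / T / n%:R <= 1.
    rewrite ler_pdivrMr// mul1r; apply: le_trans (ltW Bn).
    by rewrite /B; lra.
  split => //.
    have -> : r n = R0 * (1 - (- c / T / n%:R)).
      have -> : - c / T = - c / R0 ^+ 2 by rewrite RT.
      by rewrite /r; field; rewrite !gt_eqF.
    by rewrite mulr_ge0 ?subr_ge0// ltW.
  rewrite rE//; apply/andP; split.
    have -> : (- 2 * c - c ^+ 2 / T / n%:R) = - c * (2 - (- c / T / n%:R)) by ring.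
    by rewrite divr_ge0 ?mulr_ge0 ?oppr_ge0//; lra.
  rewrite ler_pdivrMr//; apply: (@le_trans _ _ (- 2 * c)).
    by rewrite gerBl !divr_ge0 ?sqr_ge0// ltW.
  have : - 2 * c / m <= n%:R.
    apply: le_trans (ltW Bn); rewrite /B; lra.
  by rewrite ler_pdivrMr// [m * _]mulrC.
have x0 n : 0 <= x n by rewrite le_max lexx.
have xc : n%:R * x n @[n --> \oo] --> - 2 * c.
  have L : (- 2 * c - c ^+ 2 / T * n%:R^-1) @[n --> \oo] --> - 2 * c.
    rewrite -[X in _ --> X]subr0 -(mulr0 (c ^+ 2 / T)).
    by apply: cvgB; [exact: cvg_cst|apply: cvgM; [exact: cvg_cst|exact: inv0]].
  apply: cvg_trans L; apply: near_eq_cvg; apply: filterS good => n [n0 _ /andP[y0 _]].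
  by rewrite /x max_r// rE// [RHS]mulrC divfK// pnatr_eq0 -lt0n.
have := pc x _ x0 xc.
have -> : - (- 2 * c * dl * ln 2) = xi.
  by rewrite /c ln4E; field; rewrite !gt_eqF.
apply: cvg_trans; apply: near_eq_cvg; apply: filterS good => n [n0 r0 y0].
rewrite /x max_r; last by case/andP: y0.
have := pE n _ n0 y0; rewrite subKr sqrtr_sqr ger0_norm// => E.
rewrite (_ : [set y | _] = [set y | max_modulus (z n y) <= r n]) ?E//.
have nn : 0 < n%:R :> R by rewrite ltr0n.
have k0 : 0 < R0 * n%:R * dl * ln 4 by rewrite !mulr_gt0.
have E' y : (scaled_edge n y <= xi) = (max_modulus (z n y) <= r n).
  rewrite /scaled_edge (_ : _ * ln 4 = (max_modulus (z n y) - R0) * (R0 * n%:R * dl * ln 4)); last by ring.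
  rewrite -ler_pdivlMr// lerBlDl /r /c; congr (_ <= _ + _).
  by field; rewrite !gt_eqF.
by apply/seteqP; split => y /=; rewrite E'.
Unshelve. all: by end_near.
Qed.

End limit_law.

Theorem theorem1p2 (R : realType) (Q : R * R -> \bar R) (q : R -> R)
    (S : set (R * R))
    (hQ_codomain : forall z, (-oo < Q z)%E)
    (hQ_lsc : lower_semicontinuous Q)
    (hQ_finite : (0 < area [set z | (Q z < +oo)%E])%E)
    (hQ_growth :
      (2%:E < limf_einf (fun z => Q z / (ln (cmod z))%:E) (@at_infinity R))%E)
    (hS : is_droplet Q S)
    (hQ_radial : forall z, 0 < cmod z -> Q z = (q (cmod z))%:E)
    (hq_smooth : forall (k : nat) (r : R), 0 < r -> derivable (derive1n k q) r 1)
    (hQ_subharmonic : subharmonic Q)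
    (hQ_strict : forall z, cmod z = outer_radius S ->
      \forall w \near z, 0 < laplacian (fine \o Q) w)
    (d : nat -> measure_display) (Omega : forall n, measurableType (d n))
    (P : forall n, probability (Omega n) R)
    (z : forall n, Omega n -> n.-tuple (R * R)%type)
    (hz : forall n, is_normal_matrix_ensemble (localized Q S) (P n) (z n)) :
  let R0 := outer_radius S in
  let delta := ddbar (fine \o Q) (R0, 0) in
  let omega n (x : Omega n) : R :=
    R0 * n%:R * delta * (max_modulus (z n x) - R0) * ln 4 in
  forall K : set R, compact K -> K `<=` [set xi | xi <= 0] ->
    {uniform K,
      (fun (n : nat) (xi : R) => fine (P n [set x | omega n x <= xi])) @ \oo
      --> @expR R}.
Proof.
move=> R0 delta omega K cK K0.
have [sigma es SE] := hS; subst S.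
have dE := ddbar_edge hQ_codomain hQ_lsc hQ_radial hq_smooth hQ_subharmonic hQ_growth es.
have rE := outer_radius_droplet hQ_codomain hQ_lsc hQ_radial hq_smooth hQ_subharmonic hQ_growth es.
have oE : omega = @scaled_edge R q d Omega z.
  by apply: functional_extensionality_dep => n; apply/funext => y; rewrite /omega /delta dE /R0 rE.
rewrite oE; apply: uniform_expR => //.
- by move=> n; exact: scaled_edge_cdf_nd hz n.
- by move=> xi xi0; exact: (scaled_edge_cdf_cvg hQ_codomain hQ_lsc hQ_radial hq_smooth hQ_subharmonic hQ_growth es hQ_strict hz).
Qed.
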